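(* For every sentence $\varphi$ in the language $\{\in,\mathbb{A}\}$ of set theory with atoms, $$ZFA+AC^{pure}\ \vdash\ \varphi^{PM(\mathcal{V}(\mathbb{A}),Sym(\mathbb{A}),\mathcal{F}^{Sym(\mathbb{A})}_{fin})}\leftrightarrow\varphi^{PM(\langle\mathbb{N}\rangle)},$$ where $\mathcal{V}(\mathbb{A})$ is the whole universe, $\mathbb{A}$ (the set of atoms) is infinite, and $\langle\mathbb{N}\rangle$ is the structure on $\mathbb{N}$ in the language of pure equality. That is, if $ZFA+AC^{pure}$ holds then $PM(\mathcal{V}(\mathbb{A}),Sym(\mathbb{A}),\mathcal{F}^{Sym(\mathbb{A})}_{fin})\equiv PM(\langle\mathbb{N}\rangle)$.
   Context: $ZFA$ is set theory with atoms in the language $\{\in,\mathbb{A}\}$ ($\mathbb{A}$ a unary predicate): the axioms of $ZF$ with extensionality restricted to non-atoms (''sets''), plus: atoms have no elements, and the atoms form a set, also denoted $\mathbb{A}$, which is assumed infinite. A set is pure if neither it nor any element of its transitive closure is an atom; $\mathcal{V}$ is the class of pure sets, and $AC^{pure}$ says that the axiom of choice holds in $\mathcal{V}$. For a class $U$ (with given interpretations of $\in$ and $\mathbb{A}$), $\varphi^U$ is the relativisation of $\varphi$ to $U$. Every $\pi\in Sym(\mathbb{A})$ (bijections of $\mathbb{A}$) extends to the universe by $\pi(x)=\{\pi(y):y\in x\}$ for sets $x$. For $G\leqslant Sym(\mathbb{A})$, $G_x=\{\pi\in G:\pi(x)=x\}$. $\mathcal{F}^G_{fin}$ is the set of subgroups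 $H\leqslant G$ with $G_{\mathbf a}\leqslant H$ for some finite tuple $\mathbf{a}\in\mathbb{A}^{<\omega}$. $PM(\mathcal{M},G,\mathcal{F})$ is the class of $x\in\mathcal{M}$ such that $G_y\in\mathcal{F}$ for all $y\in TC(\{x\})$ ($TC$ = transitive closure), computed in $\mathcal{M}$. Definition of $PM(\mathcal{A}^* )$ for a pure structure $\mathcal{A}^*$ with underlying set $x\in\mathcal V$. Define $\mathcal{V}^*(x)=\bigcup_\alpha\mathcal{V}^*(x)_\alpha$ by $\mathcal{V}^*(x)_0=x\times\{1\}$, $\mathcal{V}^*(x)_{\alpha+1}=(\mathcal{P}(\mathcal{V}^*(x)_\alpha)\times\{0\})\cup\mathcal{V}^*(x)_\alpha$, unions at limits. Its membership relation is $w\mathrel{\dot\in}y\iff y=\langle z,0\rangle$ for some $z$ with $w\in z$, and its atoms are the elements of the form $\langle z,1\rangle$. With these relations it is a model of $ZFA$ whose pure universe is isomorphic to $\mathcal{V}$ via $F(y)=\langle\{F(z):z\in y\},0\rangle$. Let $\underline{\mathcal{A}^*}\in\mathcal{V}^*(x)$ be the structure on the set of atoms of $\mathcal{V}^*(x)$ obtained by transporting $F(\mathcal{A}^* )$ along the bijection $F(a)\mapsto\langle a,1\rangle$, $a\in x$. Then $PM(\mathcal{A}^* ):=PM(\mathcal{V}^*(x),Aut(\underline{\mathcal{A}^*}),\mathcal{F}^{Aut(\underline{\mathcal{A}^*})}_{fin})$, computed in $\mathcal{V}^*(x)$, with membership $\dot\in$ and the atoms of $\mathcal V^*(x)$. 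*)

(* Defs.v *)
From Stdlib Require List.
From mathcomp Require Import all_boot.

Set Implicit Arguments.
Unset Strict Implicit.
Unset Printing Implicit Defensive.

(** * First-order logic with equality over the language {∈, 𝔸} *)

(* Terms are variables, represented by de Bruijn indices. *)
Inductive formula : Type :=
| fIn of nat & nat
| fAtom of nat
| fEq of nat & nat
| fBot
| fImp of formula & formula
| fAnd of formula & formula
| fOr of formula & formula
| fAll of formula
| fEx of formula.

Definition fNot (φ : formula) : formula := fImp φ fBot.
Definition fIff (φ ψ : formula) : formula := fAnd (fImp φ ψ) (fImp ψ φ).

(* Bounded quantifiers: [x] lives outside the binder. *)
Definition fAllIn (x : nat) (φ : formula) : formula := fAll (fImp (fIn 0 x.+1) φ).
Definition fExIn (x : nat) (φ : formula) : formula := fEx (fAnd (fIn 0 x.+1) φ).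

Declare Scope form_scope.
Delimit Scope form_scope with F.
Bind Scope form_scope with formula.
Notation "x ∈ y" := (fIn x y) (at level 70, no associativity) : form_scope.
Notation "x ≐ y" := (fEq x y) (at level 70, no associativity) : form_scope.
Notation "¬ φ" := (fNot φ) (at level 75, right associativity) : form_scope.
Notation "φ ∧ ψ" := (fAnd φ ψ) (at level 80, right associativity) : form_scope.
Notation "φ ∨ ψ" := (fOr φ ψ) (at level 85, right associativity) : form_scope.
Notation "φ ↔ ψ" := (fIff φ ψ) (at level 95, no associativity) : form_scope.
Notation "φ → ψ" := (fImp φ ψ)
  (at level 99, ψ at level 200, right associativity) : form_scope.
Notation "∀ φ" := (fAll φ) (at level 10, φ at level 200) : form_scope.
Notation "∃ φ" := (fEx φ) (at level 10, φ at level 200) : form_scope.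
Notation "∀∈ x , φ" := (fAllIn x φ)
  (at level 10, x at level 9, φ at level 200) : form_scope.
Notation "∃∈ x , φ" := (fExIn x φ)
  (at level 10, x at level 9, φ at level 200) : form_scope.

Local Open Scope form_scope.

Definition scons {T : Type} (x : T) (s : nat -> T) (i : nat) : T :=
  if i is j.+1 then s j else x.

Definition up (r : nat -> nat) : nat -> nat := scons 0 (fun i => (r i).+1).

Fixpoint ren (r : nat -> nat) (φ : formula) : formula :=
  match φ with
  | fIn i j => fIn (r i) (r j)
  | fAtom i => fAtom (r i)
  | fEq i j => fEq (r i) (r j)
  | fBot => fBot
  | fImp φ ψ => fImp (ren r φ) (ren r ψ)
  | fAnd φ ψ => fAnd (ren r φ) (ren r ψ)
  | fOr φ ψ => fOr (ren r φ) (ren r ψ)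
  | fAll φ => fAll (ren (up r) φ)
  | fEx φ => fEx (ren (up r) φ)
  end.

Definition shift : formula -> formula := ren S.

(* [instvar x φ] instantiates the variable 0 of [φ] with the variable [x]. *)
Definition instvar (x : nat) : formula -> formula := ren (scons x id).

(* All free variables of [φ] are smaller than [n]. *)
Fixpoint bounded (n : nat) (φ : formula) : bool :=
  match φ with
  | fIn i j => (i < n) && (j < n)
  | fAtom i => i < n
  | fEq i j => (i < n) && (j < n)
  | fBot => true
  | fImp φ ψ => bounded n φ && bounded n ψ
  | fAnd φ ψ => bounded n φ && bounded n ψ
  | fOr φ ψ => bounded n φ && bounded n ψ
  | fAll φ => bounded n.+1 φ
  | fEx φ => bounded n.+1 φ
  end.

Definition sentence (φ : formula) : Prop := bounded 0 φ.

(* Classical natural deduction with equality. *)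
Inductive derives : seq formula -> formula -> Prop :=
| d_ctx Γ φ : List.In φ Γ -> derives Γ φ
| d_raa Γ φ : derives ((¬ φ) :: Γ) fBot -> derives Γ φ
| d_impI Γ φ ψ : derives (φ :: Γ) ψ -> derives Γ (φ → ψ)
| d_impE Γ φ ψ : derives Γ (φ → ψ) -> derives Γ φ -> derives Γ ψ
| d_andI Γ φ ψ : derives Γ φ -> derives Γ ψ -> derives Γ (φ ∧ ψ)
| d_andE1 Γ φ ψ : derives Γ (φ ∧ ψ) -> derives Γ φ
| d_andE2 Γ φ ψ : derives Γ (φ ∧ ψ) -> derives Γ ψ
| d_orI1 Γ φ ψ : derives Γ φ -> derives Γ (φ ∨ ψ)
| d_orI2 Γ φ ψ : derives Γ ψ -> derives Γ (φ ∨ ψ)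
| d_orE Γ φ ψ χ : derives Γ (φ ∨ ψ) -> derives (φ :: Γ) χ -> derives (ψ :: Γ) χ ->
    derives Γ χ
| d_allI Γ φ : derives (map shift Γ) φ -> derives Γ (∀ φ)
| d_allE Γ φ x : derives Γ (∀ φ) -> derives Γ (instvar x φ)
| d_exI Γ φ x : derives Γ (instvar x φ) -> derives Γ (∃ φ)
| d_exE Γ φ ψ : derives Γ (∃ φ) -> derives (φ :: map shift Γ) (shift ψ) ->
    derives Γ ψ
| d_eqI Γ x : derives Γ (x ≐ x)
| d_eqE Γ φ x y : derives Γ (x ≐ y) -> derives Γ (instvar x φ) -> derives Γ (instvar y φ).

Definition provable (T : formula -> Prop) (φ : formula) : Prop :=
  exists Γ : seq formula, (forall ψ, List.In ψ Γ -> T ψ) /\ derives Γ φ.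

Notation "T ⊢ φ" := (provable T φ%F) (at level 100, no associativity).

(** * Interpretations and relativisation *)

(* A definable class with definable interpretations of ∈ and 𝔸; the arguments
   of the three fields are the names of the free variables. *)
Record interp : Type := Interp {
  carrier : nat -> formula;
  mem_rel : nat -> nat -> formula;
  atom_rel : nat -> formula
}.

Fixpoint relativize (U : interp) (φ : formula) : formula :=
  match φ with
  | fIn i j => mem_rel U i j
  | fAtom i => atom_rel U i
  | fEq i j => fEq i j
  | fBot => fBot
  | fImp φ ψ => fImp (relativize U φ) (relativize U ψ)
  | fAnd φ ψ => fAnd (relativize U φ) (relativize U ψ)
  | fOr φ ψ => fOr (relativize U φ) (relativize U ψ)
  | fAll φ => fAll (fImp (carrier U 0) (relativize U φ))
  | fEx φ => fEx (fAnd (carrier U 0) (relativize U φ))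
  end.

(** * Set-theoretic vocabulary

   In the formulas below the arguments [x y z ...] are variables of the ambient
   context; under [k] binders they are written [x.+k], and [0] is the innermost
   bound variable. *)

Definition isSet x := ¬ fAtom x.
Definition isSubset x y := ∀∈ x, 0 ∈ y.+1.
Definition isEmpty x := isSet x ∧ ∀ ¬ 0 ∈ x.+1.
(* z = {x, y} *)
Definition isUPair z x y := isSet z ∧ ∀ (0 ∈ z.+1 ↔ 0 ≐ x.+1 ∨ 0 ≐ y.+1).
(* z = ⟨x, y⟩ = {{x}, {x, y}} *)
Definition isOPair z x y :=
  ∃ ∃ (isUPair 1 x.+2 x.+2 ∧ isUPair 0 x.+2 y.+2 ∧ isUPair z.+2 1 0).
(* s = x ∪ {x} *)
Definition isSucc s x := isSet s ∧ ∀ (0 ∈ s.+1 ↔ 0 ∈ x.+1 ∨ 0 ≐ x.+1).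
Definition isTrans x := ∀∈ x, isSubset 0 x.+1.
(* x is an ordinal: given Foundation, a transitive set of transitive sets *)
Definition isOrd x := isSet x ∧ isTrans x ∧ ∀∈ x, (isSet 0 ∧ isTrans 0).
Definition isLimit x := isOrd x ∧ ¬ isEmpty x ∧ ¬ ∃ isSucc x.+1 0.
Definition isInductive x :=
  (∃∈ x, isEmpty 0) ∧ ∀∈ x, ∃∈ x.+1, isSucc 0 1.
Definition isOmega x :=
  isSet x ∧ isInductive x ∧ ∀ (isInductive 0 → isSubset x.+1 0).

(* ⟨x, y⟩ ∈ f *)
Definition pairIn f x y := ∃∈ f, isOPair 0 x.+1 y.+1.
(* f is a function with domain d *)
Definition isFun f d :=
  isSet f
  ∧ (∀∈ f, ∃∈ d.+1, ∃ isOPair 2 1 0)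
  ∧ (∀∈ d, ∃ pairIn f.+2 1 0)
  ∧ ∀ ∀ ∀ (pairIn f.+3 2 1 → pairIn f.+3 2 0 → 1 ≐ 0).
Definition isMap f a b := isFun f a ∧ ∀ ∀ (pairIn f.+2 1 0 → 0 ∈ b.+2).
Definition isBij f a b :=
  isMap f a b
  ∧ (∀ ∀ ∀ (pairIn f.+3 2 0 → pairIn f.+3 1 0 → 2 ≐ 1))
  ∧ ∀∈ b, ∃∈ a.+1, pairIn f.+2 0 1.
(* c = p ∘ q *)
Definition isComp c p q :=
  isSet c
  ∧ ∀ (0 ∈ c.+1 ↔ ∃ ∃ ∃ (isOPair 3 2 0 ∧ pairIn q.+4 2 1 ∧ pairIn p.+4 1 0)).
(* q is the converse of p *)
Definition isInv q p :=
  isSet q ∧ ∀ (0 ∈ q.+1 ↔ ∃ ∃ (isOPair 2 0 1 ∧ pairIn p.+3 1 0)).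

Definition isFinSet x := ∃ (isOmega 0 ∧ ∃∈ 0, ∃ isBij 0 1 x.+3).
(* s ∈ x^{<ω} *)
Definition isTuple s x := ∃ (isOmega 0 ∧ ∃∈ 0, isMap s.+2 0 x.+2).

(* t = TC(x) *)
Definition isTC t x :=
  isSet t ∧ isTrans t ∧ isSubset x t
  ∧ ∀ (isSet 0 ∧ isTrans 0 ∧ isSubset x.+1 0 → isSubset t.+1 0).
(* t = TC({x}) *)
Definition isTCsing t x := ∃ (isUPair 0 x.+1 x.+1 ∧ isTC t.+1 0).
Definition isPure x := isSet x ∧ ∃ (isTC 0 x.+1 ∧ ∀∈ 0, isSet 0).
Definition isAtoms a := isSet a ∧ ∀ (0 ∈ a.+1 ↔ fAtom 0).

(** * The theory ZFA + AC^pure *)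

Definition axExt :=
  ∀ ∀ (isSet 1 → isSet 0 → (∀ (0 ∈ 2 ↔ 0 ∈ 1)) → 1 ≐ 0).
Definition axFound := ∀ ((∃ 0 ∈ 1) → ∃∈ 0, ∀∈ 1, ¬ 0 ∈ 1).
Definition axPair := ∀ ∀ ∃ isUPair 0 2 1.
Definition axUnion := ∀ ∃ (isSet 0 ∧ ∀ (0 ∈ 1 ↔ ∃∈ 2, 1 ∈ 0)).
Definition axPower := ∀ ∃ (isSet 0 ∧ ∀ (0 ∈ 1 ↔ isSet 0 ∧ isSubset 0 2)).
Definition axInf := ∃ (isSet 0 ∧ isInductive 0).
(* In [φ], 0 is the element and 1, 2, ... are parameters. *)
Definition axSep (φ : formula) :=
  ∀ ∃ (isSet 0
       ∧ ∀ (0 ∈ 1 ↔ 0 ∈ 2 ∧ ren (scons 0 (fun i => i.+3)) φ)).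
(* In [φ], 1 is the argument, 0 its value and 2, 3, ... are parameters. *)
Definition axRepl (φ : formula) :=
  ∀ ((∀∈ 0, ∀ ∀ (ren (scons 1 (scons 2 (fun i => i.+4))) φ →
                 ren (scons 0 (scons 2 (fun i => i.+4))) φ → 1 ≐ 0)) →
     ∃ (isSet 0
        ∧ ∀ (0 ∈ 1 ↔
             ∃∈ 2, ren (scons 1 (scons 0 (fun i => i.+4))) φ))).
Definition axAtomEmpty := ∀ (fAtom 0 → ∀ ¬ 0 ∈ 1).
Definition axAtomSet := ∃ isAtoms 0.
Definition axAtomInf := ∀ (isAtoms 0 → ¬ isFinSet 0).

(* The schemes are universally closed over their parameters. *)
Inductive ZFA : formula -> Prop :=
| ZFA_ext : ZFA axExt
| ZFA_found : ZFA axFound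
| ZFA_pair : ZFA axPair
| ZFA_union : ZFA axUnion
| ZFA_power : ZFA axPower
| ZFA_inf : ZFA axInf
| ZFA_sep n φ : bounded n (axSep φ) -> ZFA (iter n fAll (axSep φ))
| ZFA_repl n φ : bounded n (axRepl φ) -> ZFA (iter n fAll (axRepl φ))
| ZFA_atomEmpty : ZFA axAtomEmpty
| ZFA_atomSet : ZFA axAtomSet
| ZFA_atomInf : ZFA axAtomInf.

(* Every set of nonempty sets has a choice function. *)
Definition axAC :=
  ∀ ((∀∈ 0, ∃ 0 ∈ 1) →
     ∃ (isFun 0 1 ∧ ∀∈ 1, ∀ (pairIn 2 1 0 → 0 ∈ 1))).

Definition PureU : interp := Interp isPure fIn fAtom.
Definition ACpure : formula := relativize PureU axAC.

Definition ZFA_ACpure (φ : formula) : Prop := ZFA φ \/ φ = ACpure.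

(** * Permutation models *)

(* g = Sym(𝔸) *)
Definition isSymAtoms g :=
  ∃ (isAtoms 0 ∧ isSet g.+1 ∧ ∀ (0 ∈ g.+2 ↔ isBij 0 1 1)).

(* π(x) = y: the recursion π(x) = {π(z) : z ∈ x} is witnessed by a function
   on TC({x}). *)
Definition isAct π x y :=
  ∃ ∃ (isTCsing 1 x.+2 ∧ isFun 0 1
       ∧ (∀∈ 1, ∀ (pairIn 2 1 0 →
            (fAtom 1 → pairIn π.+4 1 0)
            ∧ (isSet 1 → isSet 0 ∧ ∀ (0 ∈ 1 ↔ ∃∈ 2, pairIn 4 0 1))))
       ∧ pairIn 0 x.+2 y.+2).

(* h = g_x *)
Definition isStab h g x :=
  isSet h ∧ ∀ (0 ∈ h.+1 ↔ 0 ∈ g.+1 ∧ isAct 0 x.+1 x.+1).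

Definition isSubgroup h g :=
  isSet h ∧ isSubset h g ∧ (∃ 0 ∈ h.+1)
  ∧ (∀∈ h, ∀∈ h.+1, ∀ (isComp 0 2 1 → 0 ∈ h.+3))
  ∧ ∀∈ h, ∀ (isInv 0 1 → 0 ∈ h.+2).

(* F = the set of subgroups h of g containing g_s for some s ∈ 𝔸^{<ω} *)
Definition isFfin F g :=
  isSet F
  ∧ ∀ (0 ∈ F.+1 ↔
       isSubgroup 0 g.+1
       ∧ ∃ ∃ ∃ (isAtoms 0 ∧ isTuple 2 0 ∧ isStab 1 g.+4 2 ∧ isSubset 1 3)).

(* g_y ∈ F for all y ∈ TC({x}) *)
Definition inPM g F x :=
  ∃ (isTCsing 0 x.+1 ∧ ∀∈ 0, ∃ (isStab 0 g.+3 1 ∧ 0 ∈ F.+3)).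

(* PM(𝒱(𝔸), Sym(𝔸), ℱ_fin) *)
Definition PM_Sym : interp :=
  Interp (fun x => ∃ ∃ (isSymAtoms 1 ∧ isFfin 0 1 ∧ inPM 1 0 x.+2))
         fIn fAtom.

(** * Structures

   A structure is a pair ⟨x, r⟩, where r is a function on a set of symbols whose
   values are sets of finite tuples of elements of x; equality is logical. *)

(* g = Aut(s) *)
Definition isAut g s :=
  ∃ ∃ (isOPair s.+2 1 0 ∧ isSet g.+2
       ∧ ∀ (0 ∈ g.+3 ↔
            isBij 0 2 2
            ∧ ∀ ∀ (pairIn 3 1 0 →
                 ∀ ∀ (isTuple 1 6 → isComp 0 4 1 → (1 ∈ 2 ↔ 0 ∈ 2))))).

(* s' is the structure obtained by transporting s along the bijection b *)
Definition isTransport s' s b :=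
  ∃ ∃ ∃ ∃ (isOPair s.+4 3 2 ∧ isOPair s'.+4 1 0 ∧ isBij b.+4 3 1
       ∧ (∃ (isFun 3 0 ∧ isFun 1 0))
       ∧ ∀ ∀ ∀ (pairIn 5 2 1 → pairIn 3 2 0 →
            isSet 0 ∧ ∀ (0 ∈ 1 ↔ ∃∈ 2, isComp 1 b.+4.+4.+1 0))).

(* s = ⟨ℕ⟩, the structure with universe ω and no symbols *)
Definition isPureEqN s := ∃ ∃ (isOmega 1 ∧ isEmpty 0 ∧ isOPair s.+2 1 0).

(** * The models 𝒱⋆(x) *)

(* y = ⟨z, 0⟩ *)
Definition isTag0 y z := ∃ (isEmpty 0 ∧ isOPair y.+1 z.+1 0).
(* y = ⟨z, 1⟩, where 1 = {0} *)
Definition isTag1 y z :=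
  ∃ ∃ (isEmpty 1 ∧ isUPair 0 1 1 ∧ isOPair y.+2 z.+2 0).

(* v = x × {1} *)
Definition isVzero v x := isSet v ∧ ∀ (0 ∈ v.+1 ↔ ∃∈ x.+1, isTag1 1 0).
(* v = (𝒫(u) × {0}) ∪ u *)
Definition isVsucc v u :=
  isSet v
  ∧ ∀ (0 ∈ v.+1 ↔
       (∃ (isSet 0 ∧ isSubset 0 u.+2 ∧ isTag0 1 0)) ∨ 0 ∈ u.+1).
(* v = 𝒱⋆(x)_α, witnessed by the sequence ⟨𝒱⋆(x)_β : β ≤ α⟩ *)
Definition isVlevel x α v :=
  ∃ ∃ (isSucc 0 α.+2 ∧ isFun 1 0
       ∧ (∀∈ 0, ∀ (pairIn 3 1 0 →
            (isEmpty 1 → isVzero 0 x.+4)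
            ∧ (∀ ∀ (isSucc 3 1 → pairIn 5 1 0 → isVsucc 2 0))
            ∧ (isLimit 1 →
                 isSet 0 ∧ ∀ (0 ∈ 1 ↔ ∃∈ 2, ∃ (pairIn 6 1 0 ∧ 2 ∈ 0)))))
       ∧ pairIn 1 α.+2 v.+2).
(* y ∈ 𝒱⋆(x) *)
Definition inVstar x y := ∃ ∃ (isOrd 1 ∧ isVlevel x.+2 1 0 ∧ y.+2 ∈ 0).

(* z = F(y), where F(y) = ⟨{F(w) : w ∈ y}, 0⟩, witnessed by a function on
   TC({y}) *)
Definition isF y z :=
  ∃ ∃ (isTCsing 1 y.+2 ∧ isFun 0 1
       ∧ (∀∈ 1, ∀ (pairIn 2 1 0 →
            ∃ (isTag0 1 0 ∧ isSet 0 ∧ ∀ (0 ∈ 1 ↔ ∃∈ 3, pairIn 5 0 1))))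
       ∧ pairIn 0 y.+2 z.+2).

(* Below, [D s] says that s is the pure structure 𝒜⋆, with underlying set x. *)

(* 𝒱⋆(x) with its membership and its atoms *)
Definition Vstar (D : nat -> formula) : interp :=
  Interp (fun y => ∃ ∃ ∃ (D 2 ∧ isOPair 2 1 0 ∧ inVstar 1 y.+3))
         (fun w y => ∃ (isTag0 y.+1 0 ∧ w.+1 ∈ 0))
         (fun y => ∃ isTag1 y.+1 0).

(* u is the transport of F(𝒜⋆), computed in 𝒱⋆(x), along the bijection
   b ∈ 𝒱⋆(x), F(a) ↦ ⟨a, 1⟩.  Bound variables: 4 = 𝒜⋆, 3 = its underlying set x,
   2 = its relations, 1 = F(𝒜⋆), 0 = b. *)
Definition isUnderline (D : nat -> formula) u :=
  ∃ ∃ ∃ ∃ ∃ (D 4 ∧ isOPair 4 3 2 ∧ isF 4 1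
       ∧ carrier (Vstar D) 1 ∧ carrier (Vstar D) 0 ∧ carrier (Vstar D) u.+4.+1
       ∧ (∃ (isF 4 0 ∧ relativize (Vstar D) (isFun 1 0)))
       ∧ (∀∈ 3, ∀ ∀ (isF 2 1 → isTag1 0 2 → relativize (Vstar D) (pairIn 3 1 0)))
       ∧ relativize (Vstar D) (isTransport u.+4.+1 1 0)).

(* PM(𝒜⋆).  Bound variables: 2 = the transported structure, 1 = its automorphism
   group, 0 = the filter. *)
Definition PM_str (D : nat -> formula) : interp :=
  Interp (fun y =>
            ∃ ∃ ∃ (carrier (Vstar D) y.+3 ∧ carrier (Vstar D) 2
                   ∧ carrier (Vstar D) 1 ∧ carrier (Vstar D) 0
                   ∧ isUnderline D 2
                   ∧ relativize (Vstar D) (isAut 1 2)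
                   ∧ relativize (Vstar D) (isFfin 0 1)
                   ∧ relativize (Vstar D) (inPM 1 0 y.+3)))
         (mem_rel (Vstar D)) (atom_rel (Vstar D)).

(* Main.v *)
(** By completeness, one may argue inside a model of ZFA.  There, both permutation
models are symmetric universes: well-founded classes over an infinite set of
atoms, acted on by all permutations of the atoms, every element having a finite
support and every symmetric set of elements being an element.  A finite partial
injection p between the two sets of atoms makes every x supported by dom p
correspond to an element p·x of the other universe: p·x consists of the q·y with
y ∈ x and q a finite partial injection extending p.  Two extensions of p are
compatible after a permutation fixing dom p, as there is always room among the
atoms; hence the correspondences form a back-and-forth system, and the two
universes are elementarily equivalent. *)

From mathcomp Require Import all_boot boolp classical_sets.
Require Import Defs.

Set Implicit Arguments.
Unset Strict Implicit.
Unset Printing Implicit Defensive.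

(** A model S of the axioms may be ill-founded, so every induction, recursion and instance of
    replacement in it needs a predicate definable in S. Hence the parametric definability [Def], and
    hence the correspondence between the universes is introduced inside S, as the largest relation
    satisfying a back-and-forth clause. The language of ⟨ℕ⟩ has no symbols, so the transported
    structure has all permutations of its atoms as automorphisms, and PM(⟨ℕ⟩) is again the class of
    hereditarily symmetric elements, computed in 𝒱⋆(ω). Both models thus arise from one
    construction, applied to an embedding of a model into S: the identity, and the inclusion of
    𝒱⋆(ω). The two sets of atoms may differ in size in S, so there need be no bijection between
    them; finite partial injections require only that both be infinite. The amalgamation uses
    permutations only as composites of involutions, which exist in both models because every set of
    S whose elements lie in 𝒱⋆(ω) is represented in 𝒱⋆(ω). *)

(** * Structures, satisfaction and renaming of variables *)

Record structure : Type := Structure {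
  dom :> Type;
  elt : dom -> dom -> Prop;
  atm : dom -> Prop;
  pt : dom
}.
Arguments elt {s}.
Arguments atm {s}.
Arguments pt {s}.

Fixpoint sat (S : structure) (ρ : nat -> S) (φ : formula) : Prop :=
  match φ with
  | fIn i j => elt (ρ i) (ρ j)
  | fAtom i => atm (ρ i)
  | fEq i j => ρ i = ρ j
  | fBot => False
  | fImp φ ψ => sat ρ φ -> sat ρ ψ
  | fAnd φ ψ => sat ρ φ /\ sat ρ ψ
  | fOr φ ψ => sat ρ φ \/ sat ρ ψ
  | fAll φ => forall x, sat (scons x ρ) φ
  | fEx φ => exists x, sat (scons x ρ) φ
  end.

Lemma up_comp r s i : up r (up s i) = up (r \o s) i.
Proof. by case: i. Qed.

Lemma eq_ren r s φ : r =1 s -> ren r φ = ren s φ.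
Proof. by move=> /funext ->. Qed.

Lemma ren_comp r s φ : ren r (ren s φ) = ren (r \o s) φ.
Proof.
elim: φ r s => //= [φ H1 ψ H2|φ H1 ψ H2|φ H1 ψ H2|φ H|φ H] r s.
all: try by rewrite H1 H2.
all: by rewrite H; congr (_ _); apply: eq_ren => i; rewrite -up_comp.
Qed.

Lemma ren_bounded n r s φ :
  bounded n φ -> (forall i, i < n -> r i = s i) -> ren r φ = ren s φ.
Proof.
elim: φ n r s => //= [i j|i|i j|φ H1 ψ H2|φ H1 ψ H2|φ H1 ψ H2|φ H|φ H] n r s.
1,3: by move=> /andP[hi hj] e; rewrite !e.
1: by move=> hi e; rewrite e.
1,2,3: by move=> /andP[h1 h2] e; rewrite (H1 n r s) // (H2 n r s).
all: move=> h e; congr (_ _); apply: (H n.+1) => // -[|i] //= hi.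
all: by rewrite /up /= e.
Qed.

Lemma ren_id φ : ren id φ = φ.
Proof.
have up_id : up id = id by apply: funext => -[].
elim: φ => //= [φ -> ψ ->|φ -> ψ ->|φ -> ψ ->|φ H|φ H] //.
all: by rewrite up_id H.
Qed.

Lemma eq_sat (S : structure) (ρ σ : nat -> S) φ :
  ρ =1 σ -> sat ρ φ <-> sat σ φ.
Proof. by move=> /funext ->. Qed.

Lemma sat_ren (S : structure) (ρ : nat -> S) r φ : sat ρ (ren r φ) <-> sat (ρ \o r) φ.
Proof.
elim: φ ρ r => //= [φ H1 ψ H2|φ H1 ψ H2|φ H1 ψ H2|φ H|φ H] ρ r.
1,2,3: by rewrite H1 H2.
all: have e x : scons x ρ \o up r = scons x (ρ \o r) by apply: funext => -[].
- by split=> h x; [rewrite -e -H | rewrite H e].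
- by split=> -[x h]; exists x; [rewrite -e -H | rewrite H e].
Qed.

(** Sums in place of maxima, and no decrease under binders: any number above all free variables will
    do. *)
Fixpoint bound (φ : formula) : nat :=
  match φ with
  | fIn i j | fEq i j => (i + j).+1
  | fAtom i => i.+1
  | fBot => 0
  | fImp φ ψ | fAnd φ ψ | fOr φ ψ => bound φ + bound ψ
  | fAll φ | fEx φ => bound φ
  end.

Lemma boundedW n m φ : n <= m -> bounded n φ -> bounded m φ.
Proof.
elim: φ n m => //= [i j|i|i j|φ H1 ψ H2|φ H1 ψ H2|φ H1 ψ H2|φ H|φ H] n m h.
1,3: by move=> /andP[? ?]; apply/andP; split; apply: leq_trans h.
1: by move=> hi; apply: leq_trans h.
1,2,3: by move=> /andP[? ?]; apply/andP; split; [apply: (H1 n)|apply: (H2 n)].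
all: by apply: H.
Qed.

Lemma bounded_bound φ : bounded (bound φ) φ.
Proof.
elim: φ => //= [i j|i j|φ H1 ψ H2|φ H1 ψ H2|φ H1 ψ H2|φ H|φ H].
1,2: by rewrite !ltnS leq_addr leq_addl.
1,2,3: by apply/andP; split; [apply: boundedW H1|apply: boundedW H2];
  rewrite ?leq_addr ?leq_addl.
all: by apply: boundedW H.
Qed.

(** * Completeness of natural deduction *)

Lemma In_map T U (f : T -> U) s x : List.In x s -> List.In (f x) (map f s).
Proof. by elim: s => //= y s IH [->|/IH]; [left|right]. Qed.

Lemma In_mapE T U (f : T -> U) s y :
  List.In y (map f s) -> exists2 x, List.In x s & y = f x.
Proof.
elim: s => //= x s IH [<-|/IH[z ? ->]]; first by exists x => //; left.
by exists z => //; right.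
Qed.

Lemma incl_cons T (x : T) s t :
  List.incl s t -> List.incl (x :: s) (x :: t).
Proof. by move=> h y [->|/h]; [left|right]. Qed.

Lemma incl_map T U (f : T -> U) s t :
  List.incl s t -> List.incl (map f s) (map f t).
Proof. by move=> h y hy; have [x hx ->] := In_mapE hy; apply: In_map; apply: h. Qed.

Lemma ren_shift r φ : ren (up r) (shift φ) = shift (ren r φ).
Proof. by rewrite /shift !ren_comp. Qed.

Lemma ren_instvar r x φ : ren r (instvar x φ) = instvar (r x) (ren (up r) φ).
Proof. by rewrite /instvar !ren_comp; apply: eq_ren => -[]. Qed.

Lemma map_ren_shift r Γ :
  map (ren (up r)) (map shift Γ) = map shift (map (ren r) Γ).
Proof. by elim: Γ => //= φ Γ ->; rewrite ren_shift. Qed.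

(** Renaming and weakening are proved together: the quantifier rules change the context by [shift],
    and inclusion in an arbitrary larger context Δ is stable under this by [incl_map]. *)
Lemma derives_ren Γ φ r Δ : derives Γ φ -> List.incl (map (ren r) Γ) Δ ->
  derives Δ (ren r φ).
Proof.
move=> d; elim: d r Δ => {Γ φ} /=.
- by move=> Γ φ i r Δ h; apply: d_ctx; apply/h/In_map.
- by move=> Γ φ _ H r Δ h; apply: d_raa; apply: H; apply: incl_cons.
- by move=> Γ φ ψ _ H r Δ h; apply: d_impI; apply: H; apply: incl_cons.
- by move=> Γ φ ψ _ H1 _ H2 r Δ h; apply: d_impE (H1 _ _ h) (H2 _ _ h).
- by move=> Γ φ ψ _ H1 _ H2 r Δ h; apply: d_andI (H1 _ _ h) (H2 _ _ h).
- by move=> Γ φ ψ _ H r Δ h; apply: d_andE1 (H _ _ h).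
- by move=> Γ φ ψ _ H r Δ h; apply: d_andE2 (H _ _ h).
- by move=> Γ φ ψ _ H r Δ h; apply: d_orI1 (H _ _ h).
- by move=> Γ φ ψ _ H r Δ h; apply: d_orI2 (H _ _ h).
- move=> Γ φ ψ χ _ H1 _ H2 _ H3 r Δ h.
  by apply: d_orE (H1 _ _ h) (H2 _ _ _) (H3 _ _ _); apply: incl_cons.
- move=> Γ φ _ H r Δ h; apply: d_allI; apply: H.
  by rewrite map_ren_shift; apply: incl_map.
- by move=> Γ φ x _ H r Δ h; rewrite ren_instvar; apply: d_allE; apply: H.
- move=> Γ φ x _ H r Δ h; apply: (@d_exI _ _ (r x)).
  by rewrite -ren_instvar; apply: H.
- move=> Γ φ ψ _ H1 _ H2 r Δ h; apply: d_exE (H1 _ _ h) _.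
  rewrite -ren_shift; apply: H2; apply: incl_cons.
  by rewrite map_ren_shift; apply: incl_map.
- by move=> *; apply: d_eqI.
- move=> Γ φ x y _ H1 _ H2 r Δ h; rewrite ren_instvar.
  by apply: d_eqE (H1 _ _ h) _; rewrite -ren_instvar; apply: H2.
Qed.

Lemma derivesW Γ Δ φ : List.incl Γ Δ -> derives Γ φ -> derives Δ φ.
Proof.
move=> h d; rewrite -[φ]ren_id; apply: derives_ren d _.
by rewrite (_ : ren id = id) ?map_id //; apply: funext => ψ; apply: ren_id.
Qed.

Lemma provable_ctx (H : formula -> Prop) φ : H φ -> provable H φ.
Proof. by exists [:: φ]; split; [move=> ψ [<-|] | apply: d_ctx; left]. Qed.

Lemma provable_weak (H K : formula -> Prop) φ :
  (forall ψ, H ψ -> K ψ) -> provable H φ -> provable K φ.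
Proof. by move=> h [Γ [hΓ d]]; exists Γ; split=> // ψ /hΓ/h. Qed.

Lemma provable2 H φ ψ χ :
  (forall Γ, derives Γ φ -> derives Γ ψ -> derives Γ χ) ->
  provable H φ -> provable H ψ -> provable H χ.
Proof.
move=> h [Γ [hΓ d1]] [Δ [hΔ d2]]; exists (Γ ++ Δ); split.
  by move=> θ; rewrite List.in_app_iff => -[/hΓ|/hΔ].
by apply: h; [apply: derivesW d1|apply: derivesW d2] => θ;
  rewrite List.in_app_iff; [left|right].
Qed.

Definition adj (H : formula -> Prop) φ ψ := H ψ \/ ψ = φ.

Lemma provable_imp H φ ψ : provable (adj H φ) ψ -> provable H (fImp φ ψ).
Proof.
move=> [Γ [hΓ d]].
have [Δ [hΔ hΓΔ]] :
    exists Δ, (forall θ, List.In θ Δ -> H θ) /\ List.incl Γ (φ :: Δ).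
  elim: Γ {d} hΓ => [|θ Γ IH] h; first by exists [::]; split.
  have [|Δ [hΔ i]] := IH; first by move=> *; apply: h; right.
  have [|hθ|->] := h θ; first by left.
    exists (θ :: Δ); split; first by move=> ? [<-|/hΔ].
    move=> χ [<-|/i[->|]]; rewrite /=; tauto.
  by exists Δ; split=> // χ [<-|/i] //=; left.
by exists Δ; split=> //; apply: d_impI; apply: derivesW d.
Qed.

Lemma provable_raa H φ : provable (adj H (fNot φ)) fBot -> provable H φ.
Proof.
move=> /provable_imp[Γ [hΓ d]]; exists Γ; split=> //; apply: d_raa.
apply: d_impE (d_ctx _); last by left.
by apply: derivesW d => ? ?; right.
Qed.

Lemma provable_mp H φ ψ :
  provable H (fImp φ ψ) -> provable H φ -> provable H ψ.
Proof. by apply: provable2 => Γ; apply: d_impE. Qed.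

Definition consistent H := ~ provable H fBot.

(** The renaming carries x to 0 and shifts everything else. On formulas where x is fresh it is just
    [shift], so it turns a fresh variable into the eigenvariable 0 of [d_exE]. *)
Lemma ren_fresh_ctx x n Γ : n <= x ->
  (forall ψ, List.In ψ Γ -> bounded n ψ) ->
  map (ren (fun y => if y == x then 0 else y.+1)) Γ = map shift Γ.
Proof.
move=> hx; elim: Γ => //= φ Γ IH h; rewrite IH; last by move=> *; apply: h; right.
congr (_ :: _); apply: (@ren_bounded x).
  by apply: boundedW hx _; apply: h; left.
by move=> i hi; rewrite ltn_eqF.
Qed.

(** A refutation of the witness [instvar x φ] becomes, after renaming x to 0, a use of ∃-elimination
    on [fEx φ], which already lies in H. *)
Lemma consistent_witness H φ x :
  (forall ψ, H ψ -> bounded x ψ) -> H (fEx φ) -> consistent H ->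
  consistent (adj H (instvar x φ)).
Proof.
move=> hH hφ hc /provable_imp [Γ [hΓ d]]; apply: hc.
exists (fEx φ :: Γ); split; first by move=> ψ [<-|/hΓ].
apply: (@d_exE _ φ); first by apply: d_ctx; left.
apply: (@d_impE _ φ); last by apply: d_ctx; left.
have := derives_ren (r := fun y => if y == x then 0 else y.+1) d (fun _ => id).
rewrite (@ren_fresh_ctx x x) //=; last by move=> ψ /hΓ/hH.
rewrite /instvar ren_comp (_ : ren _ φ = φ); last first.
  rewrite -[RHS]ren_id; apply: (@ren_bounded x.+1 _ _ _ (hH _ hφ)) => -[|i] /=.
    by rewrite eqxx.
  by rewrite ltnS => hi; rewrite ltn_eqF.
by move=> {}d; apply: derivesW d => ? ?; right; right.
Qed.

(** * Enumeration of formulas *)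

Fixpoint tree_of_formula (φ : formula) : GenTree.tree nat :=
  let n k := GenTree.Node k in
  match φ with
  | fIn i j => n 0 [:: GenTree.Leaf i; GenTree.Leaf j]
  | fAtom i => n 1 [:: GenTree.Leaf i]
  | fEq i j => n 2 [:: GenTree.Leaf i; GenTree.Leaf j]
  | fBot => n 3 [::]
  | fImp φ ψ => n 4 [:: tree_of_formula φ; tree_of_formula ψ]
  | fAnd φ ψ => n 5 [:: tree_of_formula φ; tree_of_formula ψ]
  | fOr φ ψ => n 6 [:: tree_of_formula φ; tree_of_formula ψ]
  | fAll φ => n 7 [:: tree_of_formula φ]
  | fEx φ => n 8 [:: tree_of_formula φ]
  end.

Lemma tree_of_formula_inj : injective tree_of_formula.
Proof.
elim=> [i j|i|i j||φ H1 ψ H2|φ H1 ψ H2|φ H1 ψ H2|φ H|φ H] [] //=.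
1,3: by move=> ? ? [-> ->].
1: by move=> ? [->].
1,2,3: by move=> ? ? [/H1 -> /H2 ->].
all: by move=> ? [/H ->].
Qed.

(** Numbers that code no formula give [fBot], so that every stage of the Henkin construction has a
    formula to treat. *)
Definition formula_of_nat (n : nat) : formula :=
  if pselect (exists φ, pickle (tree_of_formula φ) = n) is left h
  then projT1 (cid h) else fBot.

Lemma formula_of_nat_surj φ : exists n, formula_of_nat n = φ.
Proof.
exists (pickle (tree_of_formula φ)); rewrite /formula_of_nat.
case: pselect => [h|[]]; last by exists φ.
case: cid => ψ /= e; apply: tree_of_formula_inj.
exact: pcan_inj pickleK _ _ e.
Qed.

(** * The maximal Henkin extension *)

Section Completeness.
Variable T : formula -> Prop.
Hypothesis T_sentence : forall φ, T φ -> sentence φ.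

Section Henkin.
Variable φ0 : formula.
Hypothesis not_provable : ~ provable T φ0.

Definition in_list (L : seq formula) φ := T φ \/ List.In φ L.

Definition list_bound (L : seq formula) := foldr (fun φ n => bound φ + n) 0 L.

(** Variables serve as Henkin constants. The variable [list_bound (ψ :: L)] lies above all free
    variables of the formulas listed so far, and the members of T are sentences, so it is fresh for
    the witness. *)
Definition henkin_step (L : seq formula) (ψ : formula) : seq formula :=
  if pselect (consistent (in_list (ψ :: L))) then
    if ψ is fEx χ then instvar (list_bound (ψ :: L)) χ :: ψ :: L else ψ :: L
  else L.

Fixpoint stage n : seq formula :=
  if n is m.+1 then henkin_step (stage m) (formula_of_nat m)
  else [:: fNot φ0].

Definition henkin φ := exists n, List.In φ (stage n).

Lemma in_list_bounded L φ : in_list L φ -> bounded (list_bound L) φ.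
Proof.
case=> [/T_sentence|]; first exact: boundedW.
elim: L => //= ψ L IH [->|/IH]; last by apply: boundedW; rewrite leq_addl.
by apply: boundedW (bounded_bound φ); rewrite leq_addr.
Qed.

Lemma in_list_cons L φ ψ : in_list (φ :: L) ψ <-> adj (in_list L) φ ψ.
Proof. by rewrite /adj /in_list /=; split; firstorder. Qed.

Lemma henkin_step_consistent L ψ :
  consistent (in_list L) -> consistent (in_list (henkin_step L ψ)).
Proof.
rewrite /henkin_step => hL; case: pselect => //= hψ.
case: ψ hψ => //= χ hψ h.
apply: (@consistent_witness (in_list (fEx χ :: L)) χ (list_bound (fEx χ :: L))).
- exact: in_list_bounded.
- by right; left.
- exact: hψ.
- by apply: provable_weak h => ψ /in_list_cons.
Qed.

Lemma stage_consistent n : consistent (in_list (stage n)).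
Proof.
elim: n => [|n]; last exact: henkin_step_consistent.
move=> h; apply: not_provable; apply: provable_raa.
by apply: provable_weak h => ψ [?|[<-|//]]; [left|right].
Qed.

Lemma stageW m n φ : m <= n -> List.In φ (stage m) -> List.In φ (stage n).
Proof.
move=> /subnK <-; elim: (n - m) => //= k IH /IH h.
rewrite /henkin_step; case: (pselect _) => //= _.
by case: (formula_of_nat _) => *; right => //; right.
Qed.

Lemma henkin_stage Γ : (forall φ, List.In φ Γ -> henkin φ) ->
  exists n, forall φ, List.In φ Γ -> List.In φ (stage n).
Proof.
elim: Γ => [|φ Γ IH] h; first by exists 0.
have [|n hn] := IH; first by move=> *; apply: h; right.
have [|m hm] := h φ; first by left.
exists (maxn n m) => ψ [<-|/hn h'].
  by apply: stageW hm; apply: leq_maxr.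
by apply: stageW h'; apply: leq_maxl.
Qed.

Lemma henkin_consistent : consistent henkin.
Proof.
move=> [Γ [/henkin_stage[n hn] d]]; apply: (@stage_consistent n).
by exists Γ; split=> // φ /hn; right.
Qed.

(** The formula is treated at the stage given by its code, and added there because it is consistent
    with that stage. This is the maximality of [henkin]. *)
Lemma henkin_add φ :
  (forall n, consistent (in_list (φ :: stage n))) -> henkin φ.
Proof.
have [m e] := formula_of_nat_surj φ => h; exists m.+1 => /=; move: e h => <- h.
rewrite /henkin_step; case: (pselect _) => //= _.
by case: (formula_of_nat _) => *; by [left|right; left].
Qed.

Lemma henkin_T φ : T φ -> henkin φ.
Proof.
move=> h; apply: henkin_add => n hn; apply: (@stage_consistent n).
by apply: provable_weak hn => ψ [?|[<-|?]]; [left|left|right].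
Qed.

Lemma henkin_stageT n φ : in_list (stage n) φ -> henkin φ.
Proof. by move=> [/henkin_T|?] //; exists n. Qed.

Lemma henkin_closed φ : provable henkin φ -> henkin φ.
Proof.
move=> h; apply: henkin_add => n hn; apply: henkin_consistent.
apply: provable_mp h; apply: provable_imp; apply: provable_weak hn => ψ.
by move=> /in_list_cons [/henkin_stageT|->]; [left|right].
Qed.

Lemma henkin_derives Γ φ :
  (forall ψ, List.In ψ Γ -> henkin ψ) -> derives Γ φ -> henkin φ.
Proof. by move=> h d; apply: henkin_closed; exists Γ. Qed.

Lemma henkin_derives1 φ ψ : derives [:: φ] ψ -> henkin φ -> henkin ψ.
Proof. by move=> d h; apply: henkin_derives d => χ [<-|]. Qed.

Lemma henkin_derives2 φ ψ χ :
  derives [:: φ; ψ] χ -> henkin φ -> henkin ψ -> henkin χ.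
Proof. by move=> d h k; apply: henkin_derives d => θ [<-|[<-|]]. Qed.

Ltac ctx := apply: d_ctx; rewrite /=; tauto.

Lemma henkin_imp φ ψ : henkin (fImp φ ψ) <-> (henkin φ -> henkin ψ).
Proof.
split=> [|h]; first by apply: henkin_derives2; apply: (@d_impE _ φ); ctx.
have [/h|hφ] := pselect (henkin φ).
  by apply: henkin_derives1; apply: d_impI; ctx.
(* As φ was not added, some stage refutes it, and a refutable φ implies ψ by ex falso. *)
apply: henkin_closed; apply: provable_imp; apply: contrapT => c.
apply: hφ; apply: henkin_add => n [Γ [hΓ d]]; apply: c; exists Γ; split.
  by move=> θ /hΓ/in_list_cons [/henkin_stageT|->]; [left|right].
by apply: d_raa; apply: derivesW d => ? ?; right.
Qed.

Lemma henkin_not φ : henkin (fNot φ) <-> ~ henkin φ.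
Proof.
rewrite henkin_imp; split=> h /h // /provable_ctx; exact: henkin_consistent.
Qed.

Lemma henkin_ex φ : henkin (fEx φ) -> exists x, henkin (instvar x φ).
Proof.
have [m hm] := formula_of_nat_surj (fEx φ) => h.
exists (list_bound (fEx φ :: stage m)), m.+1 => /=.
rewrite /henkin_step hm; case: (pselect _) => /= [_|[]]; first by left.
move=> hn; apply: henkin_consistent; apply: provable_weak hn => ψ.
by move=> /in_list_cons [/henkin_stageT|->].
Qed.

Lemma henkin_and φ ψ : henkin (fAnd φ ψ) <-> henkin φ /\ henkin ψ.
Proof.
split=> [h|[]]; last by apply: henkin_derives2; apply: d_andI; ctx.
by split; apply: henkin_derives1 h; [apply: (@d_andE1 _ _ ψ)|apply: (@d_andE2 _ φ)]; ctx.
Qed.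

Lemma henkin_or φ ψ : henkin (fOr φ ψ) <-> henkin φ \/ henkin ψ.
Proof.
split=> [h|[]]; first last.
- by apply: henkin_derives1; apply: d_orI2; ctx.
- by apply: henkin_derives1; apply: d_orI1; ctx.
have [|/henkin_not h1] := pselect (henkin φ); first by left.
right; apply: (@henkin_derives [:: fOr φ ψ; fNot φ]); first by move=> χ [<-|[<-|]].
apply: (@d_orE _ φ ψ); [by ctx| |by ctx].
apply: d_raa; apply: (@d_impE _ φ); by ctx.
Qed.

Lemma henkin_exP φ : henkin (fEx φ) <-> exists x, henkin (instvar x φ).
Proof.
split=> [/henkin_ex //|[x]]; apply: henkin_derives1.
by apply: (@d_exI _ _ x); ctx.
Qed.

Lemma henkin_all φ : henkin (fAll φ) <-> forall x, henkin (instvar x φ).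
Proof.
split=> [h x|h]; first by apply: henkin_derives1 h; apply: d_allE; ctx.
apply: contrapT => /henkin_not hn.
suff /henkin_ex[x] : henkin (fEx (fNot φ)) by move/henkin_not => []; apply: h.
apply: henkin_derives1 hn; apply: d_raa; apply: (@d_impE _ (fAll φ)); first by ctx.
apply: d_allI; apply: d_raa.
apply: (@d_impE _ (shift (fEx (fNot φ)))); first by ctx.
(* Instantiating the shifted body at the eigenvariable 0 gives back [fNot φ]. *)
apply: (@d_exI _ _ 0); rewrite /instvar /= ren_comp (_ : ren _ φ = φ); first by ctx.
by rewrite -[RHS]ren_id; apply: eq_ren => -[].
Qed.

Lemma henkin_refl x : henkin (fEq x x).
Proof. by apply: (@henkin_derives [::]) => //; apply: d_eqI. Qed.

Lemma henkin_subst φ x y :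
  henkin (fEq x y) -> henkin (instvar x φ) -> henkin (instvar y φ).
Proof. by apply: henkin_derives2; apply: (@d_eqE _ φ x y); ctx. Qed.

Lemma henkin_sym x y : henkin (fEq x y) -> henkin (fEq y x).
Proof. by move=> h; apply: (henkin_subst (φ := fEq 0 x.+1) h); apply: henkin_refl. Qed.

Lemma henkin_trans x y z :
  henkin (fEq x y) -> henkin (fEq y z) -> henkin (fEq x z).
Proof.
move=> /henkin_sym h; exact: (henkin_subst (φ := fEq 0 z.+1) h).
Qed.

(** * The term model *)

(** [xget] chooses from the whole class of x, so [rep] depends on the class only. The quotient by
    the equalities in [henkin] is then the subtype of its fixed points. *)
Definition rep (x : nat) : nat := xget 0 [set y | henkin (fEq x y)]%classic.

Lemma repP x : henkin (fEq x (rep x)).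
Proof.
by rewrite /rep; case: xgetP => [y _ //|/(_ x)[]]; apply: henkin_refl.
Qed.

Lemma rep_eq x y : rep x = rep y <-> henkin (fEq x y).
Proof.
split=> [e|h].
  apply: henkin_trans (repP x) _; rewrite e; exact/henkin_sym/repP.
congr (xget _ _); apply: funext => z; apply: propext; split.
  exact/henkin_trans/henkin_sym.
exact: henkin_trans.
Qed.

Lemma rep_id x : rep (rep x) = rep x.
Proof. exact/rep_eq/henkin_sym/repP. Qed.

Definition term_model : structure :=
  @Structure {x | rep x = x} (fun x y => henkin (fIn (sval x) (sval y)))
     (fun x => henkin (fAtom (sval x))) (exist _ (rep 0) (rep_id 0)).

Definition class (x : nat) : term_model := exist _ (rep x) (rep_id x).

Lemma class_sval (d : term_model) : class (sval d) = d.
Proof. by case: d => x h; apply: eq_exist. Qed.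

Lemma class_eq x y : class x = class y <-> henkin (fEq x y).
Proof. by rewrite -rep_eq; split=> [[]|h] //; apply: eq_exist. Qed.

Lemma henkin_eq φ x y :
  henkin (fEq x y) -> henkin (instvar x φ) <-> henkin (instvar y φ).
Proof. by move=> h; split; apply: henkin_subst => //; apply: henkin_sym. Qed.

(** The truth lemma. It is stated for every renaming σ so that [scons x σ] falls within the
    induction hypothesis under a quantifier; every element of the model is named by a variable. *)
Lemma sat_term_model σ φ :
  sat (S := term_model) (class \o σ) φ <-> henkin (ren σ φ).
Proof.
have e x τ : scons (class x) (class \o τ) = class \o scons x τ.
  by apply: funext => -[].
have e' x τ ψ : instvar x (ren (up τ) ψ) = ren (scons x τ) ψ.
  by rewrite /instvar ren_comp; apply: eq_ren => -[].
have hr x : henkin (fEq (rep x) x) by apply/henkin_sym/repP.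
elim: φ σ => /= [i j|i|i j||φ H1 ψ H2|φ H1 ψ H2|φ H1 ψ H2|φ H|φ H] σ.
- apply: iff_trans (henkin_eq (fIn 0 (rep (σ j)).+1) (hr (σ i))) _.
  exact: (henkin_eq (fIn (σ i).+1 0) (hr (σ j))).
- exact: (henkin_eq (fAtom 0) (hr (σ i))).
- exact: class_eq.
- by split=> // h; apply: henkin_consistent; apply: provable_ctx.
- by rewrite henkin_imp H1 H2.
- by rewrite henkin_and H1 H2.
- by rewrite henkin_or H1 H2.
- rewrite henkin_all; split=> h x; first by rewrite e' -H -e.
  by rewrite -(class_sval x) e H -e'.
- rewrite henkin_exP; split=> -[x h].
    by exists (sval x); rewrite e' -H -e class_sval.
  by exists (class x); rewrite e H -e'.
Qed.

Lemma henkin_model :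
  exists (S : structure) (ρ : nat -> S),
    (forall φ, T φ -> sat ρ φ) /\ ~ sat ρ φ0.
Proof.
exists term_model, (class \o id); split=> [φ h|].
  by apply/sat_term_model; rewrite ren_id; apply: henkin_T.
by rewrite sat_term_model ren_id; apply/henkin_not; exists 0; left.
Qed.

End Henkin.

Theorem completeness φ :
  (forall (S : structure) (ρ : nat -> S), (forall ψ, T ψ -> sat ρ ψ) -> sat ρ φ) ->
  provable T φ.
Proof.
by move=> h; apply: contrapT => /henkin_model[S [ρ [hT]]]; apply; apply: h.
Qed.

End Completeness.

(** * Definable predicates *)

(** Interleaving leaves infinitely many places to the arguments and to the parameters alike, so that
    the parameters of several formulas can be merged without counting variables. *)
Definition mix {T : Type} (ρ c : nat -> T) (i : nat) : T :=
  if odd i then c i./2 else ρ i./2.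

Lemma mix_even T (ρ c : nat -> T) i : mix ρ c i.*2 = ρ i.
Proof. by rewrite /mix odd_double doubleK. Qed.

Lemma mix_odd T (ρ c : nat -> T) i : mix ρ c i.*2.+1 = c i.
Proof. by rewrite /mix /= odd_double /= uphalf_double. Qed.

Lemma mix_comp T U (f : T -> U) (ρ c : nat -> T) :
  f \o mix ρ c = mix (f \o ρ) (f \o c).
Proof. by apply: funext => i; rewrite /mix /=; case: odd. Qed.

Section Definability.
Context {S : structure}.
Implicit Types (P Q : (nat -> S) -> Prop) (ρ : nat -> S).

(* Definability with parameters: the even variables stand for the arguments and
   the odd ones for the parameters. *)
Definition Def P : Prop := exists φ c, forall ρ, sat (mix ρ c) φ <-> P ρ.

Definition DefT (t : (nat -> S) -> S) : Prop :=
  Def (fun ρ => ρ 0 = t (fun i => ρ i.+1)).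

Lemma Def_ext P Q : (forall ρ, P ρ <-> Q ρ) -> Def P -> Def Q.
Proof. by move=> e [φ [c h]]; exists φ, c => ρ; rewrite h. Qed.

Lemma Def_rename r P : Def P -> Def (fun ρ => P (fun i => ρ (r i))).
Proof.
move=> [φ [c h]].
exists (ren (fun i => if odd i then i else (r i./2).*2) φ), c => ρ.
rewrite sat_ren -h; apply: eq_sat => i /=.
rewrite {2}/mix; case: ifP => o; last by rewrite mix_even.
by rewrite /mix o.
Qed.

Lemma Def_inst a P : Def P -> Def (fun ρ => P (scons a ρ)).
Proof.
move=> [φ [c h]].
(* Place 0, that of the first argument, becomes the first parameter place 1; the old parameters move
   up by one and the other arguments down by one. *)
pose r i := if odd i then i.+2 else if i is j.+2 then j else 1.
exists (ren r φ), (scons a c) => ρ.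
rewrite sat_ren -h; apply: eq_sat => i /=.
rewrite /r {2}/mix; case: ifP => o; first by rewrite /mix /= negbK o.
by case: i o => [|[|i]] //=; rewrite negbK /mix => ->.
Qed.

Lemma Def_and P Q : Def P -> Def Q -> Def (fun ρ => P ρ /\ Q ρ).
Proof.
move=> [φ [c h]] [ψ [d k]].
(* The parameters of φ go to the even parameter places and those of ψ to the odd ones. *)
pose r1 i := if odd i then (i./2).*2.*2.+1 else i.
pose r2 i := if odd i then (i./2).*2.+1.*2.+1 else i.
exists (fAnd (ren r1 φ) (ren r2 ψ)), (mix c d) => ρ /=.
rewrite !sat_ren -h -k.
suff [-> ->] : mix ρ (mix c d) \o r1 = mix ρ c /\ mix ρ (mix c d) \o r2 = mix ρ d by [].
split; apply: funext => i; rewrite /= /r1 /r2 [RHS]/mix; case: ifP => o.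
- by rewrite mix_odd mix_even.
- by rewrite /mix o.
- by rewrite mix_odd mix_odd.
- by rewrite /mix o.
Qed.

Lemma Def_not P : Def P -> Def (fun ρ => ~ P ρ).
Proof. by move=> [φ [c h]]; exists (fNot φ), c => ρ /=; rewrite h. Qed.

Lemma Def_or P Q : Def P -> Def Q -> Def (fun ρ => P ρ \/ Q ρ).
Proof.
move=> hP hQ; apply: Def_ext (Def_not (Def_and (Def_not hP) (Def_not hQ))) => ρ.
by rewrite not_andP !notK.
Qed.

Lemma Def_imp P Q : Def P -> Def Q -> Def (fun ρ => P ρ -> Q ρ).
Proof.
move=> hP hQ; apply: Def_ext (Def_or (Def_not hP) hQ) => ρ.
by rewrite implyE.
Qed.

Lemma Def_iff P Q : Def P -> Def Q -> Def (fun ρ => P ρ <-> Q ρ).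
Proof. by move=> hP hQ; apply: Def_and; apply: Def_imp. Qed.

Lemma Def_ex (Q : S -> (nat -> S) -> Prop) :
  Def (fun ρ => Q (ρ 0) (fun i => ρ i.+1)) -> Def (fun ρ => exists x, Q x ρ).
Proof.
move=> [φ [c h]].
(* Below the new binder, place 0 is the bound variable and [mix ρ c] starts at place 1. Parameters
   thus move up, argument k+1 goes from place 2k+2 to 2k+1, and argument 0 stays where it is since
   [0.-1 = 0]. *)
pose r i := if odd i then i.+1 else i.-1.
exists (fEx (ren r φ)), c => ρ /=.
have e x : sat (scons x (mix ρ c)) (ren r φ) <-> Q x ρ.
  rewrite sat_ren -(h (scons x ρ)); apply: eq_sat.
  move=> i; rewrite /= /r {2}/mix; case: ifP => o.
    by rewrite /= /mix o.
  by case: i o => [|[|i]] //=; rewrite negbK /mix /= => ->.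
by split=> -[x /e h']; exists x.
Qed.

Lemma Def_all (Q : S -> (nat -> S) -> Prop) :
  Def (fun ρ => Q (ρ 0) (fun i => ρ i.+1)) -> Def (fun ρ => forall x, Q x ρ).
Proof.
move=> /Def_not h; have := Def_not (Def_ex (Q := fun x ρ => ~ Q x ρ) h).
apply: Def_ext => ρ; split=> [k x|k [x]]; last exact.
by apply: contrapT => n; apply: k; exists x.
Qed.

Lemma Def_const (Q : Prop) : Def (fun _ => Q).
Proof.
have [h|h] := pselect Q.
  exists (fNot fBot), (fun _ => pt) => ρ. split=> //=.
exists fBot, (fun _ => pt) => ρ; split=> //.
Qed.

Lemma Def_var2 (P : S -> S -> Prop) i j :
  Def (fun ρ => P (ρ 0) (ρ 1)) -> Def (fun ρ => P (ρ i) (ρ j)).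
Proof. exact: (Def_rename (fun k => if k is 0 then i else j)). Qed.

Lemma Def_eqvar i j : Def (fun ρ => ρ i = ρ j).
Proof.
exists (fEq i.*2 j.*2), (fun _ => pt) => ρ /=.
by rewrite !mix_even.
Qed.

Lemma DefT_var i : DefT (fun ρ => ρ i).
Proof. exact: Def_eqvar. Qed.

Lemma DefT_const a : DefT (fun _ => a).
Proof. exact: (@Def_inst a (fun ρ => ρ 1 = ρ 0) (Def_eqvar 1 0)). Qed.

Class DefP1 (R : S -> Prop) := def_p1 : Def (fun ρ => R (ρ 0)).
Class DefP2 (R : S -> S -> Prop) := def_p2 : Def (fun ρ => R (ρ 0) (ρ 1)).
Class DefP3 (R : S -> S -> S -> Prop) :=
  def_p3 : Def (fun ρ => R (ρ 0) (ρ 1) (ρ 2)).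
Class DefF1 (f : S -> S) := def_f1 : DefT (fun ρ => f (ρ 0)).
Class DefF2 (f : S -> S -> S) := def_f2 : DefT (fun ρ => f (ρ 0) (ρ 1)).
Class DefF3 (f : S -> S -> S -> S) := def_f3 : DefT (fun ρ => f (ρ 0) (ρ 1) (ρ 2)).

Lemma DefT_rename r t : DefT t -> DefT (fun ρ => t (fun i => ρ (r i))).
Proof. exact: (Def_rename (fun i => if i is j.+1 then (r j).+1 else 0)). Qed.

Lemma Def_subst (Q : S -> (nat -> S) -> Prop) t :
  DefT t -> Def (fun ρ => Q (ρ 0) (fun i => ρ i.+1)) -> Def (fun ρ => Q (t ρ) ρ).
Proof.
move=> ht hQ; apply: Def_ext (Def_ex (Q := fun x ρ => x = t ρ /\ Q x ρ) _) => [ρ|].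
  by split=> [[x [-> //]]|?]; exists (t ρ).
exact: Def_and.
Qed.

Lemma Def_app1 (R : S -> Prop) {h : DefP1 R} t : DefT t -> Def (fun ρ => R (t ρ)).
Proof. by move=> ht; apply: (Def_subst (Q := fun x ρ => R x) ht). Qed.

Lemma Def_app2 (R : S -> S -> Prop) {h : DefP2 R} s t :
  DefT s -> DefT t -> Def (fun ρ => R (s ρ) (t ρ)).
Proof.
move=> hs ht; apply: (Def_subst (Q := fun x ρ => R x (t ρ)) hs).
apply: (Def_subst (Q := fun y ρ => R (ρ 0) y)).
  exact: (DefT_rename succn ht).
exact: (Def_var2 1 0 h).
Qed.

Lemma Def_app3 (R : S -> S -> S -> Prop) {h : DefP3 R} s t u :
  DefT s -> DefT t -> DefT u -> Def (fun ρ => R (s ρ) (t ρ) (u ρ)).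
Proof.
move=> hs ht hu; apply: (Def_subst (Q := fun x ρ => R x (t ρ) (u ρ)) hs).
apply: (Def_subst (Q := fun y ρ => R (ρ 0) y (u (fun i => ρ i.+1)))).
  exact: (DefT_rename succn ht).
apply: (Def_subst (Q := fun z ρ => R (ρ 1) (ρ 0) z)).
  exact: (DefT_rename (fun i => i.+2) hu).
exact: (Def_rename (fun i => if i is i.+1 then (if i is 0 then 1 else 0) else 2) h).
Qed.

Lemma DefT_app1 (f : S -> S) {h : DefF1 f} t : DefT t -> DefT (fun ρ => f (t ρ)).
Proof.
move=> /(DefT_rename succn) ht; have h' : DefP2 (fun x y => x = f y) by [].
exact: (@Def_app2 _ h' _ _ (DefT_var 0) ht).
Qed.

Lemma DefT_app2 (f : S -> S -> S) {h : DefF2 f} s t :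
  DefT s -> DefT t -> DefT (fun ρ => f (s ρ) (t ρ)).
Proof.
move=> /(DefT_rename succn) hs /(DefT_rename succn) ht.
have h' : DefP3 (fun x y z => x = f y z) by [].
exact: (@Def_app3 _ h' _ _ _ (DefT_var 0) hs ht).
Qed.

Lemma Def_eq s t : DefT s -> DefT t -> Def (fun ρ => s ρ = t ρ).
Proof.
exact: (@Def_app2 _ (Def_eqvar 0 1)).
Qed.

Lemma DefT_app3 (f : S -> S -> S -> S) {h : DefF3 f} s t u :
  DefT s -> DefT t -> DefT u -> DefT (fun ρ => f (s ρ) (t ρ) (u ρ)).
Proof.
move=> hs ht hu; apply: (@Def_subst (fun x ρ => ρ 0 = f x (t (fun i => ρ i.+1)) (u (fun i => ρ i.+1)))).
  exact: (DefT_rename succn hs).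
apply: (@Def_subst (fun x ρ => ρ 1 = f (ρ 0) x (u (fun i => ρ i.+2)))).
  exact: (DefT_rename (fun i => i.+2) ht).
apply: (@Def_subst (fun x ρ => ρ 2 = f (ρ 1) (ρ 0) x)).
  exact: (DefT_rename (fun i => i.+3) hu).
apply: (Def_rename (fun i => match i with 0 => 3 | 1 => 2 | 2 => 1 | _ => 0 end) h).
Qed.

#[global] Instance DefP2_elt : DefP2 (@elt S).
Proof. by exists (fIn 0 2), (fun _ => pt) => ρ. Qed.

#[global] Instance DefP1_atm : DefP1 (@atm S).
Proof. by exists (fAtom 0), (fun _ => pt) => ρ. Qed.

(** Undoes the interleaving, since an instance of the replacement scheme has its two variables first
    and the parameters after them. *)
Lemma DefP2_sat (R : S -> S -> Prop) : DefP2 R ->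
  exists φ c, forall x y, R x y <-> sat (scons x (scons y c)) φ.
Proof.
move=> [φ [c h]].
(* In the assignment [scons x (fun _ => y)] every argument after the first is y, so all even places
   but 0 go to 1. *)
pose r i := if odd i then i./2.+2 else if i is 0 then 0 else 1.
exists (ren r φ), c => x y.
rewrite sat_ren -(h (scons x (fun _ => y))); apply: eq_sat => i /=.
by rewrite /mix /r; case: ifP => //; case: i => [|[|i]].
Qed.

(** * Definite descriptions and set terms *)

(** The default [pt] makes descriptions total; as [pt] may serve as a parameter, they remain
    definable. *)
Definition the (P : S -> Prop) : S :=
  if pselect (exists x, P x /\ forall y, P y -> y = x) is left h
  then projT1 (cid h) else pt.

Lemma the_eq (P : S -> Prop) x : P x -> (forall y, P y -> y = x) -> the P = x.
Proof.
move=> h u; rewrite /the; case: pselect => [e|[]]; last by exists x.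
by case: cid => y /= [/u].
Qed.

Lemma DefT_the (P : S -> (nat -> S) -> Prop) :
  Def (fun ρ => P (ρ 0) (fun i => ρ i.+1)) -> DefT (fun ρ => the (fun x => P x ρ)).
Proof.
pose uniq ρ x := P x ρ /\ forall y, P y ρ -> y = x.
move=> h; have hu : Def (fun ρ => uniq (fun i => ρ i.+1) (ρ 0)).
  apply: (Def_and h).
  apply: (@Def_all (fun y ρ => P y (fun i => ρ i.+1) -> y = ρ 0)).
  apply: Def_imp; last exact: Def_eqvar.
  exact: (Def_rename (fun i => if i is j.+1 then j.+2 else 0) h).
apply: Def_ext (_ : Def (fun ρ => uniq (fun i => ρ i.+1) (ρ 0) \/
    (~ exists x, uniq (fun i => ρ i.+1) x) /\ ρ 0 = pt)) => [ρ|].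
  split=> [[[h1 h2]|[n ->]]|].
  - by rewrite (the_eq h1 h2).
  - by rewrite /the; case: pselect.
  - rewrite /the => ->; case: pselect => [e|n]; last by right.
    by left; case: cid.
apply: Def_or => //; apply: Def_and; last by apply: Def_eq; [apply: DefT_var|apply: DefT_const].
apply: Def_not; apply: (@Def_ex (fun x ρ => uniq (fun i => ρ i.+1) x)).
exact: (Def_rename (fun i => if i is j.+1 then j.+2 else 0) hu).
Qed.

Definition isset (x : S) : Prop := ~ atm x.

#[global] Instance DefP1_isset : DefP1 isset.
Proof. exact: Def_not DefP1_atm. Qed.

Definition setof (P : S -> Prop) : S :=
  the (fun b => isset b /\ forall z, elt z b <-> P z).

Lemma DefT_setof (P : S -> (nat -> S) -> Prop) :
  Def (fun ρ => P (ρ 0) (fun i => ρ i.+1)) ->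
  DefT (fun ρ => setof (fun z => P z ρ)).
Proof.
move=> h; apply: (@DefT_the (fun b ρ => isset b /\ forall z, elt z b <-> P z ρ)).
apply: Def_and; first exact: DefP1_isset.
apply: (@Def_all (fun z ρ => elt z (ρ 0) <-> P z (fun i => ρ i.+1))).
apply: Def_iff; first exact: (Def_var2 0 1 DefP2_elt).
exact: (Def_rename (fun i => if i is j.+1 then j.+2 else 0) h).
Qed.

End Definability.

Ltac def_step := first
  [ exact: DefT_var | exact: DefT_const | exact: Def_const
  | simple apply DefT_app1; [exact _|] | simple apply DefT_app2; [exact _| |]
  | simple apply DefT_app3; [exact _| | |]
  | simple apply DefT_setof | simple apply DefT_the
  | simple apply Def_app1; [exact _|] | simple apply Def_app2; [exact _| |]
  | simple apply Def_app3; [exact _| | |]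
  | simple apply Def_eq
  | simple apply Def_iff | simple apply Def_and | simple apply Def_or
  | simple apply Def_not | simple apply Def_imp | simple apply Def_ex
  | simple apply Def_all ]; cbn beta.

Ltac unfold_head R := lazymatch R with ?f _ => unfold_head f | _ => try unfold R end.

Ltac def_hyp := match goal with
  | |- DefP1 ?R => unfold_head R; unfold DefP1
  | |- DefP2 ?R => unfold_head R; unfold DefP2
  | |- DefP3 ?R => unfold_head R; unfold DefP3
  | |- DefF1 ?R => unfold_head R; unfold DefF1
  | |- DefF2 ?R => unfold_head R; unfold DefF2
  | |- DefF3 ?R => unfold_head R; unfold DefF3
  | _ => idtac end.

Ltac def := intros; def_hyp; repeat def_step.

Ltac def_closed R :=
  lazymatch R with fun _ => _ => tryif has_evar R then fail else solve [def] end.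

#[global] Hint Extern 50 (DefP1 ?R) => def_closed R : typeclass_instances.
#[global] Hint Extern 50 (DefP2 ?R) => def_closed R : typeclass_instances.
#[global] Hint Extern 50 (DefP3 ?R) => def_closed R : typeclass_instances.
#[global] Hint Extern 50 (DefF1 ?f) => def_closed f : typeclass_instances.
#[global] Hint Extern 50 (DefF2 ?f) => def_closed f : typeclass_instances.

(** * Set theory with atoms in a structure *)

Notation "x ∊ y" := (elt x y) (at level 70, no associativity).

(* The axioms of ZFA without the infinity of the set of atoms; replacement for
   partial class functions covers separation. *)
Class ZF (S : structure) : Prop := {
  ax_ext : forall x y : S, isset x -> isset y -> (forall z, z ∊ x <-> z ∊ y) -> x = y;
  ax_found : forall x : S, (exists y, y ∊ x) ->
    exists y, y ∊ x /\ forall z, z ∊ x -> ~ z ∊ y;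
  ax_pair : forall x y : S, exists b, isset b /\ forall z, z ∊ b <-> z = x \/ z = y;
  ax_union : forall x : S,
    exists b, isset b /\ forall z, z ∊ b <-> exists y, y ∊ x /\ z ∊ y;
  ax_power : forall x : S,
    exists b, isset b /\ forall z, z ∊ b <-> isset z /\ forall t, t ∊ z -> t ∊ x;
  ax_inf : exists b : S, (exists e, e ∊ b /\ isset e /\ forall z, ~ z ∊ e) /\
    forall y, y ∊ b ->
      exists s, s ∊ b /\ isset s /\ forall z, z ∊ s <-> z ∊ y \/ z = y;
  ax_repl : forall (R : S -> S -> Prop), DefP2 R -> forall a,
    (forall x y y', x ∊ a -> R x y -> R x y' -> y = y') ->
    exists b, isset b /\ forall y, y ∊ b <-> exists x, x ∊ a /\ R x y;
  ax_atomEmpty : forall x : S, atm x -> forall y, ~ y ∊ x;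
  ax_atomSet : exists a : S, isset a /\ forall z, z ∊ a <-> atm z
}.

Section SetTheory.
Context {S : structure} {zf : ZF S}.
Implicit Types (P Q : S -> Prop) (x y z a b f : S).

(** * Smallness and the basic set constructions *)

Definition small P : Prop := exists b, isset b /\ forall z, z ∊ b <-> P z.

Lemma setofP P : small P -> forall z, z ∊ setof P <-> P z.
Proof.
move=> [b [h1 h2]] z; rewrite /setof (the_eq (x := b)) // => y [? k].
by apply: ax_ext => // t; rewrite k h2.
Qed.

Lemma isset_setof P : small P -> isset (setof P).
Proof.
move=> [b [h1 h2]]; rewrite /setof (the_eq (x := b)) // => y [? k].
by apply: ax_ext => // t; rewrite k h2.
Qed.

Lemma elt_isset x y : x ∊ y -> isset y.
Proof. by move=> h a; exact: (ax_atomEmpty a h). Qed.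

Lemma setof_eq P x : isset x -> (forall z, z ∊ x <-> P z) -> setof P = x.
Proof.
move=> hx h; have sP : small P by exists x.
by apply: ax_ext (isset_setof sP) hx _ => z; rewrite setofP // h.
Qed.

Lemma eq_setof P Q : (forall z, P z <-> Q z) -> setof P = setof Q.
Proof. by move=> h; congr setof; apply: funext => z; apply: propext. Qed.

Lemma eq_small P Q : (forall z, P z <-> Q z) -> small P -> small Q.
Proof. by move=> e [b [h1 h2]]; exists b; split=> // z; rewrite h2. Qed.

Lemma small_sep P a : DefP1 P -> small (fun z => z ∊ a /\ P z).
Proof.
move=> hP; have [] := @ax_repl S zf (fun x y => y = x /\ P x) _ a.
- by move=> x y y' _ [-> _] [->].
- move=> b [h1 h2]; exists b; split=> // z; rewrite h2.
  by split=> [[x [? [-> ?]]]|[? ?]]; last exists z.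
Qed.

Lemma small_le P a : DefP1 P -> (forall z, P z -> z ∊ a) -> small P.
Proof.
by move=> /small_sep h k; apply: eq_small (h a) => z; split=> [[]|hz] //; split=> //; apply: k.
Qed.

Lemma small_sub P Q : DefP1 P -> small Q -> (forall z, P z -> Q z) -> small P.
Proof.
by move=> hP [b [_ hb]] h; apply: (@small_le _ b) => // z /h; rewrite hb.
Qed.

Lemma small_elt x : small (fun z => z ∊ x).
Proof. by apply: (@small_le _ x) => //; def. Qed.

(** Replacement along x ↦ {z | Q x z}, whose graph is definable, followed by a union. *)
Lemma small_bigU P (Q : S -> S -> Prop) : small P -> DefP2 Q ->
  (forall x, P x -> small (Q x)) -> small (fun z => exists x, P x /\ Q x z).
Proof.
move=> [a [_ ha]] hQ hs.
have [] := @ax_repl S zf (fun x y => isset y /\ forall z, z ∊ y <-> Q x z) _ a.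
- move=> x y y' _ [i1 h1] [i2 h2].
  by apply: ax_ext => // z; rewrite h1 h2.
move=> b [_ hb]; have [c [ic hc]] := ax_union b; exists c; split=> // z.
rewrite hc; split=> [[y []]|[x [px qx]]].
  by rewrite hb => -[x [/ha ? [_ h]]] /h ?; exists x.
have [d [id hd]] := hs x px; exists d; rewrite hd hb; split=> //.
by exists x; rewrite ha.
Qed.

Lemma small_pair x y : small (fun z => z = x \/ z = y).
Proof. exact: ax_pair. Qed.

Lemma small_eq x : small (fun z => z = x).
Proof. by apply: eq_small (small_pair x x) => z; tauto. Qed.

Lemma small_img P (f : S -> S) : small P -> DefF1 f ->
  small (fun y => exists x, P x /\ y = f x).
Proof. by move=> hP hf; apply: small_bigU => // x _; apply: small_eq. Qed.

Lemma small_or P Q : small P -> small Q -> small (fun z => P z \/ Q z).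
Proof.
move=> [a [_ ha]] [b [_ hb]]; have [c [_ hc]] := ax_pair a b.
have [d [id hd]] := ax_union c; exists d; split=> // z; rewrite hd.
split=> [[y []]|[/ha h|/hb h]].
- by rewrite hc => -[] -> => [/ha|/hb]; tauto.
- by exists a; rewrite hc; tauto.
- by exists b; rewrite hc; tauto.
Qed.

Lemma small_false : small (fun _ => False).
Proof.
have [a [ia ha]] := @ax_atomSet S zf.
by apply: (@small_le _ a) => //; def.
Qed.

Definition sempty : S := setof (fun _ => False).
Definition upair x y := setof (fun z => z = x \/ z = y).
Definition sing x := upair x x.
Definition pr x y := upair (sing x) (upair x y).
Definition cup x y := setof (fun z => z ∊ x \/ z ∊ y).
Definition bigU x := setof (fun z => exists y, y ∊ x /\ z ∊ y).
Definition pow x := setof (fun z => isset z /\ forall t, t ∊ z -> t ∊ x).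
Definition succ x := setof (fun z => z ∊ x \/ z = x).
Definition atoms : S := setof atm.

#[global] Instance DefF2_upair : DefF2 upair. Proof. by def. Qed.
#[global] Instance DefF1_sing : DefF1 sing. Proof. by def. Qed.
#[global] Instance DefF2_pr : DefF2 pr. Proof. by def. Qed.
#[global] Instance DefF2_cup : DefF2 cup. Proof. by def. Qed.
#[global] Instance DefF1_bigU : DefF1 bigU. Proof. by def. Qed.
#[global] Instance DefF1_pow : DefF1 pow. Proof. by def. Qed.
#[global] Instance DefF1_succ : DefF1 succ. Proof. by def. Qed.

Lemma in_empty z : ~ z ∊ sempty.
Proof. by rewrite setofP //; apply: small_false. Qed.

Lemma in_upair x y z : z ∊ upair x y <-> z = x \/ z = y.
Proof. by rewrite setofP //; apply: small_pair. Qed.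

Lemma in_sing x z : z ∊ sing x <-> z = x.
Proof. by rewrite in_upair; tauto. Qed.

Lemma in_cup x y z : z ∊ cup x y <-> z ∊ x \/ z ∊ y.
Proof. by rewrite setofP //; apply: small_or; apply: small_elt. Qed.

Lemma in_bigU x z : z ∊ bigU x <-> exists y, y ∊ x /\ z ∊ y.
Proof. by rewrite setofP //; apply: ax_union. Qed.

Lemma in_pow x z : z ∊ pow x <-> isset z /\ forall t, t ∊ z -> t ∊ x.
Proof. by rewrite setofP //; apply: ax_power. Qed.

Lemma in_succ x z : z ∊ succ x <-> z ∊ x \/ z = x.
Proof. by rewrite setofP //; apply: small_or (small_elt x) (small_eq x). Qed.

Lemma in_atoms z : z ∊ atoms <-> atm z.
Proof. by rewrite setofP //; apply: ax_atomSet. Qed.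

Lemma isset_empty : isset sempty.
Proof. exact/isset_setof/small_false. Qed.

Lemma isset_upair x y : isset (upair x y).
Proof. exact/isset_setof/small_pair. Qed.

Lemma isset_cup x y : isset (cup x y).
Proof. by apply/isset_setof/small_or; apply: small_elt. Qed.

Lemma isset_succ x : isset (succ x).
Proof. exact/isset_setof/(small_or (small_elt x) (small_eq x)). Qed.

Lemma isset_atoms : isset atoms.
Proof. exact/isset_setof/ax_atomSet. Qed.

Lemma empty_eq x : isset x -> (forall z, ~ z ∊ x) -> x = sempty.
Proof.
by move=> h n; apply: ax_ext h isset_empty _ => z; split=> [/n|/in_empty].
Qed.

Lemma sing_inj x y : sing x = sing y -> x = y.
Proof. by move=> e; apply/in_sing; rewrite -e in_sing. Qed.

Lemma pr_inj x y x' y' : pr x y = pr x' y' -> x = x' /\ y = y'.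
Proof.
move=> e; have ex : x = x'.
  have : sing x ∊ pr x' y' by rewrite -e in_upair; left.
  rewrite in_upair => -[/sing_inj //|e'].
  by have : x' ∊ sing x by [rewrite e' in_upair; left]; rewrite in_sing.
split=> //; subst x'.
have : upair x y ∊ pr x y' by rewrite -e in_upair; right.
have : upair x y' ∊ pr x y by rewrite e in_upair; right.
have h u v : upair x u = sing x \/ upair x u = upair x v -> u = x \/ u = v.
  have hu : u ∊ upair x u by rewrite in_upair; right.
  by case=> e'; rewrite e' in hu; move: hu; rewrite in_upair; tauto.
by rewrite !in_upair => /h h1 /h h2; case: h1 h2 => [->|->] // [->|->].
Qed.

Lemma in_add_pr f a b x y :
  pr x y ∊ cup f (sing (pr a b)) <-> pr x y ∊ f \/ x = a /\ y = b.
Proof.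
rewrite in_cup in_sing.
by split=> -[?|]; [left|move=> /pr_inj; right|left|move=> [-> ->]; right].
Qed.

Lemma small_img2 P Q (f : S -> S -> S) : small P -> small Q -> DefF2 f ->
  small (fun z => exists x, P x /\ exists y, Q y /\ z = f x y).
Proof.
move=> hP [b [_ hb]] hf.
apply: (eq_small (P := fun z => exists x, P x /\ exists y, y ∊ b /\ z = f x y)).
  by move=> z; split=> -[x [px [y [/hb qy ->]]]]; exists x; split=> //; exists y.
apply: small_bigU => //.
by move=> x _; apply: small_img (small_elt b) _; def.
Qed.

Lemma small_prod P Q : small P -> small Q ->
  small (fun z => exists x, P x /\ exists y, Q y /\ z = pr x y).
Proof. by move=> hP hQ; apply: small_img2. Qed.

Lemma no_cycle1 x : ~ x ∊ x.
Proof.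
move=> h; have [|y []] := @ax_found S zf (sing x); first by exists x; rewrite in_sing.
by rewrite in_sing => -> /(_ x); rewrite in_sing; apply.
Qed.

Lemma no_cycle2 x y : x ∊ y -> ~ y ∊ x.
Proof.
move=> h1 h2; have [|z []] := @ax_found S zf (upair x y).
  by exists x; rewrite in_upair; left.
rewrite in_upair => -[] -> h.
  by apply: (h y) => //; rewrite in_upair; right.
by apply: (h x) => //; rewrite in_upair; left.
Qed.

Lemma succ_inj x y : succ x = succ y -> x = y.
Proof.
move=> e; have : x ∊ succ y by rewrite -e in_succ; right.
have : y ∊ succ x by rewrite e in_succ; right.
by rewrite !in_succ => -[h1|->] // -[h2|->] //; case: (no_cycle2 h1 h2).
Qed.

Lemma succ_neq0 x : succ x <> sempty.
Proof. by move=> e; apply: (@in_empty x); rewrite -e in_succ; right. Qed.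

(** * Natural numbers *)

Definition inductive a := sempty ∊ a /\ forall n, n ∊ a -> succ n ∊ a.
#[global] Instance DefP1_inductive : DefP1 inductive.
Proof. by def. Qed.

Definition omega : S := setof (fun n => forall a, inductive a -> n ∊ a).

Lemma small_omega : small (fun n => forall a, inductive a -> n ∊ a).
Proof.
have [b [[e [eb [ie he]]] hb]] := @ax_inf S zf.
apply: (@small_le _ b).
move=> n'; apply; split; first by rewrite -(empty_eq ie he).
move=> y /hb[s [sb [iss hs]]]; rewrite (_ : succ y = s) //.
by apply: ax_ext (@isset_succ y) iss _ => z; rewrite hs in_succ.
Qed.

Lemma in_omega n : n ∊ omega <-> forall a, inductive a -> n ∊ a.
Proof. by rewrite setofP //; apply: small_omega. Qed.

Lemma isset_omega : isset omega.
Proof. exact/isset_setof/small_omega. Qed.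

Lemma omega0 : sempty ∊ omega.
Proof. by rewrite in_omega => a []. Qed.

Lemma omegaS n : n ∊ omega -> succ n ∊ omega.
Proof. by rewrite !in_omega => h a ha; apply: ha.2; apply: h. Qed.

Lemma omega_ind P : DefP1 P -> P sempty ->
  (forall n, n ∊ omega -> P n -> P (succ n)) -> forall n, n ∊ omega -> P n.
Proof.
move=> hP h0 hS n hn; have hs := small_sep omega hP.
have : n ∊ setof (fun z => z ∊ omega /\ P z).
  move/in_omega: hn; apply; split; first by apply/(setofP hs); split=> //; apply: omega0.
  move=> m; rewrite !(setofP hs) => -[h1 h2]; split; [exact: omegaS|exact: hS].
by move/(setofP hs) => -[].
Qed.

(** ** Transitive closure and ∈-induction *)

Definition trans a := forall y, y ∊ a -> forall z, z ∊ y -> z ∊ a.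
#[global] Instance DefP1_trans : DefP1 trans. Proof. by def. Qed.

Section TransClosure.
Variable x0 : S.

(** Approximations to n ↦ ⋃ⁿ x0: each pair is the initial one or arises from another pair of f. No
    domain is prescribed, so the successor step only has to add one pair. *)
Definition chain f := forall k z, pr k z ∊ f ->
  (k = sempty /\ z = x0) \/
  exists k' z', pr k' z' ∊ f /\ k = succ k' /\ z = bigU z'.
#[local] Instance DefP1_chain : DefP1 chain. Proof. by def. Qed.

Definition iterU n z := exists f, chain f /\ pr n z ∊ f.
#[local] Instance DefP2_iterU : DefP2 iterU. Proof. by def. Qed.

Lemma iterU0 : iterU sempty x0.
Proof.
exists (sing (pr sempty x0)); rewrite in_sing; split=> // k z.
by rewrite in_sing => /pr_inj[-> ->]; left.
Qed.

Lemma iterU_fun n : n ∊ omega -> forall z z', iterU n z -> iterU n z' -> z = z'.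
Proof.
move: n; apply: omega_ind.
  move=> z z' [f [hf /hf]] [[_ ->]|[? [? [_ [/esym/succ_neq0 //]]]]].
  by move=> [g [hg /hg]] [[_ ->]|[? [? [_ [/esym/succ_neq0 //]]]]].
move=> n _ IH z z' [f [hf /hf]] [[/succ_neq0 //]|[k [t [kf [/succ_inj e ->]]]]].
move=> [g [hg /hg]] [[/succ_neq0 //]|[k' [t' [kg [/succ_inj e' ->]]]]].
by subst k k'; rewrite (IH t t') //; [exists f|exists g].
Qed.

Lemma iterU_tot n : n ∊ omega -> exists z, iterU n z.
Proof.
move: n; apply: omega_ind.
  by exists x0; apply: iterU0.
move=> n _ [z [f [hf nf]]]; exists (bigU z), (cup f (sing (pr (succ n) (bigU z)))).
split; last by rewrite in_cup in_sing; right.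
move=> k t; rewrite in_cup in_sing => -[/hf[?|[k' [t' [h1 h2]]]]|/pr_inj[-> ->]].
- by left.
- by right; exists k', t'; rewrite in_cup; tauto.
- by right; exists n, z; rewrite in_cup; tauto.
Qed.

(** The superset is the union of all ⋃ⁿ x0 for n ∊ ω. *)
Lemma trans_superset : exists t, trans t /\ forall z, z ∊ x0 -> z ∊ t.
Proof.
have sP : small (fun w => exists n, n ∊ omega /\ exists z, iterU n z /\ w ∊ z).
  apply: small_bigU; [exact: small_elt|].
  move=> n hn; have [z hz] := iterU_tot hn.
  apply: eq_small (small_elt z) => w; split=> [?|[z' [hz' ?]]]; first by exists z.
  by rewrite (iterU_fun hn hz hz').
exists (setof (fun w => exists n, n ∊ omega /\ exists z, iterU n z /\ w ∊ z)).
split=> [y|z zx]; rewrite setofP //.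
  move=> [n [hn [z [hz yz]]]] w wy; rewrite setofP //.
  exists (succ n); split; first exact: omegaS.
  have [z' hz'] := iterU_tot (omegaS hn).
  exists z'; split=> //; have [f [hf /hf]] := hz'.
  move=> [[/succ_neq0 //]|[k [t [kf [/succ_inj e ->]]]]]; subst k.
  rewrite in_bigU; exists y; split=> //.
  by rewrite -(iterU_fun hn hz (z' := t)) //; exists f.
exists sempty; split; first exact: omega0.
by exists x0; split=> //; apply: iterU0.
Qed.

End TransClosure.

Definition tc x :=
  setof (fun w => forall t, trans t -> (forall z, z ∊ x -> z ∊ t) -> w ∊ t).
#[global] Instance DefF1_tc : DefF1 tc. Proof. by def. Qed.

Definition tcs x := tc (sing x).
#[global] Instance DefF1_tcs : DefF1 tcs. Proof. by def. Qed.

Lemma small_tc x :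
  small (fun w => forall t, trans t -> (forall z, z ∊ x -> z ∊ t) -> w ∊ t).
Proof.
by have [t [h1 h2]] := trans_superset x; apply: (@small_le _ t) => z; apply.
Qed.

Lemma in_tc x w : w ∊ tc x <->
  forall t, trans t -> (forall z, z ∊ x -> z ∊ t) -> w ∊ t.
Proof. by rewrite setofP //; apply: small_tc. Qed.

Lemma isset_tc x : isset (tc x).
Proof. exact/isset_setof/small_tc. Qed.

Lemma trans_tc x : trans (tc x).
Proof.
move=> y; rewrite in_tc => hy z zy; rewrite in_tc => t ht hx.
exact: (ht y (hy t ht hx)).
Qed.

Lemma tc_sub x z : z ∊ x -> z ∊ tc x.
Proof. by rewrite in_tc => zx t _; apply. Qed.

Lemma tcs_refl x : x ∊ tcs x.
Proof. by apply: tc_sub; rewrite in_sing. Qed.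

Lemma tcs_trans x y z : y ∊ tcs x -> z ∊ y -> z ∊ tcs x.
Proof. by move=> h; apply: trans_tc. Qed.

Lemma tcs_min x t : trans t -> x ∊ t -> forall z, z ∊ tcs x -> z ∊ t.
Proof. by move=> h1 h2 z /in_tc; apply=> // y; rewrite in_sing => ->. Qed.

Lemma tcs_sub x y : y ∊ x -> forall z, z ∊ tcs y -> z ∊ tcs x.
Proof.
by move=> h; apply: tcs_min; [apply: trans_tc|apply: tcs_trans h; apply: tcs_refl].
Qed.

Lemma tcsE x z : z ∊ tcs x <-> z = x \/ exists y, y ∊ x /\ z ∊ tcs y.
Proof.
split=> [|[->|[y [yx]]]]; [|exact: tcs_refl|exact: tcs_sub].
(* The elements satisfying the right-hand side form a transitive set containing x, which includes
   [tcs x] by minimality. *)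
pose P w := w ∊ tcs x /\ (w = x \/ exists y, y ∊ x /\ w ∊ tcs y).
have sP : small P by apply: small_sep; def.
move=> h; suff : z ∊ setof P by rewrite setofP // => -[].
move: z h; apply: tcs_min.
  move=> y; rewrite setofP // => -[h1 h2] w wy; rewrite setofP //.
  split; first exact: tcs_trans wy.
  case: h2 => [e|[u [ux yu]]]; right.
    by exists w; rewrite -e; split=> //; apply: tcs_refl.
  by exists u; split=> //; apply: tcs_trans wy.
by rewrite setofP //; split; [apply: tcs_refl|left].
Qed.

(** Foundation speaks of sets, so it is applied to the counterexamples inside [tcs x]; an ∊-minimal
    one contradicts the induction step. *)
Lemma eps_ind P : DefP1 P ->
  (forall x, (forall y, y ∊ x -> P y) -> P x) -> forall x, P x.
Proof.
move=> hP h x; apply: contrapT => nP.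
have sP : small (fun z => z ∊ tcs x /\ ~ P z) by apply: small_sep; def.
have [|y] := @ax_found S zf (setof (fun z => z ∊ tcs x /\ ~ P z)).
  by exists x; rewrite setofP //; split=> //; apply: tcs_refl.
rewrite setofP // => -[[yx nPy] hy]; apply: nPy; apply: h => z zy.
apply: contrapT => nPz; apply: (hy z) => //; rewrite setofP //.
by split=> //; apply: tcs_trans zy.
Qed.

Lemma no_cycle_tcs x y : y ∊ x -> ~ x ∊ tcs y.
Proof.
move: x y; apply: eps_ind.
move=> x IH y yx xy; case/tcsE: (xy) => [e|[z [zy xz]]].
  by subst y; apply: no_cycle1 yx.
by apply: (IH y yx z zy); apply: tcs_trans xz yx.
Qed.

(** ** Recursion *)

Section Recursion.
Variable G : S -> S -> S -> S.
Context {hG : DefF3 G}.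

(** Attempts at the recursion with parameter c. Their domains are closed under elements, and G sees
    only the set of the values at the elements of u, not the function. *)
Definition rec_good c f := forall u v, pr u v ∊ f ->
  (forall z, z ∊ u -> exists w, pr z w ∊ f) /\
  v = G c u (setof (fun w => exists z, z ∊ u /\ pr z w ∊ f)).
#[local] Instance DefP2_rec_good : DefP2 rec_good.
Proof. by def. Qed.

Definition rec_rel c u v := exists f, rec_good c f /\ pr u v ∊ f.
#[local] Instance DefP3_rec_rel : DefP3 rec_rel.
Proof. by def. Qed.

Definition rec c x := the (rec_rel c x).
#[global] Instance DefF2_rec : DefF2 rec. Proof. by def. Qed.

Lemma rec_rel_fun c u : forall v v', rec_rel c u v -> rec_rel c u v' -> v = v'.
Proof.
move: u; apply: eps_ind.
move=> u IH v v' [f [hf uf]] [g [hg ug]].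
have [f1 ->] := hf _ _ uf; have [g1 ->] := hg _ _ ug.
congr (G c u _); apply: eq_setof => w.
split=> -[z [zu zf']]; exists z; split=> //.
  have [w' h] := g1 _ zu; rewrite (IH z zu w w') //; by [exists f|exists g].
have [w' h] := f1 _ zu; rewrite (IH z zu w w') //; by [exists f|exists g].
Qed.

(** The values already defined on the closures of the elements of x form a set R by replacement, and
    adding the pair ⟨x, v⟩ makes it an attempt at x. The old pairs stay correct since x lies in none
    of these closures, by [no_cycle_tcs]. *)
Lemma rec_rel_step c x : (forall y, y ∊ x -> forall z, z ∊ tcs y -> exists w, rec_rel c z w) ->
  exists w, rec_rel c x w.
Proof.
move=> IH.
pose D z := exists y, y ∊ x /\ z ∊ tcs y.
have sD : small D.
  by apply: (@small_le _ (tcs x)) => [|z [y [yx]]]; [unfold D; def|apply: (tcs_sub yx)].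
have totD z : D z -> exists w, rec_rel c z w by move=> [y [yx]]; apply: IH.
have transD z u : D z -> u ∊ z -> D u.
  by move=> [y [yx zy]] uz; exists y; split=> //; apply: tcs_trans uz.
pose R p := exists z, D z /\ exists w, rec_rel c z w /\ p = pr z w.
have sR : small R.
  apply: small_bigU => //.
  move=> z /totD[w hw]; apply: eq_small (small_eq (pr z w)) => p.
  by split=> [->|[w' [hw' ->]]]; [exists w|rewrite (rec_rel_fun hw hw')].
have inR z w : R (pr z w) <-> D z /\ rec_rel c z w.
  by split=> [[z' [dz [w' [h /pr_inj[-> ->]]]]]|[dz h]] //; exists z; split=> //; exists w.
pose v := G c x (setof (fun w => exists z, z ∊ x /\ R (pr z w))).
have inf z w : pr z w ∊ cup (setof R) (sing (pr x v)) <->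
    D z /\ rec_rel c z w \/ z = x /\ w = v.
  by rewrite in_add_pr setofP // inR.
have xD : ~ D x.
  by move=> [y [yx]]; apply: no_cycle_tcs.
have Dx z : z ∊ x -> D z by move=> zx; exists z; split=> //; apply: tcs_refl.
exists v, (cup (setof R) (sing (pr x v))); split; last by rewrite inf; right.
move=> u w; rewrite inf => -[[du [f [hf uf]]]|[-> ->]]; last first.
  split=> [z zx|]; first by have [w' ?] := totD z (Dx z zx); exists w'; rewrite inf; left; split=> //; apply: Dx.
  congr (G c x _); apply: eq_setof => w'; split=> -[z [zx]].
    by rewrite inR => h; exists z; rewrite inf; split=> //; left.
  rewrite inf => -[h|[e _]]; first by exists z; rewrite inR.
  by subst z; case: (@no_cycle1 x).
have [h ->] := hf _ _ uf; split=> [z zu|].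
  have [w' hw'] := h z zu; exists w'; rewrite inf; left.
  by split; [apply: transD zu|exists f].
congr (G c u _); apply: eq_setof => w'; split=> -[z [zu]].
  move=> h'; exists z; rewrite inf; split=> //; left.
  by split; [apply: transD zu|exists f].
rewrite inf => -[[_ h']|[e _]]; last by subst z; case: xD; apply: transD zu.
have [w'' h''] := h z zu; exists z; split=> //.
by rewrite (rec_rel_fun h' (v' := w'')) //; exists f.
Qed.

(** The induction carries totality on all of [tcs x], which is what [rec_rel_step] asks of the
    elements of x. *)
Lemma rec_rel_tot c x : exists v, rec_rel c x v.
Proof.
suff h : forall z, z ∊ tcs x -> exists w, rec_rel c z w by apply/h/tcs_refl.
move: x; apply: eps_ind.
move=> x IH z /tcsE[->|[y [yx]]]; last exact: IH.
exact: rec_rel_step.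
Qed.

Lemma recP c x v : rec_rel c x v <-> v = rec c x.
Proof.
have [w hw] := rec_rel_tot c x.
have -> : rec c x = w by apply: (the_eq hw) => y hy; apply: rec_rel_fun hy hw.
by split=> [h|-> //]; apply: rec_rel_fun h hw.
Qed.

Lemma recE c x :
  rec c x = G c x (setof (fun w => exists z, z ∊ x /\ w = rec c z)).
Proof.
have [f [hf xf]] := (recP c x _).2 erefl.
have [h {1}->] := hf _ _ xf; congr (G c x _); apply: eq_setof => w.
split=> -[z [zx]].
  by move=> zw; exists z; split=> //; apply/recP; exists f.
move=> ->; exists z; split=> //; have [w' h'] := h z zx.
by rewrite -((recP c z w').1 _) //; exists f.
Qed.

Lemma small_rec c x : small (fun w => exists z, z ∊ x /\ w = rec c z).
Proof. by apply: small_img (small_elt x) _; def. Qed.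

End Recursion.
End SetTheory.

(** * Meaning of the set-theoretic formulas *)

Ltac sats := cbn [sat isSet isSubset fAllIn fExIn fNot fIff scons].

Lemma iff_and A B A' B' : (A <-> A') -> (B <-> B') -> (A /\ B <-> A' /\ B').
Proof. by tauto. Qed.
Lemma iff_or A B A' B' : (A <-> A') -> (B <-> B') -> (A \/ B <-> A' \/ B').
Proof. by tauto. Qed.
Lemma iff_imp (A B A' B' : Prop) :
  (A <-> A') -> (B <-> B') -> ((A -> B) <-> (A' -> B')).
Proof. by tauto. Qed.
Lemma iff_ex T (P Q : T -> Prop) :
  (forall x, P x <-> Q x) -> ((exists x, P x) <-> exists x, Q x).
Proof. by move=> h; split=> -[x /h ?]; exists x. Qed.
Lemma iff_all T (P Q : T -> Prop) :
  (forall x, P x <-> Q x) -> ((forall x, P x) <-> forall x, Q x).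
Proof. by move=> h; split=> k x; apply/h. Qed.

Ltac sat_leaf := fail.

Ltac sat_iff := repeat first
  [ exact: iff_refl
  | sat_leaf
  | apply: iff_and | apply: iff_or
  | apply: iff_ex => ? | apply: iff_all => ? | apply: iff_imp
  | progress sats ].

Section Formulas.
Context {S : structure} {zf : ZF S}.
Implicit Types (ρ : nat -> S) (x y z a b d f n : S).

Lemma sat_isEmpty ρ i : sat ρ (isEmpty i) <-> ρ i = sempty.
Proof.
rewrite /isEmpty; sats; split=> [[h n]|e]; first exact: empty_eq.
rewrite e.
by split; [exact: isset_empty|move=> z; apply: in_empty].
Qed.

Lemma eq_upairP z x y :
  isset z /\ (forall t, t ∊ z <-> t = x \/ t = y) <-> z = upair x y.
Proof.
split=> [[h1 h2]|->]; last by split; [exact: isset_upair|move=> t; apply: in_upair].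
by apply: ax_ext h1 (@isset_upair _ _ x y) _ => t; rewrite in_upair.
Qed.

Lemma sat_isUPair ρ k i j : sat ρ (isUPair k i j) <-> ρ k = upair (ρ i) (ρ j).
Proof. exact: eq_upairP. Qed.

Lemma sat_isOPair ρ k i j : sat ρ (isOPair k i j) <-> ρ k = pr (ρ i) (ρ j).
Proof.
rewrite /isOPair; sats; split=> [[u [v]]|e].
  by rewrite !sat_isUPair; sats => -[-> [-> ->]].
by exists (sing (ρ i)), (upair (ρ i) (ρ j)); rewrite !sat_isUPair.
Qed.

Lemma sat_isSucc ρ i j : sat ρ (isSucc i j) <-> ρ i = succ (ρ j).
Proof.
rewrite /isSucc; sats; split=> [[h1 h2]|->].
  by apply: ax_ext h1 (@isset_succ _ _ (ρ j)) _ => t; rewrite in_succ.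
by split; [exact: isset_succ|move=> t; apply: in_succ].
Qed.

Lemma sat_isTrans ρ i : sat ρ (isTrans i) <-> trans (ρ i).
Proof. by []. Qed.

Definition Ord x := isset x /\ trans x /\ forall y, y ∊ x -> isset y /\ trans y.
#[global] Instance DefP1_Ord : DefP1 Ord. Proof. by def. Qed.

Lemma sat_isOrd ρ i : sat ρ (isOrd i) <-> Ord (ρ i).
Proof. by []. Qed.

Definition Limit x := Ord x /\ x <> sempty /\ ~ exists y, x = succ y.

Lemma sat_isLimit ρ i : sat ρ (isLimit i) <-> Limit (ρ i).
Proof.
apply: iff_and; first exact: sat_isOrd.
apply: iff_and; sats; apply: iff_imp => //; first exact: sat_isEmpty.
by apply: iff_ex => y; apply: sat_isSucc.
Qed.

Lemma sat_isInductive ρ i : sat ρ (isInductive i) <-> inductive (ρ i).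
Proof.
rewrite /isInductive; sats; split=> [[[e [eb he]] h]|[h1 h2]].
  move/sat_isEmpty: he eb; sats => -> eb; split=> // n /h [s [sb]].
  by move=> /sat_isSucc; sats => <-.
split; first by exists sempty; split=> //; apply/sat_isEmpty.
by move=> n /h2 ?; exists (succ n); split=> //; apply/sat_isSucc.
Qed.

Lemma sat_isOmega ρ i : sat ρ (isOmega i) <-> ρ i = omega.
Proof.
rewrite /isOmega; sats; rewrite sat_isInductive; split=> [[h1 [h2 h3]]|->].
  apply: ax_ext h1 isset_omega _ => n; rewrite in_omega; split=> [h a ha|].
    by apply: (h3 a) => //; apply/sat_isInductive.
  exact.
split; [exact: isset_omega|split].
  by split=> [|n]; [apply: omega0|apply: omegaS].
by move=> a /sat_isInductive; sats => ha n; rewrite in_omega; apply.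
Qed.

Lemma sat_pairIn ρ k i j : sat ρ (pairIn k i j) <-> pr (ρ i) (ρ j) ∊ ρ k.
Proof.
rewrite /pairIn; sats; split=> [[z [zk /sat_isOPair]]|h]; first by sats => <-.
by exists (pr (ρ i) (ρ j)); split=> //; apply/sat_isOPair.
Qed.

Definition Fun f d :=
  isset f /\ (forall z, z ∊ f -> exists x, x ∊ d /\ exists y, z = pr x y)
  /\ (forall x, x ∊ d -> exists y, pr x y ∊ f)
  /\ (forall x y y', pr x y ∊ f -> pr x y' ∊ f -> y = y').
#[global] Instance DefP2_Fun : DefP2 Fun. Proof. by def. Qed.

Definition graph (F : S -> S) d := setof (fun z => exists x, x ∊ d /\ z = pr x (F x)).

Lemma small_graph (F : S -> S) d : DefF1 F -> small (fun z => exists x, x ∊ d /\ z = pr x (F x)).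
Proof. by move=> hF; apply: small_img (small_elt d) _; def. Qed.

Lemma in_graph (F : S -> S) d x y : DefF1 F -> pr x y ∊ graph F d <-> x ∊ d /\ y = F x.
Proof.
move=> hF; rewrite (setofP (small_graph d hF)).
by split=> [[x' [h /pr_inj[-> ->]]] //|[h ->]]; exists x.
Qed.

Lemma Fun_graph (F : S -> S) d : DefF1 F -> Fun (graph F d) d.
Proof.
move=> hF; split; [exact/isset_setof/small_graph|split; [|split]].
- by move=> z /(setofP (small_graph d hF))[x [hx ->]]; exists x; split=> //; exists (F x).
- by move=> x hx; exists (F x); apply/in_graph.
- by move=> x y y' /(in_graph _ _ _ hF)[_ ->] /(in_graph _ _ _ hF)[_ ->].
Qed.

Definition Map f a b := Fun f a /\ forall x y, pr x y ∊ f -> y ∊ b.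
#[global] Instance DefP3_Map : DefP3 Map. Proof. by def. Qed.

Definition Bij f a b := Map f a b
  /\ (forall x x' y, pr x y ∊ f -> pr x' y ∊ f -> x = x')
  /\ (forall y, y ∊ b -> exists x, x ∊ a /\ pr x y ∊ f).
#[global] Instance DefP3_Bij : DefP3 Bij. Proof. by def. Qed.

Ltac sat_leaf ::= first [ exact: sat_pairIn | exact: sat_isOPair
  | exact: sat_isOmega | exact: sat_isSucc | exact: sat_isEmpty
  | exact: sat_isUPair | exact: sat_isInductive ].

Lemma sat_isFun ρ i j : sat ρ (isFun i j) <-> Fun (ρ i) (ρ j).
Proof. by rewrite /isFun /Fun; sat_iff. Qed.

Lemma sat_isMap ρ i j k : sat ρ (isMap i j k) <-> Map (ρ i) (ρ j) (ρ k).
Proof. by apply: iff_and; [exact: sat_isFun|sat_iff]. Qed.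

Lemma sat_isBij ρ i j k : sat ρ (isBij i j k) <-> Bij (ρ i) (ρ j) (ρ k).
Proof. by apply: iff_and; [exact: sat_isMap|sat_iff]. Qed.

Lemma sat_isTC ρ i j : sat ρ (isTC i j) <-> ρ i = tc (ρ j).
Proof.
rewrite /isTC; sats; split=> [[h1 [h2 [h3 h4]]]|e].
  apply: ax_ext h1 (@isset_tc _ _ _) _ => z; split.
    apply: h4; split; [exact: isset_tc|split]; first exact: trans_tc.
    by move=> y; apply: tc_sub.
  by move/in_tc; apply.
split; [by rewrite e; exact: isset_tc|split; [|split]].
- by apply/sat_isTrans; rewrite e; apply: trans_tc.
- by move=> z; rewrite e; apply: tc_sub.
- by move=> t [_ [h1 h2]] z; rewrite e => /in_tc; apply.
Qed.

Lemma sat_isTCsing ρ i j : sat ρ (isTCsing i j) <-> ρ i = tcs (ρ j).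
Proof.
rewrite /isTCsing; sats; split=> [[u []]|e].
  by rewrite sat_isUPair sat_isTC; sats => ->.
by exists (sing (ρ j)); rewrite sat_isUPair sat_isTC.
Qed.

Lemma sat_isAtoms ρ i : sat ρ (isAtoms i) <-> ρ i = atoms.
Proof.
rewrite /isAtoms; sats; split=> [[h1 h2]|->].
  by apply: ax_ext h1 isset_atoms _ => z; rewrite in_atoms.
by split; [exact: isset_atoms|move=> z; apply: in_atoms].
Qed.

Definition Tuple s x := exists n, n ∊ omega /\ Map s n x.

Lemma sat_isTuple ρ i j : sat ρ (isTuple i j) <-> Tuple (ρ i) (ρ j).
Proof.
rewrite /isTuple; sats; split=> [[w [/sat_isOmega]]|[n [hn h]]].
  sats => -> [n [hn /sat_isMap h]].
  by exists n.
by exists omega; split; [apply/sat_isOmega|exists n; split=> //; apply/sat_isMap].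
Qed.

Lemma sat_isFinSet ρ i :
  sat ρ (isFinSet i) <-> exists n, n ∊ omega /\ exists f, Bij f n (ρ i).
Proof.
rewrite /isFinSet; sats; split=> [[w [/sat_isOmega]]|[n [hn [f h]]]].
  sats => -> [n [hn [f /sat_isBij h]]].
  by exists n; split=> //; exists f.
exists omega; split; [exact/sat_isOmega|exists n; split=> //].
by exists f; apply/sat_isBij.
Qed.

(** * Finite sets *)

(* Finiteness in the sense of Kuratowski and Tarski. *)
Definition Fin a := forall C, sempty ∊ C ->
  (forall b x, b ∊ C -> x ∊ a -> cup b (sing x) ∊ C) -> a ∊ C.
#[global] Instance DefP1_Fin : DefP1 Fin. Proof. by def. Qed.

Definition subset a b := isset a /\ forall z, z ∊ a -> z ∊ b.
#[global] Instance DefP2_subset : DefP2 subset. Proof. by def. Qed.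

Lemma subset_cup1 a b x : x ∊ a -> subset b a -> subset (cup b (sing x)) a.
Proof.
by move=> xa [h1 h2]; split; [exact: isset_cup|move=> z; rewrite in_cup in_sing => -[/h2|->]].
Qed.

(** [Fin] quantifies over sets, whereas P is a class, so P is cut down to the power set of a. *)
Lemma Fin_ind0 P a : DefP1 P -> Fin a -> P sempty ->
  (forall b x, subset b a -> P b -> x ∊ a -> P (cup b (sing x))) -> P a /\ isset a.
Proof.
move=> hP fa h0 hS.
have sP : small (fun b => b ∊ pow a /\ P b) by apply: small_sep.
suff : a ∊ setof (fun b => b ∊ pow a /\ P b).
  by rewrite (setofP sP) in_pow => -[[]].
apply: fa => [|b x]; rewrite !(setofP sP).
  by split=> //; rewrite in_pow; split; [exact: isset_empty|move=> t /in_empty].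
move=> [/in_pow h hb] xa; split; last exact: hS.
exact/in_pow/subset_cup1.
Qed.

Lemma Fin_set a : Fin a -> isset a.
Proof. by move=> h; have [] := @Fin_ind0 (fun _ => True) a _ h. Qed.

Lemma Fin0 : Fin sempty.
Proof. by []. Qed.

Lemma Fin_add a x : Fin a -> Fin (cup a (sing x)).
Proof.
move=> fa C C0 CS; apply: (CS) => //; last by rewrite in_cup in_sing; right.
by apply: fa => // b y bC ya; apply: CS => //; rewrite in_cup; left.
Qed.

Lemma Fin_ind P : DefP1 P -> P sempty ->
  (forall b x, Fin b -> P b -> P (cup b (sing x))) -> forall a, Fin a -> P a.
Proof.
move=> hP h0 hS a fa.
have [] // := @Fin_ind0 (fun b => Fin b /\ P b) a _ fa.
- by split.
- by move=> b x _ [fb pb] _; split; [exact: Fin_add|exact: hS].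
by move=> [].
Qed.

Lemma set_eq x y : isset x -> isset y -> (forall z, z ∊ x <-> z ∊ y) -> x = y.
Proof. exact: ax_ext. Qed.

Lemma Fin_sing x : Fin (sing x).
Proof.
rewrite (_ : sing x = cup sempty (sing x)); first exact/Fin_add/Fin0.
apply: set_eq; [exact: isset_upair|exact: isset_cup|move=> z].
by rewrite in_cup; split=> [|[/in_empty|]]; auto.
Qed.

Lemma Fin_cup a b : Fin a -> Fin b -> Fin (cup a b).
Proof.
move=> fa; move: b; apply: Fin_ind.
  rewrite (_ : cup a sempty = a) //; apply: set_eq; [exact: isset_cup|exact: Fin_set|].
  by move=> z; rewrite in_cup; split=> [[|/in_empty]|]; tauto.
move=> b x _ h.
rewrite (_ : cup a (cup b (sing x)) = cup (cup a b) (sing x)); first exact: Fin_add.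
by apply: set_eq; [exact: isset_cup|exact: isset_cup|move=> z; rewrite !in_cup; tauto].
Qed.

Lemma Fin_sub a b : Fin a -> subset b a -> Fin b.
Proof.
move=> fa; move: b; move: a fa.
apply: Fin_ind.
  by move=> b [h1 h2]; rewrite (empty_eq h1) // => z /h2/in_empty.
move=> a x _ IH b [h1 h2].
have sP : small (fun z => z ∊ b /\ z <> x) by apply: small_sep; def.
have fb : Fin (setof (fun z => z ∊ b /\ z <> x)).
  apply: IH; split; first exact: isset_setof.
  by move=> z; rewrite setofP // => -[/h2]; rewrite in_cup in_sing => -[].
have [xb|xb] := pselect (x ∊ b).
  rewrite (_ : b = cup (setof (fun z => z ∊ b /\ z <> x)) (sing x)); first exact: Fin_add.
  apply: set_eq => //; first exact: isset_cup.
  move=> z; rewrite in_cup in_sing setofP //; split=> [zb|[[]|->] //].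
  by have [->|] := pselect (z = x); tauto.
rewrite (_ : b = setof (fun z => z ∊ b /\ z <> x)) //.
apply: set_eq => //; first exact: isset_setof.
move=> z; rewrite setofP //; split=> [zb|[]//]; split=> // e.
by apply: xb; rewrite -e.
Qed.

Lemma Fin_img (f : S -> S) a : DefF1 f -> Fin a -> Fin (setof (fun y => exists x, x ∊ a /\ y = f x)).
Proof.
move=> hf; move: a; apply: Fin_ind.
  rewrite (_ : setof _ = sempty) //; apply: setof_eq; first exact: isset_empty.
  by move=> z; split=> [/in_empty|[x [/in_empty]]].
move=> a x _ IH; pose proof (small_img (small_elt a) hf) as s.
rewrite (_ : setof _ = cup (setof (fun y => exists x, x ∊ a /\ y = f x)) (sing (f x))).
  exact: Fin_add.
apply: setof_eq; first exact: isset_cup.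
move=> z; rewrite in_cup in_sing (setofP s); split=> [[[t [ta ->]]|->]|[t []]].
- by exists t; rewrite in_cup; split=> //; left.
- by exists x; rewrite in_cup in_sing; split=> //; right.
by rewrite in_cup in_sing => -[ta|->] ->; [left; exists t|right].
Qed.

(** Links [Fin] with the bijections from natural numbers in [isFinSet]. A new element x gets the
    index n, which is new because no set is its own element. *)
Lemma Fin_finset a : Fin a -> exists n, n ∊ omega /\ exists f, Bij f n a.
Proof.
move: a; apply: Fin_ind.
  exists sempty; split; first exact: omega0.
  exists sempty.
  split; [split; [split; [exact: isset_empty|split; [|split]]|]|split];
    by intros; exfalso; eapply in_empty; eassumption.
move=> a x _ [n [hn [f [[[f1 [f2 [f3 f4]]] f5] [f6 f7]]]]].
have [xa|xa] := pselect (x ∊ a).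
  exists n; split=> //; exists f; split; [split; first by []|split=> //].
    by move=> u v /f5; rewrite in_cup; left.
  by move=> y; rewrite in_cup in_sing => -[/f7 //|->]; apply: f7.
have inn u v : pr u v ∊ f -> u ∊ n.
  by move=> /f2[u' [hu [v' /pr_inj[-> _]]]].
have nn v : ~ pr n v ∊ f by move=> /inn/no_cycle1.
have ing u v := in_add_pr f n x u v.
exists (succ n); split; first exact: omegaS.
exists (cup f (sing (pr n x))); split; [split; [split; [|split; [|split]]|]|split].
- exact: isset_cup.
- move=> z; rewrite in_cup in_sing => -[/f2[u [hu hz]]|->].
    by exists u; split=> //; rewrite in_succ; left.
  by exists n; split; [rewrite in_succ; right|exists x].
- move=> u; rewrite in_succ => -[/f3[v h]|->]; first by exists v; rewrite ing; left.
  by exists x; rewrite ing; right.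
- move=> u v v'; rewrite !ing => -[h1|[-> ->]] [h2|[e ->]] //; first exact: f4 h1 h2.
    by subst u; case: (nn _ h1).
  by case: (nn _ h2).
- move=> u v; rewrite ing in_cup in_sing => -[/f5|[_ ->]]; tauto.
- move=> u u' v; rewrite !ing => -[h1|[-> ->]] [h2|[-> e]] //; first exact: f6 h1 h2.
    by subst v; case: xa; apply: f5 h1.
  by case: xa; apply: f5 h2.
- move=> y; rewrite in_cup in_sing => -[/f7[u [hu h]]|->].
    by exists u; rewrite in_succ ing; tauto.
  by exists n; rewrite in_succ ing; tauto.
Qed.

End Formulas.

Ltac sat_leaf ::= first [ exact: sat_pairIn | exact: sat_isOPair
  | exact: sat_isOmega | exact: sat_isSucc | exact: sat_isEmpty
  | exact: sat_isUPair | exact: sat_isInductive | exact: sat_isFun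
  | exact: sat_isMap | exact: sat_isBij | exact: sat_isTC | exact: sat_isTCsing
  | exact: sat_isAtoms | exact: sat_isTuple | exact: sat_isOrd | exact: sat_isLimit ].

(** * Hereditarily symmetric sets *)

Section Symmetric.
Context {S : structure} {zf : ZF S}.
Implicit Types (ρ : nat -> S) (x y z a b f n p q π σ h s : S).

Definition Sym p := Bij p atoms atoms.
#[global] Instance DefP1_Sym : DefP1 Sym. Proof. by def. Qed.

Definition act_step p x r :=
  the (fun y => (atm x /\ pr x y ∊ p) \/ (isset x /\ y = r)).
#[local] Instance DefF3_act_step : DefF3 act_step.
Proof. by def. Qed.

Definition act p x := rec act_step p x.
#[global] Instance DefF2_act : DefF2 act. Proof. by def. Qed.

Lemma small_act p x : small (fun w => exists z, z ∊ x /\ w = act p z).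
Proof. exact: small_rec. Qed.

Lemma act_setE p x : isset x ->
  act p x = setof (fun w => exists z, z ∊ x /\ w = act p z).
Proof.
move=> hx; rewrite /act recE /act_step; apply: the_eq; first by right.
by move=> y [[/hx]|[_ ->]].
Qed.

Lemma isset_act p x : isset x -> isset (act p x).
Proof. by move=> /act_setE ->; apply/isset_setof/small_act. Qed.

Lemma in_act p x w : isset x -> w ∊ act p x <-> exists z, z ∊ x /\ w = act p z.
Proof. by move=> /act_setE ->; rewrite (setofP (small_act p x)). Qed.

Lemma act_atomP p x y : Sym p -> atm x -> act p x = y <-> pr x y ∊ p.
Proof.
move=> [[[h1 [h2 [h3 h4]]] h5] _] ax.
have [z hz] := h3 x ((in_atoms x).2 ax).
suff -> : act p x = z by split=> [<-|] //; apply: h4.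
rewrite /act recE /act_step; apply: the_eq; first by left.
by move=> t [[_ /h4]|[]] //; apply.
Qed.

Lemma act_atom p x : Sym p -> atm x -> pr x (act p x) ∊ p.
Proof. by move=> hp ax; apply/act_atomP. Qed.

Lemma Sym_atm p x y : Sym p -> pr x y ∊ p -> atm x /\ atm y.
Proof.
move=> [[[h1 [h2 _]] h5] _] h; split; last exact/in_atoms/h5/h.
by have [u [hu [v /pr_inj[-> _]]]] := h2 _ h; apply/in_atoms.
Qed.

Lemma act_atm p x : Sym p -> atm x -> atm (act p x).
Proof. by move=> hp ax; have [] := Sym_atm hp (act_atom hp ax). Qed.

Lemma act_atmE p x : Sym p -> atm (act p x) <-> atm x.
Proof.
move=> hp; split; last exact: act_atm.
by move=> h; apply: contrapT => sx; apply: (@isset_act p x).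
Qed.

Lemma act_elt p x y : y ∊ x -> act p y ∊ act p x.
Proof. by move=> yx; apply/in_act; [apply: elt_isset yx|exists y]. Qed.

Lemma small_field p : small (fun x => exists y, pr x y ∊ p \/ pr y x ∊ p).
Proof.
apply: (@small_le _ _ _ (bigU (bigU p))).
move=> x [y [h|h]]; rewrite in_bigU.
  by exists (upair x y); rewrite in_bigU !in_upair; split; [exists (pr x y); rewrite in_upair; tauto|tauto].
by exists (upair y x); rewrite in_bigU !in_upair; split; [exists (pr y x); rewrite in_upair; tauto|tauto].
Qed.

(** * Inverses and composites of permutations *)

Definition inv p := setof (fun z => exists y x, z = pr y x /\ pr x y ∊ p).
#[global] Instance DefF1_inv : DefF1 inv. Proof. by def. Qed.

Lemma small_inv p : small (fun z => exists y x, z = pr y x /\ pr x y ∊ p).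
Proof.
pose proof (small_prod (small_field p) (small_field p)) as h.
apply: (small_sub _ h).
move=> z [y [x [-> hxy]]].
by exists y; split; [exists x; right|exists x; split=> //; exists y; left].
Qed.

Lemma in_inv p y x : pr y x ∊ inv p <-> pr x y ∊ p.
Proof.
rewrite (setofP (small_inv p)).
by split=> [[y' [x' [/pr_inj[-> ->]]]]|h] //; exists y, x.
Qed.

Lemma isset_inv p : isset (inv p).
Proof. exact/isset_setof/small_inv. Qed.

Lemma inv_pair p z : z ∊ inv p -> exists y x, z = pr y x /\ pr x y ∊ p.
Proof. by move/(setofP (small_inv p)). Qed.

Lemma Bij_inv f a b : Bij f a b -> Bij (inv f) b a.
Proof.
move=> [[[h1 [h2 [h3 h4]]] h5] [h6 h7]].
have h8 x y : pr x y ∊ f -> x ∊ a.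
  by move=> /h2[u [hu [v /pr_inj[-> _]]]].
split; [split; [split; [exact: isset_inv|split; [|split]]|]|split].
- by move=> z /inv_pair[y [x [-> h]]]; exists y; split; [apply: h5 h|exists x].
- by move=> y /h7[x [_ h]]; exists x; rewrite in_inv.
- by move=> y x x'; rewrite !in_inv; apply: h6.
- by move=> y x; rewrite in_inv => /h8.
- by move=> y y' x; rewrite !in_inv; apply: h4.
- by move=> x hx; have [y h] := h3 x hx; exists y; rewrite in_inv; split=> //; apply: h5 h.
Qed.

Lemma Sym_inv p : Sym p -> Sym (inv p).
Proof. exact: Bij_inv. Qed.

Definition comp p q := setof (fun z => exists x y w,
  z = pr x w /\ pr x y ∊ q /\ pr y w ∊ p).

Lemma small_comp p q : small (fun z => exists x y w,
  z = pr x w /\ pr x y ∊ q /\ pr y w ∊ p).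
Proof.
pose proof (small_prod (small_field q) (small_field p)) as h.
apply: (small_sub _ h).
move=> z [x [y [w [-> [h1 h2]]]]].
by exists x; split; [exists y; left|exists w; split=> //; exists y; right].
Qed.

Lemma in_comp p q x w : pr x w ∊ comp p q <-> exists y, pr x y ∊ q /\ pr y w ∊ p.
Proof.
rewrite (setofP (small_comp p q)).
split=> [[x' [y [w' [/pr_inj[-> ->]]]]]|[y h]]; first by exists y.
by exists x, y, w.
Qed.

Lemma isset_comp p q : isset (comp p q).
Proof. exact/isset_setof/small_comp. Qed.

Lemma Sym_comp p q : Sym p -> Sym q -> Sym (comp p q).
Proof.
move=> hp hq; have [[[p1 [p2 [p3 p4]]] p5] [p6 p7]] := hp.
have [[[q1 [q2 [q3 q4]]] q5] [q6 q7]] := hq.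
split; [split; [split; [exact: isset_comp|split; [|split]]|]|split].
- move=> z /(setofP (small_comp p q))[x [y [w [-> [h _]]]]].
  by exists x; split; [apply/in_atoms; apply: (Sym_atm hq h).1|exists w].
- move=> x /q3[y h]; have [w h'] := p3 y (q5 _ _ h).
  by exists w; rewrite in_comp; exists y.
- move=> x w w'; rewrite !in_comp => -[y [h1 h2]] [y' [h3 h4]].
  by move: h4; rewrite -(q4 _ _ _ h1 h3); apply: p4.
- by move=> x w; rewrite in_comp => -[y [_ /p5]].
- move=> x x' w; rewrite !in_comp => -[y [h1 h2]] [y' [h3 h4]].
  by move: h3; rewrite -(p6 _ _ _ h2 h4); apply: q6.
- move=> w /p7[y [/q7[x [hx h1]] h2]]; exists x; split=> //.
  by rewrite in_comp; exists y.
Qed.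

Lemma act_comp p q x : Sym p -> Sym q -> act (comp p q) x = act p (act q x).
Proof.
move=> hp hq; move: x; apply: eps_ind.
move=> x IH; have [ax|sx] := pselect (atm x).
  apply/act_atomP => //; first exact: Sym_comp.
  rewrite in_comp; exists (act q x); split; first exact: act_atom.
  by apply: act_atom => //; apply: act_atm.
apply: set_eq; [exact: isset_act|by do 2! apply: isset_act|].
move=> w; rewrite !in_act //; last exact: isset_act.
split=> [[z [zx ->]]|[z [/(in_act _ _ sx)]]].
  by exists (act q z); rewrite IH //; split=> //; apply: act_elt.
by move=> [u [ux ->]] ->; exists u; rewrite IH.
Qed.

Lemma act_inv p x : Sym p -> act (inv p) (act p x) = x.
Proof.
move=> hp; move: x; apply: eps_ind.
move=> x IH; have [ax|sx] := pselect (atm x).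
  apply/act_atomP; [exact: Sym_inv|exact: act_atm|].
  by rewrite in_inv; apply: act_atom.
apply: set_eq => //; first by do 2! apply: isset_act.
move=> w; rewrite in_act; last exact: isset_act.
split=> [[z [/(in_act _ _ sx) [u [ux ->]] ->]]|wx]; first by rewrite IH.
by exists (act p w); rewrite IH //; split=> //; apply: act_elt.
Qed.

Lemma inv_inv f : isset f -> (forall z, z ∊ f -> exists x y, z = pr x y) ->
  inv (inv f) = f.
Proof.
move=> sf h; apply: set_eq => //; first exact: isset_inv.
move=> z; split=> [/inv_pair[y [x [->]]]|hz]; first by rewrite in_inv.
by have [x [y e]] := h z hz; subst z; rewrite !in_inv.
Qed.

Lemma act_invK p x : Sym p -> act p (act (inv p) x) = x.
Proof.
move=> hp; have [[[sp [h _]] _] _] := hp.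
rewrite -{1}(inv_inv sp) ?act_inv //; first exact: Sym_inv.
by move=> z /h[u [_ [v ->]]]; exists u, v.
Qed.

Lemma act_empty p : act p sempty = sempty.
Proof.
apply: empty_eq => [|z]; first exact: (@isset_act p _ isset_empty).
by move/(in_act _ _ isset_empty) => [t [/in_empty]].
Qed.

Lemma act_upair p x y : act p (upair x y) = upair (act p x) (act p y).
Proof.
have su := @isset_upair S zf x y.
apply: set_eq; [exact: isset_act|exact: isset_upair|].
move=> z; rewrite in_act // in_upair; split=> [[t [/in_upair[] -> ->]]|[]->]; auto.
  by exists x; rewrite in_upair; auto.
by exists y; rewrite in_upair; auto.
Qed.

Lemma act_pr p x y : act p (pr x y) = pr (act p x) (act p y).
Proof. by rewrite /pr act_upair /sing !act_upair. Qed.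

Lemma act_succ p x : isset x -> act p (succ x) = succ (act p x).
Proof.
move=> sx; have ss := @isset_succ S zf x.
apply: set_eq; [exact: isset_act|exact: isset_succ|].
move=> z; rewrite in_act // in_succ in_act //.
split=> [[t [/in_succ[tx|->] ->]]|[[t [tx ->]]|->]].
- by left; exists t.
- by right.
- by exists t; rewrite in_succ; auto.
- by exists x; rewrite in_succ; auto.
Qed.

Lemma isset_omega_elt n : n ∊ omega -> isset n.
Proof.
move: n; apply: omega_ind; first exact: isset_empty.
by move=> n _ _; apply: isset_succ.
Qed.

Lemma act_omega p n : n ∊ omega -> act p n = n.
Proof.
move: n; apply: omega_ind; [exact: act_empty|move=> n hn e].
by rewrite act_succ ?e //; apply: isset_omega_elt.
Qed.

(** * Finite supports *)

Definition supp a x := forall p, Sym p ->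
  (forall c, c ∊ a -> act p c = c) -> act p x = x.
#[global] Instance DefP2_supp : DefP2 supp. Proof. by def. Qed.

Definition fsupp x := exists a, Fin a /\ (forall c, c ∊ a -> atm c) /\ supp a x.
#[global] Instance DefP1_fsupp : DefP1 fsupp. Proof. by def. Qed.

Definition HS x := forall y, y ∊ tcs x -> fsupp y.
#[global] Instance DefP1_HS : DefP1 HS. Proof. by def. Qed.

Lemma HS_elt x y : HS x -> y ∊ x -> HS y.
Proof. by move=> h yx z zy; apply: h; apply: (tcs_sub yx). Qed.

Lemma HS_fsupp x : HS x -> fsupp x.
Proof. by apply; apply: tcs_refl. Qed.

Lemma HS_intro x : (forall y, y ∊ x -> HS y) -> fsupp x -> HS x.
Proof. by move=> h f y /tcsE[-> //|[z [/h]]]; apply. Qed.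

(** If q fixes p(a) pointwise, then the conjugate p⁻¹qp fixes a pointwise, hence it fixes x. *)
Lemma supp_act a p x : Sym p -> supp a x ->
  supp (setof (fun y => exists c, c ∊ a /\ y = act p c)) (act p x).
Proof.
move=> hp ha q hq h.
have hip := Sym_inv hp.
suff e : act (comp (inv p) (comp q p)) x = x.
  by rewrite -{2}e !act_comp ?act_invK //; apply: Sym_comp.
apply: ha; first by do 2! apply: Sym_comp => //.
move=> c ca; rewrite !act_comp //; last exact: Sym_comp.
rewrite h ?act_inv // (setofP (small_act p a)); by exists c.
Qed.

Lemma fsupp_act p x : Sym p -> fsupp x -> fsupp (act p x).
Proof.
move=> hp [a [fa [ha sa]]].
exists (setof (fun y => exists c, c ∊ a /\ y = act p c)); split; [|split].
- by apply: Fin_img => //; def.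
- by move=> c /(setofP (small_act p a))[d [/ha da ->]]; apply: act_atm.
- exact: supp_act.
Qed.

Lemma HS_act p x : Sym p -> HS x -> HS (act p x).
Proof.
move=> hp; move: x; apply: eps_ind.
move=> x IH hx; apply: HS_intro; last by apply: fsupp_act => //; apply: HS_fsupp.
have [ax|sx] := pselect (atm x).
  by move=> y yx; case: (elt_isset yx); apply: act_atm.
move=> y /(in_act _ _ sx)[z [zx ->]]; apply: IH => //; exact: HS_elt hx zx.
Qed.

(** ** The model of hereditarily symmetric sets *)

(** The set-theoretic reading of [isAct], kept in its shape so that [sat_isAct] is a matter of
    unfolding; [act_relP] compares it with the recursion. [lvl_rel] and [mos_rel] play the same part
    for the levels and for F. *)
Definition act_rel p x y := exists t f, t = tcs x /\ Fun f t
  /\ (forall z, z ∊ t -> forall v, pr z v ∊ f ->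
       (atm z -> pr z v ∊ p)
       /\ (isset z -> isset v /\ forall e, e ∊ v <-> exists z', z' ∊ z /\ pr z' e ∊ f))
  /\ pr x y ∊ f.

Lemma act_relP p x y : Sym p -> act_rel p x y <-> y = act p x.
Proof.
move=> hp; split=> [[t [f [-> [[f1 [f2 [f3 f4]]] [hf xy]]]]]|->].
  suff h : forall z, z ∊ tcs x -> forall v, pr z v ∊ f -> v = act p z.
    by apply: h xy; apply: tcs_refl.
  apply: eps_ind.
  move=> z IH zx v zv; have [h1 h2] := hf z zx v zv.
  have [az|sz] := pselect (atm z); first by apply/esym/act_atomP => //; apply: h1.
  have [sv h] := h2 sz; apply: set_eq => //; first exact: isset_act.
  move=> w; rewrite h in_act //; split=> -[u [uz]].
    by move=> /(IH u uz (tcs_trans zx uz)) ->; exists u.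
  move=> ->; exists u; split=> //.
  pose proof (tcs_trans zx uz) as ux; have [v' hv'] := f3 u ux.
  by rewrite -(IH u uz ux _ hv').
have dF : DefF1 (act p) by def.
pose proof (fun z v => in_graph (tcs x) z v dF) as inf.
exists (tcs x), (graph (act p) (tcs x)); split=> //; split; first exact: Fun_graph.
split; last by apply/inf; split=> //; apply: tcs_refl.
move=> z hz v /inf[_ ->]; split; first exact: act_atom.
move=> sz; split; first exact: isset_act.
move=> e; rewrite in_act //; split=> -[u [uz h]]; exists u; split=> //.
  by apply/inf; split=> //; apply: tcs_trans uz.
by have [] := (inf u e).1 h.
Qed.

Lemma sat_isAct ρ i j k : Sym (ρ i) ->
  sat ρ (isAct i j k) <-> ρ k = act (ρ i) (ρ j).
Proof.
move=> hp; rewrite -act_relP //; rewrite /isAct /act_rel; sats.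
apply: iff_ex => t; apply: iff_ex => f; sat_iff.
Qed.

Lemma small_Sym : small Sym.
Proof.
pose proof (small_prod (small_elt atoms) (small_elt atoms)) as h.
apply: (@small_le _ _ _ (pow (setof _))) => p hp; rewrite in_pow.
have [[[h1 [h2 _]] h5] _] := hp; split=> // z zp; apply/(setofP h).
have [x [hx [y e]]] := h2 z zp; subst z.
by exists x; split=> //; exists y; split=> //; apply: h5 zp.
Qed.

Definition SymA := setof Sym.

Lemma in_SymA p : p ∊ SymA <-> Sym p.
Proof. by rewrite (setofP small_Sym). Qed.

Lemma sat_isSymAtoms ρ i : sat ρ (isSymAtoms i) <-> ρ i = SymA.
Proof.
rewrite /isSymAtoms; sats; split=> [[a [/sat_isAtoms]]|e].
  sats=> -> [h1 h2]; apply: set_eq => //; first exact/isset_setof/small_Sym.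
  move=> p; rewrite in_SymA; apply: (iff_trans (B := sat (scons p (scons atoms ρ)) (isBij 0 1 1))).
    exact: h2.
  exact: sat_isBij.
exists atoms; rewrite sat_isAtoms; split=> //; rewrite e.
split; first exact/isset_setof/small_Sym.
by move=> p; split=> [/in_SymA h|/sat_isBij h]; [apply/sat_isBij|apply/in_SymA].
Qed.

Definition stab x := setof (fun p => Sym p /\ act p x = x).

Lemma small_stab x : small (fun p => Sym p /\ act p x = x).
Proof.
apply: (@small_le _ _ _ SymA) => p [].
by rewrite in_SymA.
Qed.

Lemma in_stab x p : p ∊ stab x <-> Sym p /\ act p x = x.
Proof. by rewrite (setofP (small_stab x)). Qed.

Lemma isset_stab x : isset (stab x).
Proof. exact/isset_setof/small_stab. Qed.

Lemma sat_isStab ρ i j k : ρ j = SymA ->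
  sat ρ (isStab i j k) <-> ρ i = stab (ρ k).
Proof.
move=> e; rewrite /isStab; sats; split=> [[h1 h2]|->].
  apply: set_eq => //; first exact: isset_stab.
  move=> p; rewrite in_stab; split=> [/h2[]|[hp ep]].
    by rewrite e in_SymA => hp; rewrite sat_isAct.
  by apply/h2; rewrite e in_SymA sat_isAct.
split; first exact: isset_stab.
move=> p; rewrite in_stab e in_SymA; split=> -[hp].
  by move=> ep; split=> //; rewrite sat_isAct.
by rewrite sat_isAct.
Qed.

Lemma sat_isComp ρ i j k : sat ρ (isComp i j k) <-> ρ i = comp (ρ j) (ρ k).
Proof.
have h z : (exists x y w, z = pr x w /\ pr x y ∊ ρ k /\ pr y w ∊ ρ j) <->
    sat (scons z ρ) (∃ ∃ ∃ (isOPair 3 2 0 ∧ pairIn k.+4 2 1 ∧ pairIn j.+4 1 0)).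
  sats; apply: iff_ex => x; apply: iff_ex => y; apply: iff_ex => w.
  by rewrite sat_isOPair !sat_pairIn.
split=> [[h1 h2]|e].
  by apply/esym/setof_eq => // z; rewrite h; apply: h2.
split; first by change (isset (ρ i)); rewrite e; apply: isset_comp.
move=> z; change ((z ∊ ρ i) <-> sat (scons z ρ) (∃ ∃ ∃ (isOPair 3 2 0 ∧ pairIn k.+4 2 1 ∧ pairIn j.+4 1 0))).
by rewrite e -h (setofP (small_comp (ρ j) (ρ k))).
Qed.

Lemma sat_isInv ρ i j : sat ρ (isInv i j) <-> ρ i = inv (ρ j).
Proof.
have h z : (exists y x, z = pr y x /\ pr x y ∊ ρ j) <->
    sat (scons z ρ) (∃ ∃ (isOPair 2 0 1 ∧ pairIn j.+3 1 0)).
  sats; split=> [[y [x [h1 h2]]]|[x [y [h1 h2]]]].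
    by exists x, y; rewrite sat_isOPair sat_pairIn.
  by exists y, x; move: h1 h2; rewrite sat_isOPair sat_pairIn.
split=> [[h1 h2]|e].
  by apply/esym/setof_eq => // z; rewrite h; apply: h2.
split; first by change (isset (ρ i)); rewrite e; apply: isset_inv.
move=> z; change ((z ∊ ρ i) <-> sat (scons z ρ) (∃ ∃ (isOPair 2 0 1 ∧ pairIn j.+3 1 0))).
by rewrite e -h (setofP (small_inv (ρ j))).
Qed.

Definition subgroup h g := isset h /\ (forall p, p ∊ h -> p ∊ g) /\ (exists p, p ∊ h)
  /\ (forall p, p ∊ h -> forall q, q ∊ h -> forall c, c = comp p q -> c ∊ h)
  /\ (forall p, p ∊ h -> forall q, q = inv p -> q ∊ h).

Lemma sat_isSubgroup ρ i j : sat ρ (isSubgroup i j) <-> subgroup (ρ i) (ρ j).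
Proof.
rewrite /isSubgroup /subgroup; sats.
do 3! (apply: iff_and => //); apply: iff_and.
  apply: iff_all => p; apply: iff_imp => //; apply: iff_all => q; apply: iff_imp => //.
  by apply: iff_all => c; apply: iff_imp => //; apply: sat_isComp.
apply: iff_all => p; apply: iff_imp => //; apply: iff_all => q.
by apply: iff_imp => //; apply: sat_isInv.
Qed.

Lemma subgroup_stab x : subgroup (stab x) SymA.
Proof.
split; first exact: isset_stab; split; [|split; [|split]].
- by move=> p /in_stab[hp _]; apply/in_SymA.
- have dF : DefF1 (fun x : S => x) by def.
  (* The identity permutation shows that the stabiliser is inhabited. *)
  pose e := graph (fun x => x) atoms; pose proof (fun u v => in_graph atoms u v dF) as ine.
  have he : Sym e.
    split; [split; [exact: Fun_graph|]|split].
    + by move=> u v /ine[hu ->].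
    + by move=> u v w /ine[_ ->] /ine[_ ->].
    + by move=> u hu; exists u; split=> //; apply/ine.
  exists e; apply/in_stab; split=> //.
  move: x; apply: eps_ind.
  move=> x IH; have [ax|sx] := pselect (atm x).
    by apply/act_atomP => //; apply/ine; split=> //; apply/in_atoms.
  apply: set_eq => //; first exact: isset_act.
  move=> w; rewrite in_act //; split=> [[z [zx ->]]|wx]; first by rewrite IH.
  by exists w; rewrite IH.
- move=> p /in_stab[hp ep] q /in_stab[hq eq] c ->; apply/in_stab.
  by rewrite act_comp // eq ep; split=> //; apply: Sym_comp.
- move=> p /in_stab[hp ep] q ->; apply/in_stab; split; first exact: Sym_inv.
  by rewrite -{1}ep act_inv.
Qed.

Lemma Fin_omega_elt n : n ∊ omega -> Fin n.
Proof.
move: n; apply: omega_ind; first exact: Fin0.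
move=> n _ h; rewrite (_ : succ n = cup n (sing n)); first exact: Fin_add.
apply: set_eq; [exact: isset_succ|exact: isset_cup|].
by move=> z; rewrite in_succ in_cup in_sing.
Qed.

Lemma omega_elt n k : n ∊ omega -> k ∊ n -> k ∊ omega.
Proof.
move=> hn; move: n hn k; apply: omega_ind.
  by move=> k /in_empty.
by move=> n hn IH k; rewrite in_succ => -[/IH|->].
Qed.

(** A finite set of atoms is enumerated by a tuple, and a tuple has a finite range. Natural numbers
    are fixed by every permutation, so fixing a tuple amounts to fixing its entries. *)
Lemma fsupp_tuple x :
  fsupp x <-> exists s, Tuple s atoms /\ forall p, p ∊ stab s -> p ∊ stab x.
Proof.
split=> [[a [fa [ha sa]]]|[s [[n [hn [[h1 [h2 [h3 h4]]] h5]]] h]]].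
  case: (Fin_finset fa) => n [hn [s [[hs hs'] [s1 s2]]]].
  exists s; split.
    by exists n; split=> //; split=> // u v /hs' /ha ?; apply/in_atoms.
  move=> p /in_stab[hp es]; apply/in_stab; split=> //; apply: sa => // c ca.
  have [k [kn kc]] := s2 c ca.
  have : act p (pr k c) ∊ act p s by apply: act_elt.
  rewrite es act_pr act_omega; last exact: omega_elt hn kn.
  by move=> h; have [_ [_ [_ h4]]] := hs; apply: h4 h kc.
pose rng := setof (fun y => exists k, k ∊ n /\ y = the (fun y => pr k y ∊ s)).
have srng : small (fun y => exists k, k ∊ n /\ y = the (fun y => pr k y ∊ s)).
  by apply: small_img (small_elt n) _; def.
have inr k y : pr k y ∊ s -> y ∊ rng.
  move=> ky; apply/(setofP srng).
  have [k' [k'n [y' /pr_inj[ek _]]]] := h2 _ ky; subst k'.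
  by exists k; split=> //; apply/esym/the_eq => // y''; move/h4; apply.
exists rng; split; first by apply: Fin_img (Fin_omega_elt hn); def.
have rngP y : y ∊ rng -> exists k, k ∊ n /\ pr k y ∊ s.
  move=> /(setofP srng)[k [kn ->]]; exists k; split=> //.
  have [z hz] := h3 k kn; rewrite (the_eq (P := fun y => pr k y ∊ s) hz) // => y''; move/h4; exact.
split=> [y /rngP[k [_ /h5/in_atoms]] //|p hp hfix].
suff /h/in_stab[] : p ∊ stab s by [].
apply/in_stab; split=> //.
have e k y : pr k y ∊ s -> act p (pr k y) = pr k y.
  move=> ky; have [k' [k'n [y' /pr_inj[ek _]]]] := h2 _ ky; subst k'.
  rewrite act_pr (hfix y); last exact: inr ky.
  by rewrite act_omega //; apply: omega_elt hn k'n.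
apply: set_eq => //; first exact: isset_act.
move=> z; rewrite in_act //; split=> [[t [ts ->]]|zs].
  by have [k [_ [y et]]] := h2 t ts; subst t; rewrite e.
by exists z; split=> //; have [k [_ [y et]]] := h2 z zs; subst z; rewrite e.
Qed.

Definition in_Ffin h := subgroup h SymA
  /\ exists s, Tuple s atoms /\ forall p, p ∊ stab s -> p ∊ h.

Lemma small_Ffin : small in_Ffin.
Proof.
pose proof (small_sep (P := in_Ffin) (pow SymA)) as h.
suff hd : DefP1 in_Ffin.
  apply: eq_small (h hd) => g; rewrite in_pow; split=> [[]//|hg]; split=> //.
  by have [[? [? _]] _] := hg.
have hs : DefP1 (fun s => Tuple s atoms) by unfold Tuple; def.
have hst : DefF1 stab by unfold stab; def.
have hc : DefF2 comp by unfold comp; def.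
have hsg : DefP2 subgroup by unfold subgroup; def.
by unfold in_Ffin; apply: Def_and; [def|apply: Def_ex; apply: Def_and; [exact: (Def_app1 (h := hs) (DefT_var 0))|def]].
Qed.

Definition Ffin := setof in_Ffin.

Lemma sat_isFfin ρ i j : ρ j = SymA ->
  sat ρ (isFfin i j) <-> ρ i = Ffin.
Proof.
move=> eg.
have h h0 : in_Ffin h0 <-> sat (scons h0 ρ) (isSubgroup 0 j.+1
    ∧ ∃ ∃ ∃ (isAtoms 0 ∧ isTuple 2 0 ∧ isStab 1 j.+4 2 ∧ isSubset 1 3)).
  sats; rewrite sat_isSubgroup; sats; rewrite eg; apply: iff_and => //.
  apply: iff_ex => s; split=> [[h1 h2]|[st [a []]]].
    by exists (stab s), atoms; rewrite sat_isAtoms sat_isTuple sat_isStab.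
  by rewrite sat_isAtoms sat_isTuple sat_isStab //; sats => -> [h1 [-> h2]].
split=> [[h1 h2]|e].
  by apply/esym/setof_eq => // z; rewrite h; apply: h2.
split; first by change (isset (ρ i)); rewrite e; apply/isset_setof/small_Ffin.
move=> z; change (z ∊ ρ i <-> sat (scons z ρ) (isSubgroup 0 j.+1
    ∧ ∃ ∃ ∃ (isAtoms 0 ∧ isTuple 2 0 ∧ isStab 1 j.+4 2 ∧ isSubset 1 3))).
by rewrite e -h (setofP small_Ffin).
Qed.

Lemma sat_inPM ρ i j k : ρ i = SymA -> ρ j = Ffin ->
  sat ρ (inPM i j k) <-> HS (ρ k).
Proof.
move=> eg eF; rewrite /inPM; sats.
(* Stabilisers are subgroups, so membership in the filter reduces to the condition on supports. *)
have e y : in_Ffin (stab y) <-> fsupp y.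
  rewrite fsupp_tuple; split=> [[]//|h]; split=> //; exact: subgroup_stab.
split=> [[t [/sat_isTCsing]]|h].
  sats=> -> h y /h[st []]; rewrite sat_isStab //; sats => ->.
  by rewrite eF (setofP small_Ffin) => /e.
exists (tcs (ρ k)); rewrite sat_isTCsing; split=> // y /h hy.
exists (stab y); rewrite sat_isStab //; split=> //; sats.
by rewrite eF (setofP small_Ffin) e.
Qed.

Lemma sat_PM_Sym ρ i : sat ρ (carrier PM_Sym i) <-> HS (ρ i).
Proof.
rewrite /PM_Sym; cbn [carrier]; sats; split=> [[g [F [hg [hF hx]]]]|h].
  pose σ := scons F (scons g ρ).
  have eg : σ 1 = SymA by apply/sat_isSymAtoms.
  have eF : σ 0 = Ffin by apply/(sat_isFfin 0 eg).
  exact: (sat_inPM i.+2 eg eF).1 hx.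
exists SymA, Ffin; pose σ := scons Ffin (scons SymA ρ).
have eg : σ 1 = SymA by []; have eF : σ 0 = Ffin by [].
split; first exact: (sat_isSymAtoms σ 1).2.
by split; [exact: (sat_isFfin 0 eg).2|exact: (sat_inPM i.+2 eg eF).2].
Qed.

End Symmetric.

(** * The class 𝒱⋆(X) *)

Section VstarClass.
Context {S : structure} {zf : ZF S}.
Implicit Types (ρ : nat -> S) (x y z a b f n v w t α β γ : S).

Definition tag0 z := pr z sempty.
Definition tag1 z := pr z (sing sempty).
#[global] Instance DefF1_tag0 : DefF1 tag0. Proof. by def. Qed.
#[global] Instance DefF1_tag1 : DefF1 tag1. Proof. by def. Qed.

Lemma tag0_inj z z' : tag0 z = tag0 z' -> z = z'.
Proof. by move/pr_inj => []. Qed.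

Lemma tag1_inj z z' : tag1 z = tag1 z' -> z = z'.
Proof. by move/pr_inj => []. Qed.

Lemma tag01 z z' : tag0 z <> tag1 z'.
Proof. by move/pr_inj => [_ e]; apply: (@in_empty _ _ sempty); rewrite {2}e in_sing. Qed.

(** * Ordinals *)

Lemma Ord_elt α β : Ord α -> β ∊ α -> Ord β.
Proof.
move=> [_ [h1 h2]] hb; have [sb tb] := h2 β hb; split=> //; split=> // y yb.
by apply: h2; apply: h1 hb y yb.
Qed.

Lemma Ord_trans α β γ : Ord α -> β ∊ α -> γ ∊ β -> γ ∊ α.
Proof. by move=> [_ [h _]] hb; apply: h. Qed.

Lemma Ord_succ α : Ord α -> Ord (succ α).
Proof.
move=> [sa [ta ha]]; split; first exact: isset_succ.
split=> [y|y]; rewrite in_succ => -[ya|->] //; last exact: ha.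
  by move=> z zy; rewrite in_succ; left; apply: ta ya z zy.
by move=> z za; rewrite in_succ; left.
Qed.

Lemma Ord_empty : Ord (sempty : S).
Proof. by split; [exact: isset_empty|split=> y /in_empty]. Qed.

(** Two nested ∊-inductions: when neither ordinal is an element of the other, the hypotheses place
    each element of one in the other. *)
Lemma Ord_lin α β : Ord α -> Ord β -> α ∊ β \/ α = β \/ β ∊ α.
Proof.
move: α β; apply: eps_ind.
move=> α IHa β oa; move: β; apply: eps_ind.
move=> β IHb ob.
have [h|nab] := pselect (α ∊ β); first by left.
have [h|nba] := pselect (β ∊ α); first by right; right.
right; left; apply: set_eq; [exact: oa.1|exact: ob.1|move=> z; split=> hz].
  have [//|[e|h]] := IHa z hz β (Ord_elt oa hz) ob; first by subst z.
  by case: nba; apply: Ord_trans hz h.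
have [h|[e|//]] := IHb z hz (Ord_elt ob hz); last by subst z.
by case: nab; apply: Ord_trans hz h.
Qed.

Lemma Ord_omega n : n ∊ omega -> Ord n.
Proof.
move: n; apply: omega_ind; first exact: Ord_empty.
by move=> n _; apply: Ord_succ.
Qed.

(** Every finite set of natural numbers is included in some natural number n; for ω this would give
    n ∊ n. *)
Lemma Fin_omega : ~ Fin (omega : S).
Proof.
move=> f; suff h : forall a, Fin a -> (forall z, z ∊ a -> z ∊ omega) ->
    exists n, n ∊ omega /\ forall z, z ∊ a -> z ∊ n.
  by have [|n [hn h']] := h _ f; [|apply: (@no_cycle1 _ _ n); apply: h'].
apply: Fin_ind.
  by move=> _; exists sempty; split; [apply: omega0|move=> z /in_empty].
move=> a x _ IH ao; have xo : x ∊ omega by apply: ao; rewrite in_cup in_sing; right.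
have [|n [hn h]] := IH; first by move=> z za; apply: ao; rewrite in_cup; left.
have ox := Ord_omega xo.
have [xn|nx] := pselect (x ∊ n).
  by exists n; split=> // z; rewrite in_cup in_sing => -[/h|->].
exists (succ x); split=> [|z]; first exact: omegaS.
rewrite in_cup in_sing in_succ => -[/h zn|->]; last by right.
have [h'|[e|//]] := Ord_lin (Ord_omega hn) ox; left; last by rewrite -e.
exact: Ord_trans ox h' zn.
Qed.

Lemma Limit_succ γ β : Limit γ -> β ∊ γ -> succ β ∊ γ.
Proof.
move=> [og [_ hg]] hb; have [//|[e|]] := Ord_lin (Ord_succ (Ord_elt og hb)) og.
  by case: hg; exists β.
by rewrite in_succ => -[h|e]; [case: (no_cycle2 h hb)|subst β; case: (no_cycle1 hb)].
Qed.

(** * Ranks *)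

Definition rank_step (c x r : S) := setof (fun w => exists v, v ∊ r /\ w ∊ succ v).
#[local] Instance DefF3_rank_step : DefF3 rank_step.
Proof. by def. Qed.

Definition rank x := rec rank_step sempty x.
#[global] Instance DefF1_rank : DefF1 rank. Proof. by def. Qed.

Lemma small_rank_step r : small (fun w => exists v, v ∊ r /\ w ∊ succ v).
Proof. by apply: small_bigU (small_elt r) _ _ => x _; apply: small_elt. Qed.

Lemma in_rank x w : w ∊ rank x <-> exists y, y ∊ x /\ w ∊ succ (rank y).
Proof.
rewrite {1}/rank recE /rank_step (setofP (small_rank_step _)).
split=> [[v [/(setofP (small_rec _ x))[y [yx ->]] h]]|[y [yx h]]]; first by exists y.
by exists (rank y); split=> //; apply/(setofP (small_rec _ x)); exists y.
Qed.

Lemma isset_rank x : isset (rank x).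
Proof. by rewrite /rank recE; apply/isset_setof/small_rank_step. Qed.

Lemma Ord_rank x : Ord (rank x).
Proof.
move: x; apply: eps_ind.
move=> x IH; split; first exact: isset_rank.
split=> w /in_rank[y [yx]] hw.
  move=> z zw; apply/in_rank; exists y; split=> //.
  by apply: Ord_trans hw zw; apply/Ord_succ/IH.
by have [? []] := Ord_elt (Ord_succ (IH y yx)) hw.
Qed.

Lemma rank_elt x y : y ∊ x -> rank y ∊ rank x.
Proof. by move=> yx; apply/in_rank; exists y; rewrite in_succ; auto. Qed.

(** Three steps of membership lead up: t ∊ z ∊ {z} ∊ ⟨z, 0⟩. *)
Lemma rank_tag0 z t : t ∊ z -> rank t ∊ rank (tag0 z).
Proof.
move=> tz; have o := Ord_rank.
have h : sing z ∊ tag0 z by rewrite in_upair; left.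
have h' : z ∊ sing z by rewrite in_sing.
apply: Ord_trans (rank_elt h) _ => //; apply: Ord_trans (rank_elt h') _ => //.
exact: rank_elt.
Qed.

(** * The levels of 𝒱⋆(X) *)

Section Levels.
Variable X : S.

(** A single formula for all levels: r collects the lower levels v, each of which contributes 𝒫(v) ×
    {0} and v. The clauses at 0, at successors and at limits are derived from it. *)
Definition lvl_step (c x r : S) := setof (fun w => (exists a, a ∊ c /\ w = tag1 a) \/
  exists v, v ∊ r /\ ((exists z, z ∊ pow v /\ w = tag0 z) \/ w ∊ v)).
#[local] Instance DefF3_lvl_step : DefF3 lvl_step.
Proof. by def. Qed.

Definition lvl α := rec lvl_step X α.
#[global] Instance DefF1_lvl : DefF1 lvl. Proof. by def. Qed.

Lemma small_lvl_step c r : small (fun w => (exists a, a ∊ c /\ w = tag1 a) \/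
  exists v, v ∊ r /\ ((exists z, z ∊ pow v /\ w = tag0 z) \/ w ∊ v)).
Proof.
apply: small_or; first by apply: small_img (small_elt c) _; def.
apply: small_bigU (small_elt r) _ _ => v _.
by apply: small_or (small_elt v); apply: small_img (small_elt _) _; def.
Qed.

Definition tagged z v w := isset z /\ (forall t, t ∊ z -> t ∊ v) /\ w = tag0 z.

Lemma in_lvl α w : w ∊ lvl α <-> (exists a, a ∊ X /\ w = tag1 a) \/
  exists β, β ∊ α /\ ((exists z, tagged z (lvl β) w) \/ w ∊ lvl β).
Proof.
rewrite {1}/lvl recE /lvl_step (setofP (small_lvl_step _ _)).
apply: iff_or => //; split=> [[v [/(setofP (small_rec _ α))[y [yx ->]] h]]|[y [yx h]]].
  exists y; split=> //; case: h => [[z [/in_pow[h1 h2] ->]]|?]; last by right.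
  by left; exists z.
exists (lvl y); split; first by apply/(setofP (small_rec _ α)); exists y.
by case: h => [[z [h1 [h2 ->]]]|?]; [left; exists z; rewrite in_pow|right].
Qed.

Lemma isset_lvl α : isset (lvl α).
Proof. by rewrite /lvl recE; apply/isset_setof/small_lvl_step. Qed.

Lemma lvl_empty w : w ∊ lvl sempty <-> exists a, a ∊ X /\ w = tag1 a.
Proof. by rewrite in_lvl; split=> [[//|[β [/in_empty []]]]|h]; left. Qed.

Lemma lvl_succ_sub α β w : trans α -> β ∊ α -> w ∊ lvl (succ β) -> w ∊ lvl α.
Proof.
rewrite !in_lvl => ta hb [h|[γ [hg h]]]; [by left|right].
by exists γ; split=> //; move: hg; rewrite in_succ => -[hg|->] //; apply: ta hb γ hg.
Qed.

Lemma lvl_succ β w : Ord β ->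
  w ∊ lvl (succ β) <-> (exists z, tagged z (lvl β) w) \/ w ∊ lvl β.
Proof.
move=> ob; rewrite in_lvl; split=> [[h|[γ [hg h]]]|h].
- by right; rewrite in_lvl; left.
- move: hg; rewrite in_succ => -[hg|e]; last by subst γ.
  by right; rewrite in_lvl; right; exists γ.
- by right; exists β; rewrite in_succ; auto.
Qed.

Lemma lvl_limit γ w : Limit γ -> w ∊ lvl γ <-> exists β, β ∊ γ /\ w ∊ lvl β.
Proof.
move=> lg; have [og [ng _]] := lg; rewrite in_lvl; split=> [[h|[β [hb h]]]|[β [hb h]]].
- have [[β hb]|n] := pselect (exists β, β ∊ γ).
    by exists β; split=> //; rewrite in_lvl; left.
  by case: ng; apply: empty_eq; [exact: og.1|move=> z hz; apply: n; exists z].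
- exists (succ β); split; first exact: Limit_succ.
  by apply/lvl_succ => //; apply: Ord_elt hb.
- by right; exists β; auto.
Qed.

Definition Vcl w := exists α, Ord α /\ w ∊ lvl α.
#[global] Instance DefP1_V : DefP1 Vcl. Proof. by def. Qed.

Lemma V_cases w : Vcl w -> (exists a, a ∊ X /\ w = tag1 a) \/
  exists z, isset z /\ (forall t, t ∊ z -> Vcl t) /\ w = tag0 z.
Proof.
move=> [α [oa]]; move: α oa w; apply: eps_ind.
move=> α IH oa w /in_lvl[h|[β [hb [[z [h1 [h2 h3]]]|h]]]]; first by left.
  right; exists z; split=> //; split=> // t /h2 ht.
  by exists β; split=> //; apply: Ord_elt hb.
exact: IH hb (Ord_elt oa hb) _ h.
Qed.

(** Plain ∊-induction does not reach far enough for 𝒱⋆(X), as the elements of z lie three ∊-steps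
    below ⟨z, 0⟩. *)
Lemma tcs_ind P : DefP1 P ->
  (forall x, (forall z, z ∊ x -> forall y, y ∊ tcs z -> P y) -> P x) -> forall x, P x.
Proof.
move=> hP h x; suff k : forall x z, z ∊ tcs x -> P z by apply: (k x); apply: tcs_refl.
apply: eps_ind.
by move=> {}x IH z /tcsE[->|[y [yx]]]; [apply: h|apply: IH].
Qed.

Lemma V_ind P : DefP1 P -> (forall a, a ∊ X -> P (tag1 a)) ->
  (forall z, isset z -> (forall t, t ∊ z -> Vcl t /\ P t) -> P (tag0 z)) ->
  forall w, Vcl w -> P w.
Proof.
move=> hP h1 h0; apply: tcs_ind.
move=> w IH /V_cases[[a [ha ->]]|[z [sz [hz e]]]]; first exact: h1.
subst w; apply: h0 => // t tz; split; first exact: hz.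
apply: (IH (sing z)); [by rewrite in_upair; left| |exact: hz].
by apply: tcs_trans tz; apply: tcs_trans (tcs_refl _) _; rewrite in_sing.
Qed.

(** An explicit level for each element. The ranks of the elements of z lie below that of ⟨z, 0⟩,
    which puts all of them in one level and yields [V_tag0]. *)
Lemma V_rank w : Vcl w -> w ∊ lvl (succ (rank w)).
Proof.
move: w; apply: V_ind.
  by move=> a ha; rewrite in_lvl; left; exists a.
move=> z sz hz; apply/lvl_succ; first exact: Ord_rank.
left; exists z; split=> //; split=> // t tz; have [_ h] := hz t tz.
have [_ [tr _]] := Ord_rank (tag0 z).
exact: lvl_succ_sub tr (rank_tag0 tz) h.
Qed.

Lemma V_tag0 z : isset z -> (forall t, t ∊ z -> Vcl t) -> Vcl (tag0 z).
Proof.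
move=> sz hz; exists (succ (rank (tag0 z))); split; first exact/Ord_succ/Ord_rank.
apply/lvl_succ; first exact: Ord_rank.
left; exists z; split=> //; split=> // t tz.
have [_ [tr _]] := Ord_rank (tag0 z).
exact: lvl_succ_sub tr (rank_tag0 tz) (V_rank (hz t tz)).
Qed.

Lemma V_tag1 a : a ∊ X -> Vcl (tag1 a).
Proof.
move=> ha; exists sempty; split; first exact: Ord_empty.
by apply/lvl_empty; exists a.
Qed.

Lemma V_tag0E z : Vcl (tag0 z) -> isset z /\ forall t, t ∊ z -> Vcl t.
Proof.
by move=> /V_cases[[a [_ /tag01]] //|[z' [sz [hz /tag0_inj ->]]]].
Qed.

Lemma V_tag1E a : Vcl (tag1 a) -> a ∊ X.
Proof.
by move=> /V_cases[[b [hb /tag1_inj -> //]]|[z [_ [_ /esym/tag01]]]].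
Qed.

Lemma sat_isTag0 ρ i j : sat ρ (isTag0 i j) <-> ρ i = tag0 (ρ j).
Proof.
rewrite /isTag0; sats; split=> [[e []]|h].
  by rewrite sat_isEmpty sat_isOPair; sats => ->.
by exists sempty; rewrite sat_isEmpty sat_isOPair.
Qed.

Lemma sat_isTag1 ρ i j : sat ρ (isTag1 i j) <-> ρ i = tag1 (ρ j).
Proof.
rewrite /isTag1; sats; split=> [[e [u []]]|h].
  by rewrite sat_isEmpty sat_isUPair sat_isOPair; sats => -> [-> ->].
by exists sempty, (sing sempty); rewrite sat_isEmpty sat_isUPair sat_isOPair.
Qed.

Definition lvl_rel α v := exists f d, d = succ α /\ Fun f d
  /\ (forall γ, γ ∊ d -> forall u, pr γ u ∊ f ->
       (γ = sempty -> isset u /\ forall w, w ∊ u <-> exists a, a ∊ X /\ w = tag1 a)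
       /\ (forall β t, γ = succ β -> pr β t ∊ f ->
             isset u /\ forall w, w ∊ u <-> (exists z, tagged z t w) \/ w ∊ t)
       /\ (Limit γ -> isset u /\ forall w, w ∊ u <-> exists β, β ∊ γ /\ exists t, pr β t ∊ f /\ w ∊ t))
  /\ pr α v ∊ f.

Lemma lvl_relP α v : Ord α -> lvl_rel α v <-> v = lvl α.
Proof.
move=> oa; have osa := Ord_succ oa.
split=> [[f [d [-> [[f1 [f2 [f3 f4]]] [hf av]]]]]|->].
  suff h : forall γ, γ ∊ succ α -> forall u, pr γ u ∊ f -> u = lvl γ.
    by apply: h av; rewrite in_succ; right.
  apply: eps_ind.
  move=> γ IH hg u gu; have [h1 [h2 h3]] := hf γ hg u gu.
  have og : Ord γ := Ord_elt osa hg.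
  have [e0|n0] := pselect (γ = sempty).
    have [su hu] := h1 e0; apply: set_eq => //; first exact: isset_lvl.
    by move=> w; rewrite hu e0 lvl_empty.
  have [[β e]|ns] := pselect (exists β, γ = succ β).
    have hb : β ∊ γ by rewrite e in_succ; right.
    have hb' : β ∊ succ α := Ord_trans osa hg hb.
    have [t ht] := f3 β hb'; have [su hu] := h2 β t e ht.
    apply: set_eq => //; first exact: isset_lvl.
    move=> w; rewrite hu e lvl_succ; last exact: Ord_elt hb.
    by rewrite (IH β hb hb' t ht).
  have lg : Limit γ by [].
  have [su hu] := h3 lg; apply: set_eq => //; first exact: isset_lvl.
  move=> w; rewrite hu lvl_limit //; split=> -[β [hb h]]; exists β; split=> //.
    by have [t [ht hw]] := h; rewrite -(IH β hb (Ord_trans osa hg hb) t ht).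
  have hb' : β ∊ succ α := Ord_trans osa hg hb.
  by have [t ht] := f3 β hb'; exists t; split=> //; rewrite (IH β hb hb' t ht).
have dF : DefF1 lvl by def.
pose proof (fun z u => in_graph (succ α) z u dF) as inf.
exists (graph lvl (succ α)), (succ α); split=> //; split; first exact: Fun_graph.
split; last by apply/inf; rewrite in_succ; auto.
move=> γ hg u /inf[_ ->]; split=> [->|]; first by split; [exact: isset_lvl|exact: lvl_empty].
split=> [β t e /inf[hb ->]|lg].
  by split=> [|w]; [exact: isset_lvl|rewrite e lvl_succ //; apply: Ord_elt hb].
split=> [|w]; first exact: isset_lvl.
rewrite lvl_limit //; split=> -[β [hb h]]; exists β; split=> //.
  by exists (lvl β); split=> //; apply/inf; split=> //; apply: Ord_trans hg hb.
by have [t [/inf[_ ->]]] := h.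
Qed.

Lemma sat_isVlevel ρ i j k : ρ i = X -> Ord (ρ j) ->
  sat ρ (isVlevel i j k) <-> ρ k = lvl (ρ j).
Proof.
move=> ex oj; rewrite -lvl_relP // /isVlevel /lvl_rel; sats.
apply: iff_ex => f; apply: iff_ex => d; do 2! (apply: iff_and; first by sat_iff).
apply: iff_and; last by sat_iff.
apply: iff_all => γ; apply: iff_imp => //; apply: iff_all => u.
apply: iff_imp; first by sat_iff.
apply: iff_and.
  apply: iff_imp; first by sat_iff.
  rewrite /isVzero; sats; apply: iff_and => //; apply: iff_all => w.
  rewrite ex; apply: iff_and; apply: iff_imp => //;
  by apply: iff_ex => a; apply: iff_and => //; apply: sat_isTag1.
apply: iff_and.
  apply: iff_all => β; apply: iff_all => t; apply: iff_imp; first by sat_iff.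
  apply: iff_imp; first by sat_iff.
  rewrite /isVsucc; sats; apply: iff_and => //; apply: iff_all => w.
  by apply: iff_and; apply: iff_imp => //; apply: iff_or => //; apply: iff_ex => z;
    apply: iff_and => //; apply: iff_and => //; apply: sat_isTag0.
apply: iff_imp; first by sat_iff.
by sat_iff.
Qed.

Lemma sat_inVstar ρ i j : ρ i = X -> sat ρ (inVstar i j) <-> Vcl (ρ j).
Proof.
move=> e; rewrite /inVstar; sats; split=> [[α [v [/sat_isOrd oa [hv yv]]]]|[α [oa h]]].
  exists α; split=> //; move: hv; rewrite sat_isVlevel //; sats => ev.
  by rewrite -ev.
exists α, (lvl α); split; first exact/sat_isOrd.
by split=> //; apply/sat_isVlevel.
Qed.

Lemma V_empty : Vcl (tag0 sempty).
Proof. by apply: V_tag0 isset_empty _ => t /in_empty. Qed.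

Definition Vdom := {w : S | Vcl w}.

Definition Vstr : structure :=
  @Structure Vdom (fun u t : Vdom => exists z : S, sval t = tag0 z /\ sval u ∊ z)
    (fun t : Vdom => exists z : S, sval t = tag1 z) (exist _ _ V_empty).

End Levels.
End VstarClass.

(** * Relativisation *)

(** A predicate on variables instead of a bound: in the formulas defining the permutation models,
    variables ranging over the class stand next to outer variables whose values need not lie in
    it. *)
Fixpoint fv_in (p : nat -> bool) (φ : formula) : bool :=
  match φ with
  | fIn i j | fEq i j => p i && p j
  | fAtom i => p i
  | fBot => true
  | fImp φ ψ | fAnd φ ψ | fOr φ ψ => fv_in p φ && fv_in p ψ
  | fAll φ | fEx φ => fv_in (scons true p) φ
  end.

Lemma bounded_fv n φ (p : nat -> bool) : bounded n φ -> (forall i, i < n -> p i) -> fv_in p φ.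
Proof.
elim: φ n p => //= [i j|i|i j|φ H1 ψ H2|φ H1 ψ H2|φ H1 ψ H2|φ H|φ H] n p.
1,3: by move=> /andP[hi hj] h; rewrite !h.
1: by move=> hi; apply.
1,2,3: by move=> /andP[h1 h2] h; rewrite (H1 n) // (H2 n).
all: by move=> h k; apply: (H n.+1) => // -[|i] //= /k.
Qed.

(** The carrier is described at variable 0, where the relativised quantifiers use it. Variables
    outside p are left unconstrained. *)
Lemma sat_relativize (S N : structure) (ι : N -> S) (U : interp) :
  injective ι ->
  (forall σ : nat -> S, sat σ (carrier U 0) <-> exists u, σ 0 = ι u) ->
  (forall (σ : nat -> S) i j u t, σ i = ι u -> σ j = ι t ->
     sat σ (mem_rel U i j) <-> elt u t) ->
  (forall (σ : nat -> S) i u, σ i = ι u -> sat σ (atom_rel U i) <-> atm u) ->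
  forall φ p (σ : nat -> S) (τ : nat -> N), fv_in p φ ->
    (forall i, p i -> σ i = ι (τ i)) -> sat σ (relativize U φ) <-> sat τ φ.
Proof.
move=> ιI hc hm ha; elim=> /= [i j|i|i j||φ H1 ψ H2|φ H1 ψ H2|φ H1 ψ H2|φ H|φ H] p σ τ.
- by move=> /andP[pi pj] h; apply: hm; apply: h.
- by move=> pi h; apply: ha; apply: h.
- by move=> /andP[pi pj] h; rewrite !h //; split=> [/ιI|->].
- by [].
1,2,3: by move=> /andP[h1 h2] h; rewrite (H1 p σ τ) // (H2 p σ τ).
all: move=> hf h.
all: have e u : sat (scons (ι u) σ) (relativize U φ) <-> sat (scons u τ) φ
  by apply: (H (scons true p)) => // -[|i] //= /h.
- split=> k x; first by apply/e/k/hc; exists x.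
  by move=> /hc[u /= ->]; apply/e.
split=> [[x [/hc[u /= ->]]]|[u]]; first by move/e; exists u.
by move/e => k; exists (ι u); split=> //; apply/hc; exists u.
Qed.

(** * 𝒱⋆(ω) as a model *)

Section OmegaModel.
Context {S : structure} {zf : ZF S}.
Implicit Types (ρ : nat -> S) (x y z a b f n v w : S).

Notation V := (Vcl (omega : S)).
Notation N := (@Vstr S zf omega).
Notation U := (Vstar isPureEqN).

Lemma sat_isPureEqN ρ i : sat ρ (isPureEqN i) <-> ρ i = pr omega sempty.
Proof.
rewrite /isPureEqN; sats; split=> [[o [e []]]|h].
  by rewrite sat_isOmega sat_isEmpty sat_isOPair; sats => -> [-> ->].
by exists omega, sempty; rewrite sat_isOmega sat_isEmpty sat_isOPair.
Qed.

Lemma Vsv (u : N) : V (sval u).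
Proof. by case: u. Qed.

Lemma sat_carrier_U ρ i : sat ρ (carrier U i) <-> exists u : N, ρ i = sval u.
Proof.
cbn [carrier Vstar]; sats.
have h s x r : sat (scons r (scons x (scons s ρ))) (inVstar 1 i.+3) <-> Vcl x (ρ i).
  exact: (@sat_inVstar S zf x (scons r (scons x (scons s ρ))) 1 i.+3 erefl).
split=> [[s [x [r [h1 [h2 /h hv]]]]]|[[w hw] e]].
  move: h1; rewrite sat_isPureEqN => e; move: h2; rewrite sat_isOPair.
  move: e; sats => -> /pr_inj[e _]; subst x.
  by exists (exist _ (ρ i) hv).
exists (pr omega sempty), omega, sempty; rewrite h sat_isPureEqN sat_isOPair; sats.
by rewrite e.
Qed.

Lemma sat_mem_U ρ i j (u t : N) : ρ i = sval u -> ρ j = sval t ->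
  sat ρ (mem_rel U i j) <-> u ∊ t.
Proof.
move=> eu et; cbn [mem_rel Vstar]; sats; apply: iff_ex => z.
by apply: iff_and; [rewrite sat_isTag0; sats; rewrite et|rewrite eu].
Qed.

Lemma sat_atom_U ρ i (u : N) : ρ i = sval u -> sat ρ (atom_rel U i) <-> atm u.
Proof.
move=> eu; cbn [atom_rel Vstar]; sats; apply: iff_ex => z.
by rewrite sat_isTag1; sats; rewrite eu.
Qed.

Lemma sval_inj : injective (sval : N -> S).
Proof. by move=> [x hx] [y hy] /= e; apply: eq_exist. Qed.

Lemma sat_U φ p ρ (τ : nat -> N) : fv_in p φ -> (forall i, p i -> ρ i = sval (τ i)) ->
  sat ρ (relativize U φ) <-> sat τ φ.
Proof.
apply: sat_relativize; first exact: sval_inj.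
- by move=> σ; apply: sat_carrier_U.
- by move=> σ i j u t; apply: sat_mem_U.
- by move=> σ i u; apply: sat_atom_U.
Qed.

(** The defining formula is relativised to the class, and its parameters are sent along [sval]. *)
Lemma Def_transfer (P : (nat -> N) -> Prop) : Def P ->
  exists Q : (nat -> S) -> Prop, Def Q /\ forall τ, Q (sval \o τ) <-> P τ.
Proof.
move=> [φ [c h]]; exists (fun ρ => sat (mix ρ (sval \o c)) (relativize U φ)).
split; first by exists (relativize U φ), (sval \o c).
move=> τ; rewrite -h -mix_comp.
have hφ : fv_in (fun _ => true) φ by apply: (bounded_fv (bounded_bound φ)).
exact: (@sat_U φ (fun _ => true) (sval \o mix τ c) (mix τ c) hφ (fun _ _ => erefl)).
Qed.

Lemma DefP3_transfer (R : N -> N -> N -> Prop) : DefP3 R ->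
  exists Q : S -> S -> S -> Prop, DefP3 Q /\
    forall u t k : N, Q (sval u) (sval t) (sval k) <-> R u t k.
Proof.
move=> /Def_transfer[Q [hQ h]].
pose e T (x y z : T) i := match i with 0 => x | 1 => y | _ => z end.
exists (fun x y z => Q (e S x y z)).
split; last first.
  move=> u t k; rewrite -(h (e N u t k)).
  rewrite (_ : sval \o _ = e S (sval u) (sval t) (sval k)) //.
  by apply: funext => -[|[]].
apply: Def_ext (Def_rename (e nat 0 1 2) hQ) => ρ.
rewrite (_ : (fun i => ρ (e nat 0 1 2 i)) = e S (ρ 0) (ρ 1) (ρ 2)) //.
by apply: funext => -[|[]].
Qed.

Lemma V_sval w : V w -> exists u : N, w = sval u.
Proof. by move=> h; exists (exist _ w h). Qed.

Lemma Vset z : isset z -> (forall t, t ∊ z -> V t) -> exists k : N,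
  sval k = tag0 z /\ isset k /\ forall u, u ∊ k <-> sval u ∊ z.
Proof.
move=> sz hz; exists (exist _ _ (V_tag0 sz hz)); split=> //; split=> [[a /= /tag01] //|u].
by split=> [[z' /= [/tag0_inj <-]] //|h]; exists z.
Qed.

Lemma Vsmall (P : S -> Prop) : small P -> (forall t, P t -> V t) -> exists k : N,
  isset k /\ forall u, u ∊ k <-> P (sval u).
Proof.
move=> [z [sz hz]] h; have [|k [_ [sk hk]]] := Vset sz; first by move=> t /hz/h.
by exists k; split=> // u; rewrite hk hz.
Qed.

Lemma sval_setP (k : N) : isset k <-> exists z, sval k = tag0 z /\ isset z.
Proof.
split=> [sk|[z [e _]] [a]]; last by rewrite e => /tag01.
case: (V_cases (Vsv k)) => [[a [_ e]]|[z [sz [_ e]]]].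
  by case: sk; exists a.
by exists z.
Qed.

Lemma sval_atmP (k : N) : atm k <-> exists a, sval k = tag1 a /\ a ∊ omega.
Proof.
split=> [[a e]|[a [e _]]]; exists a => //; split=> //.
by apply: (@V_tag1E S zf); rewrite -e; exact: Vsv.
Qed.

Definition ext (k : N) : S := setof (fun t => exists z, sval k = tag0 z /\ t ∊ z).

Lemma small_ext (k : N) : small (fun t => exists z, sval k = tag0 z /\ t ∊ z).
Proof.
have [[z e]|n] := pselect (exists z, sval k = tag0 z).
  apply: eq_small (small_elt z) => t; split=> [?|[z' []]]; first by exists z.
  by rewrite e => /tag0_inj ->.
apply: eq_small small_false => t; split=> // -[z [e _]].
by apply: n; exists z.
Qed.

Lemma in_ext (k : N) t : t ∊ ext k <-> exists u : N, t = sval u /\ u ∊ k.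
Proof.
rewrite (setofP (small_ext k)); split=> [[z [e tz]]|[u [-> [z [e uz]]]]]; last by exists z.
have vk := Vsv k; rewrite e in vk; have [sz hz] := V_tag0E vk.
by exists (exist _ t (hz t tz)); split=> //; exists z.
Qed.

Lemma isset_ext (k : N) : isset (ext k).
Proof. exact/isset_setof/small_ext. Qed.

Lemma sval_ext (k : N) : isset k -> sval k = tag0 (ext k).
Proof.
move=> /sval_setP[z [e sz]]; rewrite e; congr tag0.
by apply/esym/setof_eq => // t; split=> [?|[z' []]]; [exists z|rewrite e => /tag0_inj ->].
Qed.

Lemma elt_ext (u k : N) : u ∊ k <-> sval u ∊ ext k.
Proof.
by rewrite in_ext; split=> [h|[u' [/sval_inj ->]]] //; exists u.
Qed.

(** This is ∊-induction in 𝒱⋆(ω) for predicates definable in the ambient model, not only for those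
    definable in 𝒱⋆(ω) itself. *)
Lemma Vstr_ind (P : S -> Prop) : DefP1 P ->
  (forall k : N, (forall u, u ∊ k -> P (sval u)) -> P (sval k)) ->
  forall k : N, P (sval k).
Proof.
move=> hP h k; move: (Vsv k); move: (sval k); apply: V_ind.
- move=> a ha; have [u e] := V_sval (V_tag1 ha); rewrite e; apply: h => t [z].
  by rewrite -e => -[/esym/tag01].
- move=> z sz hz; have [k' [e [_ hk']]] := Vset sz (fun t ht => (hz t ht).1).
  by rewrite -e; apply: h => u /hk' /hz[].
Qed.

(** * The map F of the universe into 𝒱⋆(ω) *)

Definition mos_step (c x r : S) := tag0 r.
#[local] Instance DefF3_mos_step : DefF3 mos_step.
Proof. by def. Qed.

(** The map F from the definition of PM(𝒜⋆). It is defined at atoms too, where its value is F(∅). *)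
Definition mos x := rec mos_step sempty x.
#[global] Instance DefF1_mos : DefF1 mos. Proof. by def. Qed.

Lemma mosE x : mos x = tag0 (setof (fun w => exists z, z ∊ x /\ w = mos z)).
Proof. by rewrite /mos {1}recE. Qed.

Lemma small_mos x : small (fun w => exists z, z ∊ x /\ w = mos z).
Proof. exact: small_rec. Qed.

Lemma V_mos x : V (mos x).
Proof.
move: x; apply: eps_ind.
move=> x IH; rewrite mosE; apply: V_tag0; first exact/isset_setof/small_mos.
by move=> t /(setofP (small_mos x))[z [/IH ? ->]].
Qed.

Definition Vmos x : N := exist _ (mos x) (V_mos x).

Lemma isset_Vmos x : isset (Vmos x).
Proof. by move=> [a]; rewrite /= mosE => /tag01. Qed.

Lemma in_Vmos x (u : N) : u ∊ Vmos x <-> exists y, y ∊ x /\ u = Vmos y.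
Proof.
split=> [[z [/=]]|[y [yx ->]]].
  rewrite mosE => /tag0_inj <- /(setofP (small_mos x))[y [yx e]].
  by exists y; split=> //; apply: (@sval_inj u (Vmos y)); rewrite e.
exists (setof (fun w => exists z, z ∊ x /\ w = mos z)); rewrite /= mosE; split=> //.
by apply/(setofP (small_mos x)); exists y.
Qed.

(** * The axioms in 𝒱⋆(ω) *)

#[global] Instance ZF_Vstr : ZF N.
Proof.
split.
- move=> x y sx sy h; apply: sval_inj; rewrite (sval_ext sx) (sval_ext sy); congr tag0.
  apply: set_eq; [exact: isset_ext|exact: isset_ext|].
  by move=> t; rewrite !in_ext; split=> -[u [e]] /h; exists u.
(* If x had no ∊-minimal member, [Vstr_ind] would show that nothing belongs to x. *)
- move=> x [y yx]; apply: contrapT => n.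
  suff : ~ sval y ∊ ext x by rewrite -elt_ext.
  apply: (Vstr_ind (P := fun w => ~ w ∊ ext x)).
  move=> k hk /elt_ext kx; apply: n; exists k; split=> // z zx /hk.
  by rewrite -elt_ext.
- move=> x y; have [|k [sk hk]] := @Vsmall _ (small_pair (sval x) (sval y)).
    by move=> t [] ->; exact: Vsv.
  exists k; split=> // z; rewrite hk.
  by split=> [[/sval_inj ->|/sval_inj ->]|[->|->]]; auto.
- move=> x; have [||k [sk hk]] := @Vsmall (fun t => exists y, y ∊ ext x /\ exists z, y = tag0 z /\ t ∊ z).
  + apply: small_bigU; [exact: small_elt|].
    move=> y /in_ext[u [-> _]]; exact: small_ext.
  + move=> t [y [/in_ext[u [-> _]] h]].
    have /in_ext[u' [-> _]] : t ∊ ext u by apply/(setofP (small_ext u)).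
    exact: Vsv.
  exists k; split=> // z; rewrite hk; split=> [[y [/in_ext[u [-> ux]] zu]]|[y [yx zy]]].
    by exists u.
  by exists (sval y); split=> //; apply/in_ext; exists y.
- move=> x; have [||k [sk hk]] := @Vsmall (fun t => exists z, z ∊ pow (ext x) /\ t = tag0 z).
  + by apply: small_img (small_elt _) _; def.
  + move=> t [z [/in_pow[sz hz] ->]]; apply: V_tag0 => // w /hz/in_ext[u [-> _]].
    exact: Vsv.
  exists k; split=> // z; rewrite hk; split=> [[w [/in_pow[sw hw] e]]|[sz hz]].
    split; first by apply/sval_setP; exists w.
    by move=> t [w' []]; rewrite e => /tag0_inj <- /hw; rewrite -elt_ext.
  exists (ext z); split; last exact: sval_ext.
  apply/in_pow; split; first exact: isset_ext.
  by move=> t /in_ext[u [-> /hz]]; rewrite -elt_ext.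
(* The image F(ω) is inductive in 𝒱⋆(ω). *)
- exists (Vmos omega); split.
    exists (Vmos sempty); split; first by apply/in_Vmos; exists sempty; split=> //; apply: omega0.
    by split; [exact: isset_Vmos|move=> z /in_Vmos[y [/in_empty]]].
  move=> y /in_Vmos[n [hn ->]]; exists (Vmos (succ n)); split.
    by apply/in_Vmos; exists (succ n); split=> //; apply: omegaS.
  split; first exact: isset_Vmos.
  move=> z; rewrite !in_Vmos; split=> [[m [/in_succ[h|->] ->]]|[[m [h ->]]|->]].
  + by left; exists m.
  + by right.
  + by exists m; rewrite in_succ; auto.
  + by exists n; rewrite in_succ; auto.
(* R is given a dummy third argument to fit [DefP3_transfer]. The guards V keep the transferred
   relation Q, of which nothing is known elsewhere, within the class. *)
- move=> R hR a fR; have hR3 : DefP3 (fun x y _ : N => R x y) := hR.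
  have [Q [hQ h]] := DefP3_transfer hR3; have [|b [sb hb]] := @ax_repl S zf (fun x y => V x /\ V y /\ Q x y y) _ (ext a).
    move=> x y y' /in_ext[u [-> ua]] [_ [/V_sval[t ->] q]] [_ [/V_sval[t' ->] q']].
    by congr sval; apply: (fR u t t' ua ((h _ _ _).1 q) ((h _ _ _).1 q')).
  have [|k [_ [sk hk]]] := Vset sb; first by move=> t /hb[x [_ [_ []]]].
  exists k; split=> // y; rewrite hk hb; split=> [[x [/in_ext[u [-> ua]] [_ [_ /h q]]]]|[x [xa r]]].
    by exists u.
  exists (sval x); split; first exact/elt_ext.
  by split; [exact: Vsv|split; [exact: Vsv|apply/h]].
- by move=> x [a e] y [z []]; rewrite e => /esym/tag01.
- have [||k [sk hk]] := @Vsmall (fun t => exists z, z ∊ omega /\ t = tag1 z).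
  + by apply: small_img (small_elt _) _; def.
  + by move=> t [z [hz ->]]; apply: V_tag1.
  exists k; split=> // z; rewrite hk sval_atmP.
  by split=> -[a [h1 h2]]; exists a.
Qed.

End OmegaModel.

(** * The carrier of PM(⟨ℕ⟩) *)

Section Structures.
Context {S : structure} {zf : ZF S}.
Implicit Types (ρ : nat -> S) (x y z a b f n v w : S).

(** Without relation symbols every bijection is an automorphism. *)
Lemma sat_isAut0 ρ i j x : ρ j = pr x sempty ->
  sat ρ (isAut i j) <-> isset (ρ i) /\ forall f, f ∊ ρ i <-> Bij f x x.
Proof.
move=> e; rewrite /isAut; sats; split=> [[x' [r [h1 [h2 h3]]]]|[h2 h3]].
  move: h1; rewrite sat_isOPair; sats; rewrite e => /pr_inj[ex er]; subst x' r.
  split=> // f; split=> [/h3[/sat_isBij]//|hf]; apply/h3.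
  split; first exact/sat_isBij.
  by move=> u t /sat_pairIn; sats => /in_empty.
exists x, sempty; split; first exact/sat_isOPair.
split=> // f; split=> [/h3 hf|[/sat_isBij hf _]]; last exact/h3.
split; first exact/sat_isBij.
by move=> u t /sat_pairIn; sats => /in_empty.
Qed.

Lemma Fun_empty_dom f : Fun f sempty <-> f = sempty.
Proof.
split=> [[h1 [h2 _]]|->].
  by apply: empty_eq => // z /h2[u [/in_empty]].
by split; [exact: isset_empty|split; [|split]] => [z /in_empty|z /in_empty|? ? ? /in_empty].
Qed.

(** With no symbols to transport, only the image of the universe is left. *)
Lemma sat_isTransport0 ρ i j k x : ρ j = pr x sempty ->
  sat ρ (isTransport i j k) <-> exists x', ρ i = pr x' sempty /\ Bij (ρ k) x x'.
Proof.
move=> e; rewrite /isTransport; sats.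
split=> [[x0 [r [x' [r' [h1 [h2 [h3 [[d [h4 h5]] _]]]]]]]]|[x' [h1 h2]]].
  move: h1 h2 h3 h4 h5; rewrite !sat_isOPair sat_isBij !sat_isFun; sats.
  rewrite e => /pr_inj[<- <-] -> h3 [_ [_ [h4 _]]] [h5 [h6 _]]; exists x'; split=> //.
  rewrite (empty_eq h5) // => z /h6[u [/h4[t /in_empty //]]].
exists x, sempty, x', sempty; rewrite !sat_isOPair sat_isBij; sats; split=> //.
split=> //; split=> //; split.
  by exists sempty; rewrite !sat_isFun; sats; split; apply/Fun_empty_dom.
by move=> u t w /sat_pairIn; sats => /in_empty.
Qed.

Definition mos_rel y z := exists t f, t = tcs y /\ Fun f t
  /\ (forall u, u ∊ t -> forall v, pr u v ∊ f ->
        exists w, v = tag0 w /\ isset w /\ forall e, e ∊ w <-> exists u', u' ∊ u /\ pr u' e ∊ f)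
  /\ pr y z ∊ f.

Lemma mos_relP y z : mos_rel y z <-> z = mos y.
Proof.
split=> [[t [f [-> [[f1 [f2 [f3 f4]]] [hf yz]]]]]|->].
  suff h : forall u, u ∊ tcs y -> forall v, pr u v ∊ f -> v = mos u.
    by apply: h yz; apply: tcs_refl.
  apply: eps_ind.
  move=> u IH uy v uv; have [w [-> [sw hw]]] := hf u uy v uv.
  rewrite mosE; congr tag0; apply/esym/setof_eq => // e; rewrite hw.
  split=> -[u' [u'u]]; pose proof (tcs_trans uy u'u) as u'y.
    by move/(IH u' u'u u'y) => ->; exists u'.
  move=> ->; exists u'; split=> //; have [v' hv'] := f3 u' u'y.
  by rewrite -(IH u' u'u u'y _ hv').
have dF : DefF1 (mos : S -> S) by def.
pose proof (fun u v => in_graph (tcs y) u v dF) as inf.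
exists (tcs y), (graph mos (tcs y)); split=> //; split; first exact: Fun_graph.
split; last by apply/inf; split=> //; apply: tcs_refl.
move=> u hu v /inf[_ ->].
exists (setof (fun w => exists z, z ∊ u /\ w = mos z)); split; first exact: mosE.
split; first exact/isset_setof/small_mos.
move=> e; rewrite (setofP (small_mos u)); split=> -[u' [u'u h]]; exists u'; split=> //.
  by apply/inf; split=> //; apply: tcs_trans u'u.
by have [] := (inf u' e).1 h.
Qed.

Lemma sat_isF ρ i j : sat ρ (isF i j) <-> ρ j = mos (ρ i).
Proof.
rewrite -mos_relP /isF /mos_rel; sats; apply: iff_ex => t; apply: iff_ex => f.
do 2! (apply: iff_and; first by sat_iff).
apply: iff_and; last by sat_iff.
apply: iff_all => u; apply: iff_imp => //; apply: iff_all => v; apply: iff_imp.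
  by sat_iff.
apply: iff_ex => w; apply: iff_and; first exact: sat_isTag0.
by sat_iff.
Qed.

End Structures.

(** * Pairs and atoms of 𝒱⋆(ω), and the transported structure *)

Section PureEquality.
Context {S : structure} {zf : ZF S}.
Implicit Types (ρ : nat -> S) (x y z a b f n v w : S).

Notation V := (Vcl (omega : S)).
Notation N := (@Vstr S zf omega).
Notation U := (Vstar isPureEqN).

Lemma sval_upair (u t : N) : sval (upair u t) = tag0 (upair (sval u) (sval t)).
Proof.
rewrite (sval_ext (@isset_upair _ _ u t)); congr tag0.
apply: set_eq; [exact: isset_ext|exact: isset_upair|move=> w].
rewrite in_ext in_upair; split=> [[k [->]]|]; first by rewrite in_upair => -[] ->; auto.
by move=> [] ->; [exists u|exists t]; rewrite in_upair; auto.
Qed.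

(** The pair ⟨x, y⟩ as 𝒱⋆(ω) computes it, written as a term of the ambient model and hence definable
    there. *)
Definition vpr x y := tag0 (upair (tag0 (upair x x)) (tag0 (upair x y))).
#[global] Instance DefF2_vpr : DefF2 vpr. Proof. by def. Qed.

Lemma sval_pr (u t : N) : sval (pr u t) = vpr (sval u) (sval t).
Proof. by rewrite /pr sval_upair /sing !sval_upair. Qed.

Lemma Vmos_upair x y : Vmos (upair x y) = upair (Vmos x) (Vmos y).
Proof.
apply: set_eq; [exact: isset_Vmos|exact: isset_upair|move=> u].
rewrite in_Vmos in_upair; split=> [[z [/in_upair[] -> ->]]|[]->]; auto.
  by exists x; rewrite in_upair; auto.
by exists y; rewrite in_upair; auto.
Qed.

Lemma Vmos_pr x y : Vmos (pr x y) = pr (Vmos x) (Vmos y).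
Proof. by rewrite /pr /sing !Vmos_upair. Qed.

Definition Vatom n (hn : n ∊ omega) : N := exist _ _ (V_tag1 hn).

Lemma Vmos_empty : Vmos (sempty : S) = sempty.
Proof. by apply: empty_eq => [|u /in_Vmos[y [/in_empty]]] //; apply: isset_Vmos. Qed.

(** If n ∊ m, equality would make F(m) a member of itself; natural numbers are comparable, so this
    decides all cases. *)
Lemma Vmos_omega_inj n m : n ∊ omega -> m ∊ omega -> Vmos n = Vmos m -> n = m.
Proof.
move=> hn hm e; have [h|[//|h]] := Ord_lin (Ord_omega hn) (Ord_omega hm).
  by case: (@no_cycle1 _ _ (Vmos m)); rewrite -{1}e; apply/in_Vmos; exists n.
by case: (@no_cycle1 _ _ (Vmos m)); rewrite -{2}e; apply/in_Vmos; exists m.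
Qed.

Lemma Bij_graph (b : N) :
  isset b -> (forall z : N, z ∊ b <-> exists u t, z = pr u t /\
     exists n, n ∊ omega /\ u = Vmos n /\ sval t = tag1 n) ->
  Bij b (Vmos omega) atoms.
Proof.
move=> sb hb.
have hb' u t : pr u t ∊ b <-> exists n, n ∊ omega /\ u = Vmos n /\ sval t = tag1 n.
  rewrite hb; split=> [[u' [t' [/pr_inj[-> ->]]]]|h] //; by exists u, t.
split; [split; [split; [|split; [|split]]|]|split].
- by [].
- move=> z /hb[u [t [-> [n [hn [eu et]]]]]]; exists u; split; last by exists t.
  by apply/in_Vmos; exists n.
- move=> u /in_Vmos[n [hn ->]]; exists (Vatom hn).
  by apply/hb'; exists n.
- move=> u t t' /hb'[n [hn [-> et]]] /hb'[m [hm [e et']]].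
  apply: sval_inj; rewrite et et'; congr tag1; exact: Vmos_omega_inj e.
- by move=> u t /hb'[n [hn [_ et]]]; apply/in_atoms/sval_atmP; exists n.
- by move=> u u' t /hb'[n [hn [-> et]]] /hb'[m [hm [->]]]; rewrite et => /tag1_inj ->.
- move=> t /in_atoms/sval_atmP[n [et hn]]; exists (Vmos n).
  by split; [apply/in_Vmos; exists n|apply/hb'; exists n].
Qed.

(** The map F(n) ↦ ⟨n, 1⟩ is a set of the ambient model whose elements all lie in 𝒱⋆(ω), so it is
    represented there. *)
Lemma exists_bij : exists b : N, isset b /\ forall z : N, z ∊ b <-> exists u t, z = pr u t /\
     exists n, n ∊ omega /\ u = Vmos n /\ sval t = tag1 n.
Proof.
have vp n : n ∊ omega -> exists u t : N, vpr (mos n) (tag1 n) = sval (pr u t) /\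
    u = Vmos n /\ sval t = tag1 n.
  move=> hn; exists (Vmos n), (Vatom hn); split=> //.
  by rewrite sval_pr.
have [||b [sb hb]] := @Vsmall S zf (fun t => exists n, n ∊ omega /\ t = vpr (mos n) (tag1 n)).
- by apply: small_img (small_elt _) _; def.
- by move=> t [n [/vp[u [t' [-> _]]] ->]]; apply: Vsv.
exists b; split=> // z; rewrite hb; split=> [[n [hn e]]|[u [t [-> [n [hn [-> et]]]]]]].
  have [u [t [e' [eu et]]]] := vp n hn; exists u, t; split; last by exists n.
  by apply: sval_inj; rewrite e e'.
by exists n; rewrite sval_pr et.
Qed.

(* 2 is the index at which the carrier of PM(⟨ℕ⟩) uses this formula. *)
Lemma sat_isUnderline ρ (k : N) : ρ 2 = sval k ->
  sat ρ (isUnderline isPureEqN 2) <-> k = pr atoms sempty.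
Proof.
move=> ek; rewrite /isUnderline; sats.
pose σ s x r fa b := scons b (scons fa (scons r (scons x (scons s ρ)))).
(* Under its five binders [isUnderline] refers to the variable 2 as 7. *)
have relT s x r (faN bN : N) :
    sat (σ s x r (sval faN) (sval bN)) (relativize U (isTransport 7 1 0)) <->
    sat (fun i => match i with 0 => bN | 1 => faN | _ => k end) (isTransport 7 1 0).
  by apply: (@sat_U S zf _ (fun i => (i < 2) || (i == 7))) => // -[|[|i]] //= /eqP[->].
have relP s x r fa (bN u t : N) a :
    sat (scons (sval t) (scons (sval u) (scons a (σ s x r fa (sval bN)))))
      (relativize U (pairIn 3 1 0)) <-> pr u t ∊ bN.
  rewrite (@sat_U S zf _ (fun i => (i < 2) || (i == 3)) _
    (fun i => match i with 0 => t | 1 => u | _ => bN end)) ?sat_pairIn //.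
  by move=> [|[|[|[|i]]]].
have relF s x r fa (bN d : N) :
    sat (scons (sval d) (σ s x r fa (sval bN))) (relativize U (isFun 1 0)) <-> Fun bN d.
  rewrite (@sat_U S zf _ (fun i => i < 2) _
    (fun i => match i with 0 => d | _ => bN end)) ?sat_isFun //.
  by move=> [|[|i]].
split=> [[s [x [r [fa [b [h1 [h2 [h3 [_ [h5 [_ [_ [h8 h9]]]]]]]]]]]]]|e].
  have es : s = pr omega sempty by apply/(sat_isPureEqN (σ s x r fa b) 4).
  have : s = pr x r by apply/(sat_isOPair (σ s x r fa b) 4 3 2).
  rewrite es => /pr_inj[ex er].
  have efa : fa = mos s by apply/(sat_isF (σ s x r fa b) 4 1).
  have [bN eb] : exists bN : N, b = sval bN by apply/(sat_carrier_U (σ s x r fa b) 0).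
  have efa' : fa = sval (pr (Vmos omega) sempty : N).
    by rewrite efa es -Vmos_empty -Vmos_pr.
  subst b; rewrite efa' in h9; move/(relT s x r): h9.
  move/(sat_isTransport0 _ _ (erefl : _ 1 = _)) => [x' [ek' [[[b1 [b2 [b3 b4]]] b5] [b6 b7]]]].
  rewrite (ek' : k = _); congr pr.
  (* The clause on b puts every pair ⟨F(n), ⟨n, 1⟩⟩ into it. As the F(n) exhaust the domain F(ω),
     the range of b, and with it the universe of the structure, is exactly the set of atoms. *)
  have hT (t : N) n : n ∊ omega -> sval t = tag1 n -> pr (Vmos n) t ∊ bN.
    move=> hn et; apply/(relP s x r fa bN (Vmos n) t n); apply: (h8 n _ (mos n) (sval t)).
    - by rewrite -ex.
    - by apply/sat_isF.
    - by apply/sat_isTag1.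
  apply: set_eq; [|exact: isset_atoms|move=> t; split].
  - have h0 : Vmos sempty ∊ Vmos omega.
      by apply/in_Vmos; exists sempty; split=> //; apply: omega0.
    have [u hu] := b3 _ h0.
    exact: elt_isset (b5 _ _ hu).
  - move=> /b7[u [/in_Vmos[n [hn ->]] ut]]; apply/in_atoms.
    have e : sval (Vatom hn) = tag1 n by [].
    by rewrite (b4 _ _ _ ut (hT _ n hn e)); exists n.
  - by move=> /in_atoms/sval_atmP[n [et hn]]; apply: b5 (hT t n hn et).
have [bN [sb hb]] := exists_bij; have bb := Bij_graph sb hb.
have hc i (u : N) ρ' : ρ' i = sval u -> sat ρ' (carrier U i).
  by move=> h; apply/sat_carrier_U; exists u.
exists (pr omega sempty), omega, sempty, (sval (pr (Vmos omega) sempty : N)), (sval bN).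
split; first exact/(sat_isPureEqN (σ _ _ _ _ _) 4).
split; first exact/(sat_isOPair (σ _ _ _ _ _) 4 3 2).
split; first by apply/(sat_isF (σ _ _ _ _ _) 4 1); rewrite /= -Vmos_empty -Vmos_pr.
split; first exact: (hc 1 (pr (Vmos omega) sempty)).
split; first exact: (hc 0 bN).
split; first exact: (hc 7 k).
split.
  exists (sval (Vmos omega)); split; first by apply/sat_isF.
  by apply/relF; have [[? _] _] := bb.
split; last first.
  apply/(relT _ _ _ (pr (Vmos omega) sempty) bN).
  apply/(sat_isTransport0 _ _ (erefl : _ 1 = _)).
  by exists atoms.
move=> a ha f t hf ht.
have ef : f = sval (Vmos a) by apply/(sat_isF (scons t (scons f (scons a ρ))) 2 1).
have et : t = tag1 a by apply/(sat_isTag1 (scons t (scons f (scons a ρ))) 0 2).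
have ha' : a ∊ omega := ha.
rewrite ef et -[tag1 a]/(sval (Vatom ha')); apply/relP/hb.
exists (Vmos a), (Vatom ha'); split=> //.
by exists a.
Qed.

(** The transported structure is forced to be the set of atoms without relations, its group to be
    [SymA] and the filter to be [Ffin], all computed in 𝒱⋆(ω). What remains is [HS]. *)
Lemma sat_PM_str ρ :
  sat ρ (carrier (PM_str isPureEqN) 0) <-> exists k : N, ρ 0 = sval k /\ HS k.
Proof.
rewrite /PM_str; cbn [carrier]; sats.
have hc i ρ' : sat ρ' (carrier U i) <-> exists u : N, ρ' i = sval u.
  exact: sat_carrier_U.
pose σ u g F := scons F (scons g (scons u ρ)).
pose τ (k u g F : N) i := match i with 0 => F | 1 => g | 2 => u | _ => k end.
have rel φ (k u g F : N) : fv_in (fun i => i < 4) φ -> ρ 0 = sval k ->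
    sat (σ (sval u) (sval g) (sval F)) (relativize U φ) <-> sat (τ k u g F) φ.
  by move=> hφ ek; apply: (sat_U hφ) => -[|[|[|[|i]]]].
split=> [[u [g [F [/(hc 3)[k ek] [/(hc 2)[uN eu] [/(hc 1)[gN eg] [/(hc 0)[FN eF]]]]]]]]|[k [ek hk]]].
  have {}ek : ρ 0 = sval k := ek; have {}eu : u = sval uN := eu.
  have {}eg : g = sval gN := eg; have {}eF : F = sval FN := eF.
  subst u g F; move=> [/(sat_isUnderline (ρ := σ _ _ _) erefl) e1 [h2 [h3 h4]]].
  exists k; split=> //.
  move/(rel (isAut 1 2) _ _ _ _ erefl ek): h2 => /(sat_isAut0 1 (ρ := τ k uN gN FN) (j := 2) e1)[h2 h2'].
  have e2 : gN = SymA.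
    apply: set_eq => //; first exact/isset_setof/small_Sym.
    by move=> p; rewrite in_SymA; apply: h2'.
  move/(rel (isFfin 0 1) _ _ _ _ erefl ek): h3 => /(sat_isFfin (ρ := τ k uN gN FN) 0 (j := 1) e2) e3.
  by move/(rel (inPM 1 0 3) _ _ _ _ erefl ek): h4 => /(sat_inPM (ρ := τ k uN gN FN) 3 (i := 1) (j := 0) e2 e3).
exists (sval (pr atoms sempty : N)), (sval (SymA : N)), (sval (Ffin : N)).
split; first by apply/(hc 3); exists k.
split; first by apply/(hc 2); eexists.
split; first by apply/(hc 1); eexists.
split; first by apply/(hc 0); eexists.
split; first exact: (sat_isUnderline (ρ := σ _ _ _) erefl).2.
pose τ0 := τ k (pr atoms sempty) SymA Ffin.
have e1 : τ0 1 = SymA by []; have e0 : τ0 0 = Ffin by [].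
split.
  apply/(rel (isAut 1 2) _ _ _ _ erefl ek)/(sat_isAut0 1 (ρ := τ0) (j := 2) erefl).
  by split; [exact/isset_setof/small_Sym|move=> p; rewrite in_SymA].
split; first by apply/(rel (isFfin 0 1) _ _ _ _ erefl ek)/(sat_isFfin (ρ := τ0) 0 (j := 1) e1).
by apply/(rel (inPM 1 0 3) _ _ _ _ erefl ek)/(sat_inPM (ρ := τ0) 3 (i := 1) (j := 0) e1 e0).
Qed.

End PureEquality.

(** * Symmetric universes inside a model *)

(* What the back-and-forth argument uses of a permutation model with finite
   supports that is definable in a model of ZFA. *)
Record symuniv (S : structure) : Type := SymUniv {
  su_dom : S -> Prop;
  su_elt : S -> S -> Prop;
  su_atoms : S;
  su_perm : S -> Prop;
  su_act : S -> S -> S;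
  su_def_dom : DefP1 su_dom;
  su_def_elt : DefP2 su_elt;
  su_def_perm : DefP1 su_perm;
  su_def_act : DefF2 su_act;
  su_dom_elt : forall x y, su_dom x -> su_elt y x -> su_dom y;
  su_atoms_dom : forall a, a ∊ su_atoms -> su_dom a;
  su_atoms_empty : forall x y, x ∊ su_atoms -> ~ su_elt y x;
  su_ext : forall x y, su_dom x -> su_dom y -> ~ x ∊ su_atoms -> ~ y ∊ su_atoms ->
    (forall z, su_elt z x <-> su_elt z y) -> x = y;
  su_ind : forall P : S -> Prop, DefP1 P ->
    (forall x, su_dom x -> (forall y, su_elt y x -> P y) -> P x) ->
    forall x, su_dom x -> P x;
  su_closed : forall x, su_dom x ->
    exists t, x ∊ t /\ forall v, v ∊ t -> forall u, su_elt u v -> u ∊ t;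
  su_act_dom : forall g x, su_perm g -> su_dom x -> su_dom (su_act g x);
  su_act_atoms : forall g x, su_perm g -> su_dom x -> su_act g x ∊ su_atoms <-> x ∊ su_atoms;
  su_act_elt : forall g x y, su_perm g -> su_dom x ->
    su_elt y x -> su_elt (su_act g y) (su_act g x);
  su_inv : forall g, su_perm g -> exists h, su_perm h /\ forall x, su_dom x ->
    su_act h (su_act g x) = x /\ su_act g (su_act h x) = x;
  su_mul : forall g h, su_perm g -> su_perm h -> exists k, su_perm k /\
    forall x, su_dom x -> su_act k x = su_act g (su_act h x);
  su_supp : forall x, su_dom x -> exists a, Fin a /\ (forall c, c ∊ a -> c ∊ su_atoms) /\
    forall g, su_perm g -> (forall c, c ∊ a -> su_act g c = c) -> su_act g x = x;
  su_comprehension : forall (P : S -> Prop) a, small P -> (forall w, P w -> su_dom w) ->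
    Fin a -> (forall c, c ∊ a -> c ∊ su_atoms) ->
    (forall g, su_perm g -> (forall c, c ∊ a -> su_act g c = c) ->
       forall w, P w -> P (su_act g w)) ->
    exists x, su_dom x /\ ~ x ∊ su_atoms /\ (forall w, su_elt w x <-> P w) /\
      forall g, su_perm g -> (forall c, c ∊ a -> su_act g c = c) -> su_act g x = x;
  su_involution : forall f,
    (forall a b, pr a b ∊ f -> a ∊ su_atoms /\ b ∊ su_atoms) ->
    (forall a b b', pr a b ∊ f -> pr a b' ∊ f -> b = b') ->
    (forall a a' b, pr a b ∊ f -> pr a' b ∊ f -> a = a') ->
    (forall a b c, pr a b ∊ f -> ~ pr b c ∊ f) ->
    exists g, su_perm g /\ (forall a b, pr a b ∊ f -> su_act g a = b) /\
      (forall c, c ∊ su_atoms -> (forall b, ~ pr c b ∊ f) -> (forall a, ~ pr a c ∊ f) ->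
         su_act g c = c);
  su_atoms_set : isset su_atoms;
  su_infinite : ~ Fin su_atoms
}.

#[global] Existing Instance su_def_dom.
#[global] Existing Instance su_def_elt.
#[global] Existing Instance su_def_perm.
#[global] Existing Instance su_def_act.

(* [K] is a definable class model of [S] containing every subset of it. *)
Record embedding (K S : structure) (ι : K -> S) : Prop := Embedding {
  emb_inj : injective ι;
  emb_def3 : forall R : K -> K -> K -> Prop, DefP3 R -> exists Q : S -> S -> S -> Prop,
    DefP3 Q /\ forall u t k, Q (ι u) (ι t) (ι k) <-> R u t k;
  emb_range : DefP1 (fun w => exists k, w = ι k);
  emb_ext : forall k, small (fun t => exists u, t = ι u /\ u ∊ k);
  emb_comp : forall P : S -> Prop, small P -> (forall t, P t -> exists u, t = ι u) ->
    exists k, isset k /\ forall u, u ∊ k <-> P (ι u);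
  emb_ind : forall P : S -> Prop, DefP1 P ->
    (forall k, (forall u, u ∊ k -> P (ι u)) -> P (ι k)) -> forall k, P (ι k);
  emb_pr : exists f : S -> S -> S, DefF2 f /\ forall u t, ι (pr u t) = f (ι u) (ι t)
}.

Section SideOfEmbedding.
Context {S : structure} {zf : ZF S}.
Variables (K : structure) (zfK : ZF K) (ι : K -> S) (emb : embedding ι).
Hypothesis atomsK_inf : ~ Fin (setof (fun t => exists u, t = ι u /\ atm u)).

Let ιI := emb_inj emb.

(** The transferred relation is known to agree with R on the range of ι only, so membership in the
    range is conjoined to it. *)
Lemma emb_lift3 (R : K -> K -> K -> Prop) : DefP3 R ->
  DefP3 (fun x y z => exists u t k, x = ι u /\ y = ι t /\ z = ι k /\ R u t k).
Proof.
move=> /(emb_def3 emb)[Q [hQ h]]; have hr := emb_range emb.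
have hi i : Def (fun ρ : nat -> S => exists u, ρ i = ι u).
  exact: (Def_rename (fun _ => i) hr).
have hd : DefP3 (fun x y z => (exists u, x = ι u) /\ (exists t, y = ι t) /\
    (exists k, z = ι k) /\ Q x y z).
  exact: (Def_and (hi 0) (Def_and (hi 1) (Def_and (hi 2) hQ))).
apply: Def_ext hd => ρ.
split=> [[[u eu] [[t et] [[k ek]]]]|[u [t [k [eu [et [ek hu]]]]]]].
  by rewrite eu et ek h => ?; exists u, t, k.
by rewrite eu et ek h; split; [exists u|split; [exists t|split; [exists k|]]].
Qed.

Lemma emb_lift2 (R : K -> K -> Prop) : DefP2 R ->
  DefP2 (fun x y => exists u t, x = ι u /\ y = ι t /\ R u t).
Proof.
move=> hR; have hR3 : DefP3 (fun u t _ : K => R u t) := hR.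
have h := Def_rename (fun i => if i is 0 then 0 else 1) (emb_lift3 hR3).
apply: Def_ext h => ρ; split=> [[u [t [_ [eu [et [_ r]]]]]]|[u [t [eu [et r]]]]].
  by exists u, t.
by exists u, t, t.
Qed.

Lemma emb_lift1 (R : K -> Prop) : DefP1 R -> DefP1 (fun x => exists u, x = ι u /\ R u).
Proof.
move=> hR; have hR3 : DefP3 (fun u _ _ : K => R u) := hR.
have h := Def_rename (fun _ => 0) (emb_lift3 hR3).
apply: Def_ext h => ρ; split=> [[u [_ [_ [eu [_ [_ r]]]]]]|[u [eu r]]]; first by exists u.
by exists u, u, u.
Qed.

(** * Hereditarily symmetric elements of an embedded model *)

Definition emb_dom x := exists u, x = ι u /\ HS u.
Definition emb_elt x y := exists u t, x = ι u /\ y = ι t /\ u ∊ t.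
Definition emb_atoms : S := setof (fun x => exists u, x = ι u /\ atm u).
Definition emb_perm x := exists u, x = ι u /\ Sym u.
Definition emb_act x y := the (fun z =>
  exists u t k, x = ι u /\ y = ι t /\ z = ι k /\ k = act u t).

#[local] Instance DefP1_emb_dom : DefP1 emb_dom.
Proof. by apply: emb_lift1; def. Qed.
#[local] Instance DefP2_emb_elt : DefP2 emb_elt.
Proof. by apply: emb_lift2; def. Qed.
#[local] Instance DefP1_emb_perm : DefP1 emb_perm.
Proof. by apply: emb_lift1; def. Qed.
#[local] Instance DefF2_emb_act : DefF2 emb_act.
Proof.
have h : DefP3 (fun u t k : K => k = act u t) by def.
have h' := emb_lift3 h.
apply: DefT_the; exact: (Def_rename (fun i => match i with 0 => 1 | 1 => 2 | _ => 0 end) h').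
Qed.

Lemma small_emb_atoms : small (fun x => exists u, x = ι u /\ atm u).
Proof.
apply: eq_small (emb_ext emb atoms) => x.
by split=> -[t [e h]]; exists t; move: h; rewrite in_atoms.
Qed.

Lemma in_emb_atoms u : ι u ∊ emb_atoms <-> atm u.
Proof. by rewrite (setofP small_emb_atoms); split=> [[t [/ιI ->]]|] //; exists u. Qed.

Lemma emb_atomsE x : x ∊ emb_atoms -> exists u, x = ι u /\ atm u.
Proof. by move=> /(setofP small_emb_atoms). Qed.

Lemma emb_actE u t : emb_act (ι u) (ι t) = ι (act u t).
Proof.
apply: the_eq; first by exists u, t, (act u t).
by move=> z [u' [t' [k [/ιI <- [/ιI <- [-> ->]]]]]].
Qed.

Lemma emb_eltE u t : emb_elt (ι u) (ι t) <-> u ∊ t.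
Proof. by split=> [[u' [t' [/ιI -> [/ιI ->]]]]|h] //; exists u, t. Qed.

Lemma HS_atm (u : K) : atm u -> HS u.
Proof.
move=> au; apply: HS_intro => [y yu|]; first by case: (ax_atomEmpty au yu).
exists (sing u); split; [|split].
- exact: Fin_sing.
- by move=> c /in_sing ->.
- by move=> p hp; apply; rewrite in_sing.
Qed.

Definition ext_of k := setof (fun t => exists u, t = ι u /\ u ∊ k).

Lemma in_ext_of k u : ι u ∊ ext_of k <-> u ∊ k.
Proof.
by rewrite (setofP (emb_ext emb k)); split=> [[t [/ιI ->]]|] //; exists u.
Qed.

Lemma ext_ofE k t : t ∊ ext_of k -> exists u, t = ι u /\ u ∊ k.
Proof. by move=> /(setofP (emb_ext emb k)). Qed.

Lemma isset_ext_of k : isset (ext_of k).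
Proof. exact/isset_setof/(emb_ext emb k). Qed.

(* Finiteness does not depend on the model, as both have the same families of
   subsets of a given set. *)
Lemma Fin_ext_of k : Fin k -> Fin (ext_of k).
Proof.
move=> fk; have sk := Fin_set fk; move=> C C0 CS.
(* The family of those b ⊆ k whose extension lies in C, to be turned into a set of K. Extensions are
   described through [emb_elt], which is definable in the ambient model. *)
pose P t := t ∊ ext_of (pow k) /\ exists c, c ∊ C /\ isset c /\ forall s, s ∊ c <-> emb_elt s t.
have sP : small P by apply: small_sep; def.
have [|D [sD hD]] := emb_comp emb sP.
  by move=> t [/ext_ofE[u [-> _]] _]; exists u.
have hc c b : isset c -> (forall s, s ∊ c <-> emb_elt s (ι b)) -> c = ext_of b.
  move=> sc h; apply: set_eq => //; first exact: isset_ext_of.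
  move=> s; rewrite h; split=> [[u [t [-> [/ιI -> ?]]]]|/ext_ofE[u [-> ub]]].
    exact/in_ext_of.
  by exists u, b.
have he b s : s ∊ ext_of b <-> emb_elt s (ι b).
  split=> [/ext_ofE[u [-> ub]]|[u [t [-> [/ιI -> ?]]]]]; last exact/in_ext_of.
  by exists u, b.
have inD b : b ∊ D <-> b ∊ pow k /\ ext_of b ∊ C.
  rewrite hD /P in_ext_of; apply: iff_and => //; split=> [[c [cC [sc h]]]|h].
    by rewrite -(hc c b).
  by exists (ext_of b); split=> //; split; [exact: isset_ext_of|exact: he].
suff /inD[] : k ∊ D by [].
apply: fk.
  apply/inD; split; first by apply/in_pow; split; [exact: isset_empty|move=> t /in_empty].
  rewrite (_ : ext_of _ = sempty) //; apply: empty_eq; first exact: isset_ext_of.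
  by move=> z /ext_ofE[u [_ /in_empty]].
move=> b x /inD[/in_pow[sb hb] bC] xk; apply/inD; split.
  apply/in_pow; split; first exact: isset_cup.
  by move=> t; rewrite in_cup in_sing => -[/hb|->].
rewrite (_ : ext_of _ = cup (ext_of b) (sing (ι x))).
  by apply: CS => //; apply/in_ext_of.
apply: set_eq; [exact: isset_ext_of|exact: isset_cup|move=> z].
rewrite in_cup in_sing; split=> [/ext_ofE[u [->]]|[/ext_ofE[u [-> ub]]|->]].
- by rewrite in_cup in_sing in_ext_of => -[|->]; auto.
- by apply/in_ext_of; rewrite in_cup; left.
- by apply/in_ext_of; rewrite in_cup in_sing; right.
Qed.

(** A finite set of the ambient model is built up one element at a time, and each addition can be
    carried out in K. Finiteness in K is lifted to [LFin] so that the induction predicate is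
    definable. *)
Lemma Fin_emb a : Fin a -> (forall t, t ∊ a -> exists u, t = ι u) ->
  exists k, Fin k /\ forall u, u ∊ k <-> ι u ∊ a.
Proof.
pose LFin t := exists k, t = ι k /\ Fin k.
have dL : DefP1 LFin by apply: emb_lift1; def.
pose R t := exists u, t = ι u; have dR : DefP1 R := emb_range emb.
move=> fa ha; suff : exists t, LFin t /\ forall s, s ∊ a <-> emb_elt s t.
  move=> [t [[k [-> fk]] h]]; exists k; split=> // u; rewrite h.
  by rewrite emb_eltE.
have {}ha : forall t, t ∊ a -> R t by [].
move: a fa ha; apply: Fin_ind.
  move=> _; exists (ι sempty); split; first by exists sempty; split=> //; exact: Fin0.
  by move=> s; split=> [/in_empty|[u [t [_ [/ιI <- /in_empty]]]]].
move=> b x _ IH h; have [|t [[k [-> fk]] hk]] := IH.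
  by move=> t tb; apply: h; rewrite in_cup; left.
have [y ex] : R x by apply: h; rewrite in_cup in_sing; right.
subst x.
exists (ι (cup k (sing y))); split; first by exists (cup k (sing y)); split=> //; apply: Fin_add.
move=> s; rewrite in_cup in_sing hk; split=> [[[u [t1 [-> [/ιI <- uk]]]]|->]|[u [t1 [-> [/ιI <-]]]]].
- by apply/emb_eltE; rewrite in_cup; left.
- by apply/emb_eltE; rewrite in_cup in_sing; right.
- by rewrite in_cup in_sing => -[uk|->]; [left; apply/emb_eltE|right].
Qed.

(** The permutation exchanges the two ends of each pair of f and fixes all other atoms. As no value
    of f is also an argument, this relation is functional; being a set of pairs from K, it is
    represented in K. *)
Lemma emb_involution f :
  (forall a b, pr a b ∊ f -> a ∊ emb_atoms /\ b ∊ emb_atoms) ->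
  (forall a b b', pr a b ∊ f -> pr a b' ∊ f -> b = b') ->
  (forall a a' b, pr a b ∊ f -> pr a' b ∊ f -> a = a') ->
  (forall a b c, pr a b ∊ f -> ~ pr b c ∊ f) ->
  exists g, emb_perm g /\ (forall a b, pr a b ∊ f -> emb_act g a = b) /\
    (forall c, c ∊ emb_atoms -> (forall b, ~ pr c b ∊ f) -> (forall a, ~ pr a c ∊ f) ->
       emb_act g c = c).
Proof.
move=> fA ff fi fn.
pose rel x y := pr x y ∊ f \/ pr y x ∊ f \/
  (x = y /\ (forall b, ~ pr x b ∊ f) /\ (forall a, ~ pr a x ∊ f)).
have dr : DefP2 rel by unfold rel; def.
have rels x y : rel x y -> rel y x.
  by move=> [?|[?|[e ?]]]; [right; left|left|subst y; right; right].
have relf x y y' : rel x y -> rel x y' -> y = y'.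
  move=> [h1|[h1|[<- [n1 n2]]]] [h2|[h2|[<- [n3 n4]]]] //.
  - exact: ff h1 h2.
  - by case: (fn _ _ _ h2 h1).
  - by case: (n3 y).
  - by case: (fn _ _ _ h1 h2).
  - exact: fi h1 h2.
  - by case: (n4 y).
  - by case: (n1 y').
  - by case: (n2 y').
have relt x : exists y, rel x y.
  have [[y h]|n1] := pselect (exists y, pr x y ∊ f); first by exists y; left.
  have [[y h]|n2] := pselect (exists y, pr y x ∊ f); first by exists y; right; left.
  exists x; right; right; split=> //.
  by split=> y h; [apply: n1|apply: n2]; exists y.
have relA x y : rel x y -> x ∊ emb_atoms -> y ∊ emb_atoms.
  by move=> [/fA[]|[/fA[]|[<-]]].
have [p [dp hp]] := emb_pr emb.
pose P z := exists x, x ∊ emb_atoms /\ exists y, y ∊ emb_atoms /\ z = p x y /\ rel x y.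
have sP : small P.
  pose proof (small_img2 (small_elt emb_atoms) (small_elt emb_atoms) dp) as h.
  apply: (small_sub _ h); first by unfold P; def.
  by move=> z [x [hx [y [hy [-> _]]]]]; exists x; split=> //; exists y.
have [|k [sk hk]] := emb_comp emb sP.
  move=> t [x [/emb_atomsE[u [-> _]] [y [/emb_atomsE[w [-> _]] [-> _]]]]].
  by exists (pr u w); rewrite hp.
have hk' z : z ∊ k <-> exists u t, z = pr u t /\ atm u /\ atm t /\ rel (ι u) (ι t).
  rewrite hk; split=> [[x [/emb_atomsE[u [-> au]] [y [/emb_atomsE[t [-> at']] [e r]]]]]|].
    exists u, t; split=> //; apply: ιI; by rewrite hp.
  move=> [u [t [-> [au [at' r]]]]]; exists (ι u); split; first exact/in_emb_atoms.
  by exists (ι t); split; [exact/in_emb_atoms|rewrite hp].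
have hkp u t : pr u t ∊ k <-> atm u /\ atm t /\ rel (ι u) (ι t).
  by rewrite hk'; split=> [[u' [t' [/pr_inj[-> ->]]]]|h] //; exists u, t.
have relK u : atm u -> exists t, atm t /\ rel (ι u) (ι t).
  move=> /in_emb_atoms au; have [y r] := relt (ι u).
  have /emb_atomsE[t [e at']] := relA _ _ r au.
  by exists t; rewrite -e.
have symk : Sym k.
  split; [split; [split; [|split; [|split]]|]|split].
  - by [].
  - by move=> z /hk'[u [t [-> [au _]]]]; exists u; split; [apply/in_atoms|exists t].
  - move=> u /in_atoms au; have [t [at' r]] := relK u au.
    by exists t; apply/hkp.
  - by move=> u t t' /hkp[_ [_ r]] /hkp[_ [_ r']]; apply: ιI; apply: relf r r'.
  - by move=> u t /hkp[_ [at' _]]; apply/in_atoms.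
  - move=> u u' t /hkp[_ [_ /rels r]] /hkp[_ [_ /rels r']].
    by apply: ιI; apply: relf r r'.
  - move=> t /in_atoms at'; have [u [au /rels r]] := relK t at'.
    by exists u; split; [apply/in_atoms|apply/hkp].
have actk u t : atm u -> atm t -> rel (ι u) (ι t) -> emb_act (ι k) (ι u) = ι t.
  by move=> au at' r; rewrite emb_actE; congr ι; apply/act_atomP => //; apply/hkp.
exists (ι k); split; first by exists k.
split=> [a b h|c /emb_atomsE[u [-> au]] n1 n2]; last by apply: actk => //; right; right.
have [/emb_atomsE[u [eu au]] /emb_atomsE[t [et at']]] := fA _ _ h.
by rewrite eu et; apply: actk => //; left; rewrite -eu -et.
Qed.

(** The set k exists in K by [emb_comp]. A permutation fixing a pointwise maps k into itself, and so
    does its inverse; hence a supports k, and k is hereditarily symmetric. *)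
Lemma emb_comprehension (P : S -> Prop) a : small P -> (forall w, P w -> emb_dom w) ->
  Fin a -> (forall c, c ∊ a -> c ∊ emb_atoms) ->
  (forall g, emb_perm g -> (forall c, c ∊ a -> emb_act g c = c) ->
     forall w, P w -> P (emb_act g w)) ->
  exists x, emb_dom x /\ ~ x ∊ emb_atoms /\ (forall w, emb_elt w x <-> P w) /\
    forall g, emb_perm g -> (forall c, c ∊ a -> emb_act g c = c) -> emb_act g x = x.
Proof.
move=> sP PD fa aA ha.
have [|k [sk hk]] := emb_comp emb sP; first by move=> t /PD[u [-> _]]; exists u.
have [|a' [fa' ha']] := Fin_emb fa.
  by move=> t /aA/emb_atomsE[u [-> _]]; exists u.
have fixa g : Sym g -> (forall c, c ∊ a' -> act g c = c) ->
    forall c, c ∊ a -> emb_act (ι g) c = c.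
  move=> hg h c ca; have [u [e au]] := emb_atomsE (aA c ca); subst c.
  by rewrite emb_actE h //; apply/ha'.
have closed g : Sym g -> (forall c, c ∊ a' -> act g c = c) -> forall u, u ∊ k -> act g u ∊ k.
  move=> hg h u /hk pu; apply/hk; rewrite -emb_actE; apply: ha => //; first by exists g.
  exact: fixa.
have supk : supp a' k.
  move=> g hg h; apply: set_eq => //; first exact: isset_act.
  move=> w; rewrite in_act //; split=> [[z [zk ->]]|wk]; first exact: closed.
  exists (act (inv g) w); rewrite act_invK //; split=> //; apply: closed => //.
    exact: Sym_inv.
  by move=> c ca; rewrite -{1}(h c ca) act_inv.
exists (ι k); split; [|split; [|split]].
- exists k; split=> //; apply: HS_intro => [y /hk/PD[u [/ιI ->]] //|].
  by exists a'; split=> //; split=> // c /ha'/aA/in_emb_atoms.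
- by move/in_emb_atoms.
- move=> w; split=> [[u [t [-> [/ιI <- /hk]]]] //|pw].
  by have [u [e _]] := PD w pw; subst w; apply/emb_eltE/hk.
- move=> g [p [-> hp]] h; rewrite emb_actE supk //.
  by move=> c /ha' ca; apply: ιI; rewrite -emb_actE h.
Qed.

Definition symuniv_of_emb : symuniv S.
Proof.
refine (@SymUniv S emb_dom emb_elt emb_atoms emb_perm emb_act _ _ _ _
  _ _ _ _ _ _ _ _ _ _ _ _ emb_comprehension emb_involution
  (isset_setof small_emb_atoms) atomsK_inf).
- by move=> x y [u [-> hu]] [t [u' [-> [/ιI <- tu]]]]; exists t; split=> //; apply: HS_elt hu tu.
- by move=> a /emb_atomsE[u [-> au]]; exists u; split=> //; apply: HS_atm.
- move=> x y /emb_atomsE[u [-> au]] [t [u' [_ [/ιI <- tu]]]].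
  exact: (ax_atomEmpty au tu).
- move=> x y [u [-> hu]] [t [-> ht]]; rewrite !in_emb_atoms => su st h.
  congr ι; apply: set_eq => // z; have := h (ι z); by rewrite !emb_eltE.
- move=> P dP h x [k [-> hk]].
  have dQ : DefP1 (fun x => emb_dom x -> P x) by def.
  apply: (emb_ind emb dQ); last by exists k.
  move=> {hk} k IH hk; apply: h => // y [u [t [-> [/ιI <- uk]]]].
  apply: IH => //; case: hk => k' [/ιI <- hk].
  by exists u; split=> //; apply: HS_elt hk uk.
- move=> x [u [-> hu]]; exists (ext_of (tcs u)); split; first exact/in_ext_of/tcs_refl.
  move=> v /ext_ofE[w [-> hw]] y [t [w' [-> [/ιI <- tw]]]].
  by apply/in_ext_of; apply: tcs_trans tw.
- move=> g x [p [-> hp]] [u [-> hu]]; rewrite emb_actE.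
  by exists (act p u); split=> //; apply: HS_act.
- move=> g x [p [-> hp]] [u [-> hu]]; rewrite emb_actE !in_emb_atoms; exact: act_atmE.
- move=> g x y [p [-> hp]] _ [u [t [-> [-> ut]]]]; rewrite !emb_actE.
  by apply/emb_eltE; apply: act_elt.
- move=> g [p [-> hp]]; exists (ι (inv p)); split.
    by exists (inv p); split=> //; apply: Sym_inv.
  by move=> x [u [-> _]]; rewrite !emb_actE act_inv // act_invK.
- move=> g h [p [-> hp]] [q [-> hq]]; exists (ι (comp p q)); split.
    by exists (comp p q); split=> //; apply: Sym_comp.
  by move=> x [u [-> _]]; rewrite !emb_actE act_comp.
- move=> x [u [-> /HS_fsupp[a [fa [ha sa]]]]]; exists (ext_of a); split; first exact: Fin_ext_of.
  split=> [c /ext_ofE[t [-> /ha ?]]|g [p [-> hp]] h]; first exact/in_emb_atoms.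
  rewrite emb_actE sa // => c ca; apply: ιI; rewrite -emb_actE; apply: h.
  exact/in_ext_of.
Defined.

End SideOfEmbedding.

(** * Back and forth between symmetric universes *)

Section BackForth.
Context {S : structure} {zf : ZF S}.
Implicit Types (s t : symuniv S) (a b f p q r x y z u v g : S).

Lemma small_uniq (P : S -> Prop) : (forall z z', P z -> P z' -> z = z') -> small P.
Proof.
move=> h; have [[z hz]|n] := pselect (exists z, P z).
  by apply: eq_small (small_eq z) => z'; split=> [->|hz'] //; apply: h.
by apply: eq_small small_false => z; split=> // hz; apply: n; exists z.
Qed.

Lemma Fin_rel (R : S -> S -> Prop) p b : DefP2 R -> Fin p -> isset b ->
  (forall z w w', R z w -> R z w' -> w = w') ->
  (forall w, w ∊ b -> exists z, z ∊ p /\ R z w) -> Fin b.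
Proof.
move=> hR fp sb hu hb.
have hf : DefF1 (fun z => the (fun w => R z w)) by def.
apply: (Fin_sub (Fin_img hf fp)); split=> // w /hb[z [zp zw]].
apply/(setofP (small_img (small_elt p) hf)); exists z; split=> //.
by apply/esym/the_eq => // w' /hu; apply.
Qed.

(** * Finite partial injections between two sets of atoms *)

Definition finj s t p := Fin p
  /\ (forall z, z ∊ p -> exists a, a ∊ su_atoms s /\ exists b, b ∊ su_atoms t /\ z = pr a b)
  /\ (forall a b b', pr a b ∊ p -> pr a b' ∊ p -> b = b')
  /\ (forall a a' b, pr a b ∊ p -> pr a' b ∊ p -> a = a').
#[local] Instance DefP1_finj s t : DefP1 (finj s t).
Proof. by def. Qed.

Lemma finj_atoms s t p a b : finj s t p -> pr a b ∊ p -> a ∊ su_atoms s /\ b ∊ su_atoms t.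
Proof. by move=> [_ [h _]] /h[a' [ha [b' [hb /pr_inj[-> ->]]]]]. Qed.

Lemma small_finj s t : small (finj s t).
Proof.
pose proof (small_prod (small_elt (su_atoms s)) (small_elt (su_atoms t))) as h.
apply: (@small_le _ _ _ (pow (setof _))) => p hp; rewrite in_pow; split.
  by case: hp => /Fin_set.
by have [_ [h2 _]] := hp; move=> z /h2 hz; apply/(setofP h).
Qed.

Lemma finj_inv s t p : finj s t p -> finj t s (inv p).
Proof.
move=> [fp [h1 [h2 h3]]]; split; [|split; [|split]].
- apply: (@Fin_rel (fun z w => exists a b, z = pr a b /\ w = pr b a) p) => //.
  + exact: isset_inv.
  + by move=> z w w' [a [b [-> ->]]] [a' [b' [/pr_inj[-> ->] ->]]].
  + by move=> w /inv_pair[b [a [-> h]]]; exists (pr a b); split=> //; exists a, b.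
- move=> z /inv_pair[b [a [-> /h1[a' [ha [b' [hb /pr_inj[-> ->]]]]]]]].
  by exists b'; split=> //; exists a'.
- by move=> a b b'; rewrite !in_inv; apply: h3.
- by move=> a a' b; rewrite !in_inv; apply: h2.
Qed.

Lemma finj_invK s t p : finj s t p -> inv (inv p) = p.
Proof.
move=> [/Fin_set sp [h _]]; apply: inv_inv => // z /h[x [_ [y [_ e]]]].
by exists x, y.
Qed.

Definition sub a b := forall z, z ∊ a -> z ∊ b.
#[local] Instance DefP2_sub : DefP2 sub. Proof. by def. Qed.

Lemma sub_inv p q : sub p q -> sub (inv p) (inv q).
Proof. by move=> h z /inv_pair[b [a [-> /h]]]; rewrite in_inv. Qed.

(* The domain of [p] supports [x]. *)
Definition sup s p x := forall g, su_perm s g ->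
  (forall a b, pr a b ∊ p -> su_act s g a = a) -> su_act s g x = x.
#[local] Instance DefP2_sup s : DefP2 (sup s).
Proof. by def. Qed.

Lemma supW s p q x : sub p q -> sup s p x -> sup s q x.
Proof. by move=> h hp g hg k; apply: hp => // a b /h; apply: k. Qed.

(** * The correspondence between two universes *)

(** The operator of which [sim] is the largest fixed point. The support conditions let a permutation
    that fixes one side of p move a chosen member of x or y without leaving x or y; extending p in
    [simW] depends on this. *)
Definition step s t (R : S -> S -> S -> Prop) p x y :=
  finj s t p /\ su_dom s x /\ su_dom t y /\
  ((x ∊ su_atoms s /\ y ∊ su_atoms t /\ pr x y ∊ p) \/
   (~ x ∊ su_atoms s /\ ~ y ∊ su_atoms t /\ sup s p x /\ sup t (inv p) y
    /\ (forall u, su_elt s u x ->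
          exists q, finj s t q /\ sub p q /\ exists v, su_elt t v y /\ R q u v)
    /\ (forall v, su_elt t v y ->
          exists q, finj s t q /\ sub p q /\ exists u, su_elt s u x /\ R q u v))).

Definition triple p x y := pr p (pr x y).
#[local] Instance DefF3_triple : DefF3 triple. Proof. by def. Qed.

Lemma triple_inj p x y p' x' y' :
  triple p x y = triple p' x' y' -> p = p' /\ x = x' /\ y = y'.
Proof. by move=> /pr_inj[-> /pr_inj]. Qed.

(* [x] corresponds to [y] under every extension of [p] to a bijection of the
   atoms; the recursive characterisation [simE] is turned into a definition by
   taking the largest relation satisfying it. *)
Definition sim s t p x y := exists R,
  (forall p x y, triple p x y ∊ R -> step s t (fun p x y => triple p x y ∊ R) p x y)
  /\ triple p x y ∊ R.
#[local] Instance DefP3_sim s t : DefP3 (sim s t).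
Proof. by unfold sim, step; def. Qed.

Lemma step_mono s t (R R' : S -> S -> S -> Prop) p x y :
  (forall q u v, su_elt s u x -> su_elt t v y -> finj s t q -> R q u v -> R' q u v) ->
  step s t R p x y -> step s t R' p x y.
Proof.
move=> h [h1 [h2 [h3 [h4|[h5 [h6 [h7 [h8 [h9 h10]]]]]]]]]; do 3! split=> //; first by left.
right; do 4! split=> //; split=> [u ux|v vy].
  have [q [hq [pq [v [vy r]]]]] := h9 u ux.
  by exists q; split=> //; split=> //; exists v; split=> //; apply: h.
have [q [hq [pq [u [ux r]]]]] := h10 v vy.
by exists q; split=> //; split=> //; exists u; split=> //; apply: h.
Qed.

(** For the converse a set R is needed. It collects the triples that satisfy the clause and whose
    entries lie in sets around x and y closed under members, as given by [su_closed]. *)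
Lemma simE s t p x y : sim s t p x y <-> step s t (sim s t) p x y.
Proof.
split=> [[R [hR h]]|h].
  by apply: step_mono (hR _ _ _ h) => q u v _ _ _ r; exists R.
have [hp [dx [dy _]]] := h.
have [t1 [xt1 ct1]] := su_closed dx; have [t2 [yt2 ct2]] := su_closed dy.
pose P z := exists q, finj s t q /\ exists u, u ∊ t1 /\ exists v, v ∊ t2 /\
  z = triple q u v /\ step s t (sim s t) q u v.
have dst : DefP3 (step s t (sim s t)) by unfold step; def.
have sP : small P.
  apply: small_bigU; [exact: small_finj|move=> q _].
  apply: small_bigU; [exact: small_elt|move=> u _].
  apply: small_bigU; [exact: small_elt|move=> v _].
  by apply: small_uniq => z z' [-> _] [-> _].
have inP q u v : triple q u v ∊ setof P <->
    finj s t q /\ u ∊ t1 /\ v ∊ t2 /\ step s t (sim s t) q u v.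
  rewrite (setofP sP); split=> [[q' [hq [u' [hu [v' [hv [/triple_inj[-> [-> ->]] k]]]]]]]|].
    by [].
  move=> [hq [hu [hv k]]]; exists q; split=> //; exists u; split=> //.
  by exists v.
exists (setof P); split; last by apply/inP.
move=> q u v /inP[hq [hu [hv]]]; apply: step_mono => q' u' v' eu ev hq' [R [hR k]].
apply/inP; split=> //; split; first exact: ct1 eu.
split; first exact: ct2 ev.
by apply: step_mono (hR _ _ _ k) => *; exists R.
Qed.

Lemma sim_swap s t p x y : sim s t p x y -> sim t s (inv p) y x.
Proof.
move=> h; have [_ [dx _]] := (simE _ _ _ _ _).1 h.
move: x dx p y h; apply: su_ind.
move=> x dx IH p y /simE[hp [_ [dy h]]]; apply/simE.
split; first exact: finj_inv.
do 2! split=> //.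
case: h => [[xa [ya h]]|[nx [ny [sx [sy [zig zag]]]]]]; first by left; rewrite in_inv.
right; do 3! split=> //; split; first by rewrite (finj_invK hp).
split=> [v /zag|u ux].
  move=> [q [hq [pq [u [ux k]]]]]; exists (inv q); split; first exact: finj_inv.
  by split; [apply: sub_inv|exists u; split=> //; apply: IH].
have [q [hq [pq [v [vy k]]]]] := zig u ux; exists (inv q); split; first exact: finj_inv.
by split; [apply: sub_inv|exists v; split=> //; apply: IH].
Qed.

(** ** Moving a finite partial injection *)

(** The pairs of the composite p ∘ g⁻¹. *)
Definition moved s g p z := exists w, w ∊ p /\ exists a b, w = pr a b /\ z = pr (su_act s g a) b.

Definition move s g p := setof (moved s g p).

Lemma small_moved s g p : small (moved s g p).
Proof.
apply: small_bigU; [exact: small_elt|move=> w _].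
by apply: small_uniq => z z' [a [b [-> ->]]] [a' [b' [/pr_inj[-> ->] ->]]].
Qed.

Lemma in_move s g p x b : pr x b ∊ move s g p <-> exists a, pr a b ∊ p /\ x = su_act s g a.
Proof.
rewrite (setofP (small_moved s g p)).
split=> [[w [wp [a [b' [e /pr_inj[-> ->]]]]]]|[a [h ->]]]; first by exists a; rewrite -e.
by exists (pr a b); split=> //; exists a, b.
Qed.

Lemma su_act_inj s g x y : su_perm s g -> su_dom s x -> su_dom s y ->
  su_act s g x = su_act s g y -> x = y.
Proof.
move=> hg dx dy e; have [h [_ hh]] := su_inv hg.
by have [<- _] := hh x dx; have [<- _] := hh y dy; rewrite e.
Qed.

Lemma finj_move s t g p : su_perm s g -> finj s t p -> finj s t (move s g p).
Proof.
move=> hg hp; have [fp [h1 [h2 h3]]] := hp.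
have hd a b : pr a b ∊ p -> su_dom s a.
  by move=> /(finj_atoms hp)[ha _]; apply: su_atoms_dom.
split; [|split; [|split]].
- apply: (@Fin_rel (fun z w => exists a b, z = pr a b /\ w = pr (su_act s g a) b) p) => //.
  + exact/isset_setof/small_moved.
  + by move=> z w w' [a [b [-> ->]]] [a' [b' [/pr_inj[-> ->] ->]]].
  + by move=> w /(setofP (small_moved s g p)).
- move=> z /(setofP (small_moved s g p))[w [wp [a [b [e ->]]]]]; subst w.
  have [ha hb] := finj_atoms hp wp; exists (su_act s g a); split; last by exists b.
  by apply/su_act_atoms => //; apply: hd wp.
- move=> x b b' /in_move[a [ab ->]] /in_move[a' [ab' e]].
  have ea := su_act_inj hg (hd _ _ ab) (hd _ _ ab') e; subst a'.
  exact: h2 ab ab'.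
- move=> x x' b /in_move[a [ab ->]] /in_move[a' [ab' ->]].
  by rewrite (h3 _ _ _ ab ab').
Qed.

Lemma sub_move s g p q : sub p q -> sub (move s g p) (move s g q).
Proof.
move=> h z /(setofP (small_moved s g p))[w [/h wq k]].
by apply/(setofP (small_moved s g q)); exists w.
Qed.

Lemma move_fix s t g p q : finj s t p -> sub p q ->
  (forall a b, pr a b ∊ p -> su_act s g a = a) -> sub p (move s g q).
Proof.
move=> hp pq h z zp; have [_ [h1 _]] := hp.
have [a [_ [b [_ e]]]] := h1 z zp; subst z; apply/in_move; exists a.
by rewrite (h _ _ zp); split=> //; apply: pq.
Qed.

Lemma sim_move s t p x y g : su_perm s g -> sim s t p x y ->
  sim s t (move s g p) (su_act s g x) y.
Proof.
move=> hg h; have [_ [dx _]] := (simE _ _ _ _ _).1 h.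
move: x dx p y h; apply: su_ind; first by unfold move, moved; def.
move=> x dx IH p y /simE[hp [_ [dy h]]]; apply/simE.
split; first exact: finj_move.
split; first exact: su_act_dom.
split=> //; case: h => [[xa [ya h]]|[nx [ny [sx [sy [zig zag]]]]]].
  left; split; first exact/su_act_atoms.
  by split=> //; apply/in_move; exists x.
right; split; first by rewrite su_act_atoms.
have [h [hh hK]] := su_inv hg.
split=> //; split; [|split; [|split]].
(* If k fixes the moved domain, the conjugate g⁻¹kg fixes the domain of p, hence x; so k fixes
   g(x). *)
- move=> k hk fk; have [m [hm em]] := su_mul hh hk; have [m' [hm' em']] := su_mul hm hg.
  have e z : su_dom s z -> su_act s m' z = su_act s h (su_act s k (su_act s g z)).
    by move=> dz; rewrite em' // em //; apply: su_act_dom.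
  have fx : su_act s m' x = x.
    apply: sx => // a b ab; have da : su_dom s a.
      by have [ha _] := finj_atoms hp ab; apply: su_atoms_dom.
    rewrite e // (fk _ b); last by apply/in_move; exists a.
    by have [] := hK a da.
  have dk : su_dom s (su_act s k (su_act s g x)) by do 2! apply: su_act_dom => //.
  by have [_ <-] := hK _ dk; rewrite -e // fx.
- move=> k hk fk; apply: sy => // b a; rewrite in_inv => ab.
  by apply: (fk b (su_act s g a)); rewrite in_inv in_move; exists a.
- move=> u' hu'; have dgx := su_act_dom hg dx.
  have du' : su_dom s u' by apply: su_dom_elt hu'.
  have := su_act_elt hh dgx hu'; have [-> _] := hK x dx => ux.
  have [q [hq [pq [v [vy k]]]]] := zig _ ux.
  exists (move s g q); split; first exact: finj_move.
  split; first exact: sub_move.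
  exists v; split=> //; have := IH _ ux _ _ k; by have [_ ->] := hK u' du'.
- move=> v vy; have [q [hq [pq [u [ux k]]]]] := zag _ vy.
  exists (move s g q); split; first exact: finj_move.
  split; first exact: sub_move.
  by exists (su_act s g u); split; [apply: su_act_elt|apply: IH].
Qed.

(** ** Amalgamation of finite partial injections *)

Lemma fresh_atom s a : Fin a -> exists c, c ∊ su_atoms s /\ ~ c ∊ a.
Proof.
move=> fa; apply: contrapT => n; apply: (@su_infinite _ s).
apply: (Fin_sub fa); split=> [|z hz]; first exact: su_atoms_set.
by apply: contrapT => k; apply: n; exists z.
Qed.

Definition domain p := setof (fun x => exists b, pr x b ∊ p).
Definition range p := domain (inv p).

Lemma small_domain p : small (fun x => exists b, pr x b ∊ p).
Proof. by apply: (small_sub _ (small_field p)) => x [b h]; exists b; left. Qed.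

Lemma in_domain p x : x ∊ domain p <-> exists b, pr x b ∊ p.
Proof. by rewrite (setofP (small_domain p)). Qed.

Lemma in_range p x : x ∊ range p <-> exists a, pr a x ∊ p.
Proof. by rewrite in_domain; apply: iff_ex => a; rewrite in_inv. Qed.

Lemma Fin_domain p : Fin p -> Fin (domain p).
Proof.
move=> fp; apply: (@Fin_rel (fun z w => exists b, z = pr w b) p) => //.
- exact/isset_setof/small_domain.
- by move=> z w w' [b ->] [b' /pr_inj[]].
- by move=> w /in_domain[b h]; exists (pr w b); split=> //; exists b.
Qed.

Lemma Fin_range s t p : finj s t p -> Fin (range p).
Proof. by move=> /finj_inv[/Fin_domain]. Qed.

Lemma finj_add s t p c d : finj s t p -> c ∊ su_atoms s -> d ∊ su_atoms t ->
  ~ c ∊ domain p -> ~ d ∊ range p -> finj s t (cup p (sing (pr c d))).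
Proof.
move=> [fp [h1 [h2 h3]]] hc hd nc nd.
have inp a b : pr a b ∊ cup p (sing (pr c d)) <-> pr a b ∊ p \/ a = c /\ b = d.
  exact: in_add_pr.
split; [exact: Fin_add|split; [|split]].
- move=> z; rewrite in_cup in_sing => -[/h1 //|->].
  by exists c; split=> //; exists d.
- move=> a b b'; rewrite !inp => -[k|[ea ->]] [k'|[ea' ->]] //; first exact: h2 k k'.
    by case: nc; apply/in_domain; exists b; rewrite -ea'.
  by case: nc; apply/in_domain; exists b'; rewrite -ea.
- move=> a a' b; rewrite !inp => -[k|[-> eb]] [k'|[-> eb']] //; first exact: h3 k k'.
    by case: nd; apply/in_range; exists a; rewrite -eb'.
  by case: nd; apply/in_range; exists a'; rewrite -eb.
Qed.

Lemma finj0 s t : finj s t sempty.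
Proof.
split; first exact: Fin0.
by split=> [z /in_empty //|]; split=> a b b' /in_empty.
Qed.

(* Extends [p] to the finite set [a] with new values outside the finite set [c]. *)
Lemma finj_extend s t p a c : finj s t p -> Fin c -> Fin a ->
  (forall x, x ∊ a -> x ∊ su_atoms s) ->
  exists q, finj s t q /\ sub p q /\ (forall x, x ∊ a -> x ∊ domain q) /\
    forall x y, pr x y ∊ q -> pr x y ∊ p \/ x ∊ a /\ ~ y ∊ c.
Proof.
move=> hp fc fa; move: a fa; apply: Fin_ind.
  by unfold domain; def.
  move=> _; exists p; split=> //; split=> //; split=> [x /in_empty //|x y h]; by left.
move=> a x _ IH h; have [|q [hq [pq [aq nq]]]] := IH.
  by move=> y ya; apply: h; rewrite in_cup; left.
have xs : x ∊ su_atoms s by apply: h; rewrite in_cup in_sing; right.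
have [xq|xq] := pselect (x ∊ domain q).
  exists q; split=> //; split=> //; split=> [y|y z /nq[|[ya zc]]]; [|by left|].
    by rewrite in_cup in_sing => -[/aq //|->].
  by right; rewrite in_cup; split=> //; left.
have [fq _] := hq.
have fG : Fin (cup (range q) c) by apply: Fin_cup => //; apply: Fin_range hq.
have [d [hd nd]] := fresh_atom t fG.
have ndq : ~ d ∊ range q by move=> k; apply: nd; rewrite in_cup; left.
exists (cup q (sing (pr x d))); split; first exact: finj_add.
split; first by move=> z /pq zq; rewrite in_cup; left.
split=> [y|y z]; rewrite in_cup in_sing.
  move=> [/aq/in_domain[b yb]|->]; apply/in_domain; first by exists b; rewrite in_cup; left.
  by exists d; rewrite in_cup in_sing; right.
move=> [/nq[|[ya zc]]|/pr_inj[-> ->]]; first by left.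
  by right; rewrite in_cup; split=> //; left.
right; rewrite in_cup in_sing; split; first by right.
by move=> dc; apply: nd; rewrite in_cup; right.
Qed.

(* First step of amalgamation: the new part of the domain of [q'] is moved off
   the domain of [q]. *)
Lemma separate s t p q q' : finj s t p -> finj s t q -> finj s t q' -> sub p q' ->
  exists g, su_perm s g /\ (forall a b, pr a b ∊ p -> su_act s g a = a) /\
    forall x, x ∊ domain q -> x ∊ domain (move s g q') -> x ∊ domain p.
Proof.
move=> hp hq hq' pq'; have [fq _] := hq; have [fq' [_ [q'f q'i]]] := hq'.
have fF : Fin (cup (domain q) (domain q')) by apply: Fin_cup; apply: Fin_domain.
pose P x := x ∊ domain q' /\ ~ x ∊ domain p.
have sP : small P by apply: small_sep; unfold domain; def.
have inE x : x ∊ setof P <-> P x by rewrite (setofP sP).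
have fE : Fin (setof P).
  apply: (Fin_sub (Fin_domain fq')); split; first exact: isset_setof.
  by move=> z /inE[].
have [|f [hf [_ [fE1 fE2]]]] := finj_extend (finj0 s s) fF fE.
  by move=> x /inE[/in_domain[b /(finj_atoms hq')[]]].
have {}fE2 x y : pr x y ∊ f -> P x /\ ~ y ∊ cup (domain q) (domain q').
  by move=> /fE2[/in_empty //|[/inE]].
have [_ [_ [ff fi]]] := hf.
have [||||g [hg [g1 g2]]] := @su_involution _ s f.
- by move=> a b /(finj_atoms hf).
- exact: ff.
- exact: fi.
- move=> a b c /fE2[_ nb] /fE2[[bq _] _]; apply: nb; rewrite in_cup; by right.
exists g; split=> //.
have gp a b : pr a b ∊ p -> su_act s g a = a.
  move=> ab; apply: g2; first by have [] := finj_atoms hp ab.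
    by move=> c /fE2[[_ n] _]; apply: n; apply/in_domain; exists b.
  by move=> c /fE2[_ n]; apply: n; rewrite in_cup; right; apply/in_domain; exists b; apply: pq'.
split=> // x xq /in_domain[b /in_move[a [ab e]]].
have [/in_domain[b' h]|n] := pselect (a ∊ domain p).
  by apply/in_domain; exists b'; rewrite e (gp a b').
have /fE1/in_domain[y ay] : a ∊ setof P by apply/inE; split=> //; apply/in_domain; exists b.
have [_ ny] := fE2 _ _ ay; case: ny; rewrite in_cup; left.
by rewrite -(g1 a y ay) -e.
Qed.

(** After [separate], q and the moved injection q1 share arguments only in the domain of p, where
    they agree. The remaining conflicts are equal values at different arguments c of q1 and d of q;
    a second permutation removes them by exchanging c and d. *)
Lemma amalgamate s t p q q' : finj s t p -> finj s t q -> finj s t q' ->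
  sub p q -> sub p q' ->
  exists g, su_perm s g /\ (forall a b, pr a b ∊ p -> su_act s g a = a) /\
    exists r, finj s t r /\ sub q r /\ sub (move s g q') r.
Proof.
move=> hp hq hq' pq pq'.
have [g1 [hg1 [fix1 sep]]] := separate hp hq hq' pq'.
pose q1 := move s g1 q'; have hq1 : finj s t q1 := finj_move hg1 hq'.
have pq1 : sub p q1 := move_fix hp pq' fix1.
have {}sep x : x ∊ domain q -> x ∊ domain q1 -> x ∊ domain p := sep x.
have [fq [_ [qf qi]]] := hq; have [fq1 [_ [q1f q1i]]] := hq1.
pose P z := exists c, c ∊ domain q1 /\ exists d, d ∊ domain q /\ z = pr c d /\
  ~ c ∊ domain p /\ exists b, pr c b ∊ q1 /\ pr d b ∊ q.
have sP : small P.
  pose proof (small_prod (small_elt (domain q1)) (small_elt (domain q))) as h.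
  apply: (small_sub _ h); first by unfold P, domain; def.
  by move=> z [c [hc [d [hd [-> _]]]]]; exists c; split=> //; exists d.
have inf c d : pr c d ∊ setof P <-> ~ c ∊ domain p /\ exists b, pr c b ∊ q1 /\ pr d b ∊ q.
  rewrite (setofP sP); split=> [[c' [_ [d' [_ [/pr_inj[-> ->] h]]]]] //|[n [b [h1 h2]]]].
  exists c; split; first by apply/in_domain; exists b.
  by exists d; split; [apply/in_domain; exists b|split=> //; split=> //; exists b].
have [||||g2 [hg2 [g2f g2x]]] := @su_involution _ s (setof P).
- by move=> a b /inf[_ [e [/(finj_atoms hq1)[? _] /(finj_atoms hq)[? _]]]].
- move=> a b b' /inf[_ [e [h1 h2]]] /inf[_ [e' [h1' h2']]].
  by move: h2'; rewrite -(q1f _ _ _ h1 h1'); apply: qi.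
- move=> a a' b /inf[_ [e [h1 h2]]] /inf[_ [e' [h1' h2']]].
  by move: h1'; rewrite -(qf _ _ _ h2 h2'); apply: q1i.
- move=> a b c /inf[_ [e [_ h]]] /inf[n [e' [h' _]]]; apply: n.
  by apply: sep; apply/in_domain; [exists e|exists e'].
have fix2 a b : pr a b ∊ p -> su_act s g2 a = a.
  move=> ab; apply: g2x; first by have [] := finj_atoms hp ab.
    by move=> d /inf[n _]; apply: n; apply/in_domain; exists b.
  move=> c /inf[n [e [h1 h2]]]; apply: n; apply/in_domain; exists b.
  have ee := qf _ _ _ h2 (pq _ ab); subst e.
  by rewrite (q1i _ _ _ h1 (pq1 _ ab)).
have [g [hg eg]] := su_mul hg2 hg1.
exists g; split=> //; split=> [a b ab|].
  rewrite eg; last by have [ha _] := finj_atoms hp ab; apply: su_atoms_dom.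
  by rewrite (fix1 _ _ ab) (fix2 _ _ ab).
pose q2 := move s g2 q1; have hq2 : finj s t q2 := finj_move hg2 hq1.
have [fq2 [q2a [q2f q2i]]] := hq2; have [_ [qa _]] := hq.
(* Each pair of q2 either belongs to q or has both ends off q, so the union of q and q2 is an
   injection. *)
have key x b : pr x b ∊ q2 -> pr x b ∊ q \/ (~ x ∊ domain q /\ ~ b ∊ range q).
  move=> /in_move[c [cb ->]].
  have [/in_domain[b' h]|n] := pselect (c ∊ domain p).
    by rewrite (fix2 _ _ h) (q1f _ _ _ cb (pq1 _ h)); left; apply: pq.
  have [/in_range[d h]|n'] := pselect (b ∊ range q).
    by left; rewrite (g2f c d) //; apply/inf; split=> //; exists b.
  right; split=> //; rewrite g2x.
  - by move=> h; apply: n; apply: sep => //; apply/in_domain; exists b.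
  - by have [] := finj_atoms hq1 cb.
  - move=> d /inf[_ [e [h1 h2]]]; apply: n'; apply/in_range; exists d.
    by rewrite (q1f _ _ _ cb h1).
  - move=> d /inf[_ [e [_ h2]]]; apply: n; apply: sep; apply/in_domain; first by exists e.
    by exists b.
exists (cup q q2); split; [split; [|split; [|split]]|split].
- exact: Fin_cup.
- by move=> z; rewrite in_cup => -[/qa|/q2a].
- move=> a b b'; rewrite !in_cup => -[h|h] [h'|h'].
  + exact: qf h h'.
  + by case: (key _ _ h') => [/(qf _ _ _ h)|[n _]] //; case: n; apply/in_domain; exists b.
  + by case: (key _ _ h) => [/qf/(_ h')|[n _]] //; case: n; apply/in_domain; exists b'.
  + exact: q2f h h'.
- move=> a a' b; rewrite !in_cup => -[h|h] [h'|h'].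
  + exact: qi h h'.
  + by case: (key _ _ h') => [/(qi _ _ _ h)|[_ n]] //; case: n; apply/in_range; exists a.
  + by case: (key _ _ h) => [/qi/(_ h')|[_ n]] //; case: n; apply/in_range; exists a'.
  + exact: q2i h h'.
- by move=> z; rewrite in_cup; left.
- move=> z /(setofP (small_moved s g q'))[w [wq [a [b [ew ->]]]]]; subst w.
  rewrite in_cup; right; apply/in_move; exists (su_act s g1 a); split.
    by apply/in_move; exists a.
  by rewrite eg //; have [ha _] := finj_atoms hq' wq; apply: su_atoms_dom.
Qed.

(* The left hand side of a pair may be moved so as to match a given extension. *)
Lemma sim_amalgamate s t p q q' u v : finj s t p -> finj s t q -> finj s t q' ->
  sub p q -> sub p q' -> sim s t q' u v ->
  exists g, su_perm s g /\ (forall a b, pr a b ∊ p -> su_act s g a = a) /\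
    exists q1 r, finj s t r /\ sub q r /\ sub q1 r /\ sim s t q1 (su_act s g u) v.
Proof.
move=> hp hq hq' pq pq' h.
have [g [hg [fg [r [hr [qr q'r]]]]]] := amalgamate hp hq hq' pq pq'.
exists g; split=> //; split=> //; exists (move s g q'), r.
by do 3! split=> //; apply: sim_move.
Qed.

Lemma su_act_fix_elt s g u x : su_perm s g -> su_dom s x -> su_act s g x = x ->
  su_elt s u x -> su_elt s (su_act s g u) x.
Proof. by move=> hg dx e ux; rewrite -e; apply: su_act_elt. Qed.

(** * Monotonicity and injectivity of the correspondence *)

(** A partner found under an extension p' of p is made compatible with q by a permutation fixing the
    relevant side of p. The support conditions keep it a member, and the induction hypothesis passes
    to a common extension. *)
Lemma simW s t p q x y : sim s t p x y -> finj s t q -> sub p q -> sim s t q x y.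
Proof.
move=> h; have [_ [dx _]] := (simE _ _ _ _ _).1 h.
move: x dx p y h q; apply: su_ind.
move=> x dx IH p y /simE[hp [_ [dy h]]] q hq pq; apply/simE; do 3! split=> //.
case: h => [[xa [ya h]]|[nx [ny [sx [sy [zig zag]]]]]]; first by left; split=> //; split=> //; apply: pq.
right; do 2! split=> //; split; first exact: supW sx.
split; first by apply: supW sy; apply: sub_inv.
split=> [u ux|v vy].
  have [p' [hp' [pp' [v [vy k]]]]] := zig u ux.
  (* Amalgamation moves the left argument; here v has to move and u to stay, so it is applied to the
     inverses. *)
  have [g [hg [fg [q1 [r [hr [qr [q1r k']]]]]]]] := sim_amalgamate (finj_inv hp) (finj_inv hq)
    (finj_inv hp') (sub_inv pq) (sub_inv pp') (sim_swap k).
  exists (inv r); split; first exact: finj_inv.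
  split; first by rewrite -(finj_invK hq); apply: sub_inv.
  exists (su_act t g v); split; first by apply: su_act_fix_elt => //; apply: sy.
  apply: (IH u ux _ _ (sim_swap k')); first exact: finj_inv.
  exact: sub_inv.
have [p' [hp' [pp' [u [ux k]]]]] := zag v vy.
have [g [hg [fg [q1 [r [hr [qr [q1r k']]]]]]]] := sim_amalgamate hp hq hp' pq pp' k.
exists r; split=> //; split=> //; exists (su_act s g u).
have gux : su_elt s (su_act s g u) x by apply: su_act_fix_elt => //; apply: sx.
by split=> //; apply: IH k' _ hr q1r.
Qed.

(** A member u of x is matched with some v in y, and v with some u' in x'. A permutation fixing the
    domain of p keeps u' in x' and brings both matchings under one injection, so u is the moved u'
    by induction. The other inclusion is alike. *)
Lemma sim_injl s t p x x' y : sim s t p x y -> sim s t p x' y -> x = x'.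
Proof.
move=> h; have [_ [dx _]] := (simE _ _ _ _ _).1 h.
move: x dx p y x' h; apply: su_ind.
move=> x dx IH p y x' /simE[hp [_ [dy h]]] /simE[_ [dx' [_ h']]].
case: h => [[xa [ya h]]|[nx [ny [sx [sy [zig zag]]]]]].
  case: h' => [[_ [_ h']]|[_ [/(_ ya) []]]].
  by have [_ [_ [_ hi]]] := hp; apply: hi h h'.
case: h' => [[_ [/ny []]]|[nx' [_ [sx' [_ [zig' zag']]]]]].
apply: (@su_ext _ s) => // u; split=> [ux|ux'].
  have [q [hq [pq [v [vy k]]]]] := zig u ux.
  have [q' [hq' [pq' [u' [ux' k']]]]] := zag' v vy.
  have [g [hg [fg [q1 [r [hr [qr [q1r k1]]]]]]]] := sim_amalgamate hp hq hq' pq pq' k'.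
  rewrite (IH u ux r v (su_act s g u')); first by apply: su_act_fix_elt => //; apply: sx'.
    exact: simW k hr qr.
  exact: simW k1 hr q1r.
have [q [hq [pq [v [vy k]]]]] := zig' u ux'.
have [q' [hq' [pq' [u' [ux k']]]]] := zag v vy.
have [g [hg [fg [q1 [r [hr [qr [q1r k1]]]]]]]] := sim_amalgamate hp hq hq' pq pq' k'.
have gx : su_elt s (su_act s g u') x by apply: su_act_fix_elt => //; apply: sx.
rewrite -(IH _ gx r v u) //; first exact: simW k1 hr q1r.
exact: simW k hr qr.
Qed.

Lemma sim_injr s t p x y y' : sim s t p x y -> sim s t p x y' -> y = y'.
Proof. by move=> /sim_swap h /sim_swap; apply: sim_injl h. Qed.

Lemma sim_atoms s t p x y : sim s t p x y -> x ∊ su_atoms s <-> y ∊ su_atoms t.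
Proof. by move=> /simE[_ [_ [_ [[h [h' _]]|[h [h' _]]]]]]; split. Qed.

(** The back-and-forth clause gives u a partner in y under an extension of p; by [simW] and
    [sim_injr] this partner is v. *)
Lemma sim_elt1 s t p x y u v : sim s t p x y -> sim s t p u v ->
  su_elt s u x -> su_elt t v y.
Proof.
move=> /simE[hp [dx [dy h]]] huv ux.
case: h => [[xa _]|[nx [ny [sx [sy [zig zag]]]]]]; first by case: (su_atoms_empty xa ux).
have [q [hq [pq [v' [vy k]]]]] := zig u ux.
by rewrite (sim_injr (simW huv hq pq) k).
Qed.

Lemma sim_elt s t p x y u v : sim s t p x y -> sim s t p u v ->
  su_elt s u x <-> su_elt t v y.
Proof.
move=> h h'; split; first exact: sim_elt1 h h'.
exact: sim_elt1 (sim_swap h) (sim_swap h').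
Qed.

(** * Existence of corresponding elements *)

(** An atom needs a value under p in order to have a partner, whereas a set needs a support. *)
Definition covers s p x := (x ∊ su_atoms s -> x ∊ domain p) /\ (~ x ∊ su_atoms s -> sup s p x).

Lemma exists_cover s t p x : finj s t p -> su_dom s x ->
  exists q, finj s t q /\ sub p q /\ covers s q x.
Proof.
move=> hp dx; have [xa|xa] := pselect (x ∊ su_atoms s).
  have [|q [hq [pq [hx _]]]] := finj_extend hp Fin0 (@Fin_sing _ _ x); first by move=> z /in_sing ->.
  by exists q; do 3! split=> //; move=> _; apply: hx; rewrite in_sing.
have [a [fa [aA sa]]] := su_supp dx.
have [q [hq [pq [hx _]]]] := finj_extend hp Fin0 fa aA.
exists q; do 3! split=> //; move=> _ g hg fg; apply: sa => // c /hx/in_domain[b cb].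
exact: fg cb.
Qed.

(** The partner of a set x consists of all v matched with a member of x under some extension of p.
    These form a set since [sim_injr] allows at most one v for each u and q, and the range of p
    supports it by [sim_move] on the other side. *)
Lemma sim_exists s t p x : finj s t p -> su_dom s x -> covers s p x ->
  exists y, sim s t p x y.
Proof.
move=> hp dx; move: x dx p hp; apply: su_ind.
  by unfold covers, domain; def.
move=> x dx IH p hp [cx1 cx2].
have [xa|xa] := pselect (x ∊ su_atoms s).
  have [y xy] := (in_domain _ _).1 (cx1 xa); exists y; apply/simE.
  have [_ ya] := finj_atoms hp xy.
  by do 2! split=> //; split; [apply: su_atoms_dom|left].
have sx := cx2 xa; have [c [xc cc]] := su_closed dx.
pose P v := exists u, (u ∊ c /\ su_elt s u x) /\
  exists q, finj s t q /\ sub p q /\ sim s t q u v.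
have sP : small P.
  apply: small_bigU; [by apply: small_sep; def|move=> u [_ ux]].
  apply: (eq_small (P := fun v => exists q, finj s t q /\ (sub p q /\ sim s t q u v))) => //.
  apply: small_bigU; [exact: small_finj|move=> q hq].
  by apply: small_uniq => v v' [_ h] [_ h']; apply: sim_injr h h'.
have [fp [_ [pf pi]]] := hp.
have [|||y [dy [ny [ey sy]]]] := @su_comprehension _ t P (range p) sP _ (Fin_range hp).
- by move=> v [u [_ [q [_ [_ /simE[_ [_ []]]]]]]].
- by move=> b /in_range[a /(finj_atoms hp)[]].
- move=> g hg fg v [u [hu [q [hq [pq k]]]]]; exists u; split=> //.
  have k' := sim_swap (sim_move hg (sim_swap k)).
  exists (inv (move t g (inv q))); split; first by apply/finj_inv/finj_move/finj_inv.
  split=> //; rewrite -(finj_invK hp); apply: sub_inv.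
  apply: (move_fix (finj_inv hp)); first exact: sub_inv.
  by move=> b a; rewrite in_inv => ab; apply: fg; apply/in_range; exists a.
exists y; apply/simE; do 3! split=> //; right; do 3! split=> //; split; [|split].
- move=> g hg fg; apply: sy => // b /in_range[a ab].
  by apply: (fg b a); rewrite in_inv.
- move=> u ux; have du := su_dom_elt dx ux.
  have [q [hq [pq cq]]] := exists_cover hp du.
  have [v k] := IH u ux q hq cq; exists q; split=> //; split=> //; exists v.
  split=> //; apply/ey; exists u; split; last by exists q.
  by split=> //; apply: cc ux.
- move=> v /ey[u [[_ ux] [q [hq [pq k]]]]].
  by exists q; split=> //; split=> //; exists u.
Qed.

Lemma sim_forth s t p x : finj s t p -> su_dom s x ->
  exists q, finj s t q /\ sub p q /\ exists y, sim s t q x y.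
Proof.
move=> hp dx; have [q [hq [pq cq]]] := exists_cover hp dx.
by exists q; split=> //; split=> //; apply: sim_exists.
Qed.

Lemma sim_back s t p y : finj s t p -> su_dom t y ->
  exists q, finj s t q /\ sub p q /\ exists x, sim s t q x y.
Proof.
move=> hp dy; have [q [hq [pq [x h]]]] := sim_forth (finj_inv hp) dy.
exists (inv q); split; first exact: finj_inv.
split; first by rewrite -(finj_invK hp); apply: sub_inv.
by exists x; apply: sim_swap.
Qed.

(** * Elementary equivalence of symmetric universes *)

Lemma su_inhabited s : {x | su_dom s x}.
Proof.
by apply: cid; have [c [hc _]] := fresh_atom s Fin0; exists c; apply: su_atoms_dom.
Qed.

Definition su_str s : structure :=
  @Structure {x | su_dom s x} (fun x y : {x | su_dom s x} => su_elt s (sval x) (sval y))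
    (fun x : {x | su_dom s x} => sval x ∊ su_atoms s) (su_inhabited s).

(** One injection p matches the values of all free variables at once; at a quantifier it is
    extended, and [simW] preserves the earlier matches. *)
Lemma su_sat_sim s t φ n p (ρ : nat -> su_str s) (σ : nat -> su_str t) :
  bounded n φ -> finj s t p -> (forall i, i < n -> sim s t p (sval (ρ i)) (sval (σ i))) ->
  sat ρ φ <-> sat σ φ.
Proof.
have val_inj (w : symuniv S) (x y : su_str w) : sval x = sval y -> x = y.
  by case: x y => [x hx] [y hy] /= e; apply: eq_exist.
elim: φ n p ρ σ => /= [i j|i|i j||φ H1 ψ H2|φ H1 ψ H2|φ H1 ψ H2|φ H|φ H] n p ρ σ.
- by move=> /andP[hi hj] _ h; apply: sim_elt; apply: h.
- by move=> hi _ h; apply: sim_atoms; apply: h.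
- move=> /andP[hi hj] _ h; split=> e; apply: val_inj.
    by apply: sim_injr (h i hi) _; rewrite e; apply: h.
  by apply: sim_injl (h i hi) _; rewrite e; apply: h.
- by [].
1,2,3: by move=> /andP[h1 h2] hp h; rewrite (H1 n p ρ σ) // (H2 n p ρ σ).
all: move=> hb hp h.
all: have e q (x : su_str s) (y : su_str t) : finj s t q -> sub p q ->
    sim s t q (sval x) (sval y) -> sat (scons x ρ) φ <-> sat (scons y σ) φ
  by move=> hq pq k; apply: (H n.+1 q) => // -[|i] //= hi; apply: simW hq pq; apply: h.
all: have forth (x : su_str s) : exists q (y : su_str t),
    finj s t q /\ sub p q /\ sim s t q (sval x) (sval y).
  1,3: have [q [hq [pq [y k]]]] := sim_forth hp (proj2_sig x).
  1,2: by have [_ [_ [dy _]]] := (simE _ _ _ _ _).1 k; exists q, (exist _ y dy).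
all: have back (y : su_str t) : exists q (x : su_str s),
    finj s t q /\ sub p q /\ sim s t q (sval x) (sval y).
  1,3: have [q [hq [pq [x k]]]] := sim_back hp (proj2_sig y).
  1,2: by have [_ [dx _]] := (simE _ _ _ _ _).1 k; exists q, (exist _ x dx).
- split=> k z.
    by have [q [x [hq [pq r]]]] := back z; apply/(e q x z hq pq r).
  by have [q [y [hq [pq r]]]] := forth z; apply/(e q z y hq pq r).
split=> -[z k].
  by have [q [y [hq [pq r]]]] := forth z; exists y; apply/(e q z y hq pq r).
by have [q [x [hq [pq r]]]] := back z; exists x; apply/(e q x z hq pq r).
Qed.

Lemma su_elementary s t φ (ρ : nat -> su_str s) (σ : nat -> su_str t) :
  sentence φ -> sat ρ φ <-> sat σ φ.
Proof. by move=> hφ; apply: (su_sat_sim hφ (finj0 s t)). Qed.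

End BackForth.

(** * The two permutation models *)

Section TwoModels.
Context {S : structure} {zf : ZF S}.

Lemma embedding_id : embedding (@id S).
Proof.
split.
- by [].
- by move=> R hR; exists R.
- by apply: Def_ext (Def_const True) => ρ; split=> // _; exists (ρ 0).
- move=> k; apply: eq_small (small_elt k) => t; split=> [h|[u [-> //]]].
  by exists t.
- by move=> P [k [sk hk]] _; exists k.
- by move=> P hP h k; move: k; apply: eps_ind.
- by exists pr; split=> //; def.
Qed.

Lemma embedding_Vstr : embedding (sval : Vstr omega -> S).
Proof.
split.
- exact: sval_inj.
- exact: DefP3_transfer.
- apply: Def_ext (DefP1_V (omega : S)) => ρ.
  by split=> [/V_sval //|[u ->]]; apply: Vsv.
- move=> k; apply: eq_small (small_ext k) => t.
  by rewrite -in_ext /ext (setofP (small_ext k)).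
- by move=> P sP hP; apply: Vsmall => // t /hP[u ->]; apply: Vsv.
- by move=> P hP h k; apply: Vstr_ind.
- by exists vpr; split; [exact: DefF2_vpr|exact: sval_pr].
Qed.

(** Otherwise ⟨n, 1⟩ ↦ n would carry a finite set onto ω. *)
Lemma Vstr_atoms_infinite :
  ~ Fin (setof (fun t : S => exists u : Vstr omega, t = sval u /\ atm u)).
Proof.
move=> h; apply: (@Fin_omega S zf).
apply: (@Fin_rel S zf (fun t n => t = tag1 n) _ _ _ h).
- exact: isset_omega.
- by move=> t n n' -> /tag1_inj.
move=> n hn; exists (tag1 n); split=> //.
have sP : small (fun t : S => exists u : Vstr omega, t = sval u /\ atm u).
  apply: (eq_small (P := fun t => exists n, n ∊ omega /\ t = tag1 n)).
    move=> t; split=> [[m [hm ->]]|[u [-> /sval_atmP[m [-> hm]]]]]; last by exists m.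
    by exists (Vatom hm); split=> //; exists m.
  by apply: small_img (small_elt _) _; def.
by apply/(setofP sP); exists (Vatom hn); split=> //; exists n.
Qed.

Lemma sat_su_str (s : symuniv S) (I : interp) :
  (forall σ : nat -> S, sat σ (carrier I 0) <-> su_dom s (σ 0)) ->
  (forall (σ : nat -> S) i j, su_dom s (σ i) -> su_dom s (σ j) ->
     sat σ (mem_rel I i j) <-> su_elt s (σ i) (σ j)) ->
  (forall (σ : nat -> S) i, su_dom s (σ i) -> sat σ (atom_rel I i) <-> σ i ∊ su_atoms s) ->
  forall φ (ρ : nat -> S) (τ : nat -> su_str s), sentence φ -> sat ρ (relativize I φ) <-> sat τ φ.
Proof.
move=> hc hm ha φ ρ τ hφ.
apply: (@sat_relativize S (su_str s) sval I _ _ _ _ φ (fun _ => false)) => //.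
- by move=> [x hx] [y hy] /= e; apply: eq_exist.
- by move=> σ; rewrite hc; split=> [h|[[x hx] /= ->]] //; exists (exist _ _ h).
- by move=> σ i j [u hu] [t ht] /= eu et; rewrite hm ?eu ?et.
- by move=> σ i [u hu] /= eu; rewrite ha ?eu.
exact: bounded_fv hφ _.
Qed.

Hypothesis atoms_infinite : ~ Fin (atoms : S).

Lemma atoms_infinite' : ~ Fin (setof (fun t : S => exists u : S, t = id u /\ atm u)).
Proof.
rewrite (_ : setof _ = atoms) //; apply: eq_setof => t.
by split=> [[u [-> //]]|h]; exists t.
Qed.

Lemma PM_equivalent φ (ρ : nat -> S) : sentence φ ->
  sat ρ (relativize PM_Sym φ) <-> sat ρ (relativize (PM_str isPureEqN) φ).
Proof.
move=> hφ; pose s1 := @symuniv_of_emb S zf S zf id embedding_id atoms_infinite'.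
pose s2 := @symuniv_of_emb S zf _ (@ZF_Vstr S zf) sval embedding_Vstr Vstr_atoms_infinite.
have h1 : sat ρ (relativize PM_Sym φ) <-> sat (fun _ => pt : su_str s1) φ.
  apply: (@sat_su_str s1 PM_Sym) => //.
  - by move=> σ; rewrite sat_PM_Sym; split=> [h|[u [-> //]]]; exists (σ 0).
  - move=> σ i j _ _; split=> [h|[u [t [e1 [e2 h]]]]]; first by exists (σ i), (σ j).
    by change (σ i ∊ σ j); rewrite e1 e2.
  - by move=> σ i _; exact: (iff_sym (@in_emb_atoms S zf S zf id embedding_id (σ i))).
have h2 : sat ρ (relativize (PM_str isPureEqN) φ) <-> sat (fun _ => pt : su_str s2) φ.
  apply: (@sat_su_str s2 (PM_str isPureEqN)) => //.
  - by move=> σ; apply: sat_PM_str.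
  - move=> σ i j [u [eu _]] [t [et _]]; rewrite (sat_mem_U eu et) eu et.
    exact: (iff_sym (emb_eltE embedding_Vstr u t)).
  - move=> σ i [u [eu _]]; rewrite (sat_atom_U eu) eu.
    exact: (iff_sym (@in_emb_atoms S zf _ (@ZF_Vstr S zf) sval embedding_Vstr u)).
by rewrite h1 h2; apply: su_elementary.
Qed.

End TwoModels.

(** * From models to provability *)

(** Obtained from the syntactic [ren_bounded]: in [mix ρ σ] the renaming [double] reads ρ, while r
    reads ρ below n and σ above, which amounts to σ. Both renamings coincide below n. *)
Lemma sat_bounded (S : structure) n φ (ρ σ : nat -> S) :
  bounded n φ -> (forall i, i < n -> ρ i = σ i) -> sat ρ φ <-> sat σ φ.
Proof.
move=> hb h; pose r i := if i < n then i.*2 else i.*2.+1.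
have e : ren double φ = ren r φ by apply: (ren_bounded hb) => i; rewrite /r => ->.
have e1 : mix ρ σ \o double =1 ρ by move=> i; apply: mix_even.
have e2 : mix ρ σ \o r =1 σ.
  by move=> i; rewrite /= /r; case: ifP => [/h <-|_]; rewrite ?mix_even ?mix_odd.
by rewrite -(eq_sat φ e1) -(eq_sat φ e2) -!sat_ren e.
Qed.

Lemma bounded_closure m n φ : bounded m (iter n fAll φ) = bounded (n + m) φ.
Proof. by elim: n m => //= n IH m; rewrite IH addnS. Qed.

Lemma sat_closure (S : structure) n φ (ρ σ : nat -> S) :
  bounded n φ -> sat ρ (iter n fAll φ) -> sat σ φ.
Proof.
move=> hb h.
(* What the assignment τ becomes once the n outer quantifiers have been instantiated with the values
   of σ. *)
pose env n (τ : nat -> S) i := if i < n then σ i else τ (i - n).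
suff : sat (env n ρ) φ by apply: (sat_bounded hb _).1 => i; rewrite /env => ->.
elim: n ρ h {hb} => [|n IH] τ /=.
  by have e : τ =1 env 0 τ by [move=> i; rewrite /env subn0]; apply: (eq_sat φ e).1.
move=> /(_ (σ n))/IH.
have e : env n (scons (σ n) τ) =1 env n.+1 τ; last exact: (eq_sat φ e).1.
move=> i; rewrite /env ltnS.
by have [lt|gt|->] := ltngtP i n; rewrite ?subnn // -(subnSK gt).
Qed.

Section ModelOfZFA.
Variables (S : structure) (ρ : nat -> S).
Hypothesis hS : forall ψ, ZFA_ACpure ψ -> sat ρ ψ.

Let hZ ψ : ZFA ψ -> sat ρ ψ. Proof. by move=> h; apply: hS; left. Qed.

Lemma ZF_of_sat : ZF S.
Proof.
split.
- by move=> x y sx sy h; apply: (hZ ZFA_ext).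
- by move=> x h; apply: (hZ ZFA_found).
- by move=> x y; apply: (hZ ZFA_pair).
- by move=> x; apply: (hZ ZFA_union).
- by move=> x; apply: (hZ ZFA_power).
- have [b [_ [[e [eb he]] h]]] := hZ ZFA_inf; exists b; split; last exact: h.
  by exists e.
- move=> R /DefP2_sat[φ [c hR]] a ha.
  (* [axRepl] has the value at 0 and the argument at 1, the reverse of φ. *)
  pose ψ := ren (fun i => match i with 0 => 1 | 1 => 0 | _ => i end) φ.
  have hψ (τ : nat -> S) x y : τ =1 scons y (scons x c) -> sat τ ψ <-> R x y.
    by move=> /eq_sat ->; rewrite hR sat_ren; apply: eq_sat => -[|[|i]].
  have h1 : ZFA (iter (bound (axRepl ψ)) fAll (axRepl ψ)).
    by apply: ZFA_repl; apply: bounded_bound.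
  have := sat_closure c (bounded_bound _) (hZ h1).
  rewrite /axRepl; cbn [sat fAllIn fExIn fIff isSet fNot] => /(_ a).
  case.
    move=> x xa y y' /sat_ren r1 /sat_ren r2; apply: (ha x y y' xa).
      by apply: (hψ _ _ _ _).1 r1 => -[|[|i]].
    by apply: (hψ _ _ _ _).1 r2 => -[|[|i]].
  move=> b [sb hb]; exists b; split=> // y; split=> [/(hb y).1[x [xa /sat_ren r]]|[x [xa r]]].
    by exists x; split=> //; apply: (hψ _ _ _ _).1 r => -[|[|i]].
  apply: (hb y).2; exists x; split=> //; apply/sat_ren.
  by apply: (hψ _ _ _ _).2 r => -[|[|i]].
- by move=> x ax y; apply: (hZ ZFA_atomEmpty).
- exact: (hZ ZFA_atomSet).
Qed.

Lemma infinite_of_sat {zf : ZF S} : ~ Fin (atoms : S).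
Proof.
move=> f; have := hZ ZFA_atomInf; apply: (_ : sat ρ axAtomInf -> False).
move=> /(_ atoms) h.
have h1 : sat (scons atoms ρ) (isAtoms 0) by apply/sat_isAtoms.
by apply: (h h1); apply/sat_isFinSet/Fin_finset.
Qed.

End ModelOfZFA.

Lemma ZFA_ACpure_sentence φ : ZFA_ACpure φ -> sentence φ.
Proof.
by case=> [|-> //]; case=> // n ψ h; rewrite /sentence bounded_closure addn0.
Qed.

Theorem mainTheorem6 (φ : formula) (hφ : sentence φ) :
  ZFA_ACpure ⊢ relativize PM_Sym φ ↔ relativize (PM_str isPureEqN) φ.
Proof.
apply: (completeness ZFA_ACpure_sentence) => S ρ hS; have zf := ZF_of_sat hS.
exact: (PM_equivalent (infinite_of_sat hS) ρ hφ).
Qed.
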